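(* Let $T\in\mathbb{R}$, $\alpha\in(\frac13,\frac12]$, $\lambda=(\lambda^0,\lambda^1,\dots,\lambda^d)\in\mathbb{R}^{d+1}$ with positive entries and $\rho=(\rho^1,\dots,\rho^d)$ with $0<\rho^i<\lambda^i$ for $i=1,\dots,d$. Let $K\subset\mathscr{C}^{\alpha,\rho}_g((-\infty,T],\mathbb{R}^d)$ be a compact set and let $F:\mathscr{C}^{\alpha,\rho}_g((-\infty,T],\mathbb{R}^d)\to\mathbb{R}$ be continuous (for the exponentially weighted rough path topology). Then for any $\epsilon>0$ there exists $\ell\in T(\mathbb{R}^{d+1})$ such that, for all $\mathbf{X}\in K$, $$\big|F(\mathbf{X})-\langle\ell,\widehat{\mathbb{X}}^\lambda_T\rangle\big|<\epsilon,$$ where $\widehat{\mathbb{X}}^\lambda_T$ is the EFM-signature over $(-\infty,T]$ of the time-augmented (rough) path $\widehat{X}_t=(t,X_t)$.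
   Context: Tensors. Words $v=i_1\cdots i_n$ over an alphabet of $m$ letters index the basis of $(\mathbb{R}^m)^{\otimes n}$. $T(\mathbb{R}^m)$ is the space of finite linear combinations $\ell=\sum_v\ell^vv$ of words, and $\langle\ell,q\rangle=\sum_v\ell^vq^v$. For $\mu\in\mathbb{R}^m$ put $\mu^{i_1\cdots i_n}=\sum_k\mu^{i_k}$; $\mathbf{D}^\mu_h$ multiplies the coefficient of each word $v$ by $e^{-\mu^vh}$. $|\cdot|$ is the Euclidean norm. Weighted norm: $\|A\|_{\alpha,\rho}=\sup_{u<v\le T,\ v-u<1}|\mathbf{D}^\rho_{T-u}A_{u,v}|/|v-u|^\alpha$ for two-parameter tensor-valued functions. $\mathscr{C}^{\alpha,\rho}((-\infty,T],\mathbb{R}^d)$ is the set of pairs $\mathbf{X}=(\mathbb{X}^1,\mathbb{X}^2)$, with $\mathbb{X}^1_{s,t}=X_t-X_s\in\mathbb{R}^d$ the increments of a path and $\mathbb{X}^2_{s,t}\in(\mathbb{R}^d)^{\otimes2}$, such that $\|\mathbb{X}^1\|_{\alpha,\rho}<\infty$, $\|\mathbb{X}^2\|_{2\alpha,\rho}<\infty$ and $\mathbb{X}^2_{s,t}=\mathbb{X}^2_{s,u}+\mathbb{X}^2_{u,t}+\mathbb{X}^1_{s,u}\otimes\mathbb{X}^1_{u,t}$ for $s\le u\le t\le T$. $\mathscr{C}^{\alpha,\rho}_g$ is the subset of weakly geometric ones: $\mathrm{Sym}(\mathbb{X}^2_{s,t})=\frac12\mathbb{X}^1_{s,t}\otimes\mathbb{X}^1_{s,t}$.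 The topology is induced by $\varrho_{\alpha,\rho}(\mathbf{X},\mathbf{Y})=\|\mathbb{X}^1-\mathbb{Y}^1\|_{\alpha,\rho}+\|\mathbb{X}^2-\mathbb{Y}^2\|_{2\alpha,\rho}$. Time augmentation. Letters of $\widehat X=(t,X)$ are $0,1,\dots,d$, with $\widehat X^0_t=t$. $\widehat{\mathbf{X}}=(\widehat{\mathbb{X}}^1,\widehat{\mathbb{X}}^2)$ is the rough path over $\mathbb{R}^{d+1}$ with $\widehat{\mathbb{X}}^{1}_{s,t}=(t-s,\mathbb{X}^1_{s,t})$, second-level components with both letters in $\{1,\dots,d\}$ given by $\mathbb{X}^2$, and components involving the letter $0$ given by the canonical (Young) integrals $\int_s^t\widehat{\mathbb{X}}^{1,i}_{s,r}\,d\widehat X^j_r$. EFM-signature of $\widehat{\mathbf X}$. $\widehat{\mathbb{X}}^{\lambda,0}_t=1$ (level $0$) and $\widehat{\mathbb{X}}^{\lambda,n+1}_t=\lim_{R\to-\infty}\int_R^t\mathbf{D}^\lambda_{t-u}(\widehat{\mathbb{X}}^{\lambda,n}_u\,d\widehat{\mathbf{X}}_u)$, where the integral over $[R,t]$ is the limit, over partitions with mesh tending to $0$, of $\sum_{[u,v]}\mathbf{D}^\lambda_{t-u}\big(\widehat{\mathbb{X}}^{\lambda,n}_u\otimes\widehat{\mathbb{X}}^1_{u,v}+\widehat{\mathbb{X}}^{\lambda,n-1}_u\otimes\widehat{\mathbb{X}}^2_{u,v}\big)$ (with $\widehat{\mathbb{X}}^{\lambda,-1}:=0$). *)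

(* Defs.v *)
From HB Require Import structures.
From mathcomp Require Import all_boot all_order all_algebra.
From mathcomp Require Import finmap.
From mathcomp Require Import all_classical all_reals all_analysis.
From mathcomp Require Import ring lra.

Set Implicit Arguments.
Unset Strict Implicit.
Unset Printing Implicit Defensive.

Import Order.TTheory GRing.Theory Num.Theory.
Import numFieldNormedType.Exports.

Local Open Scope classical_set_scope.
Local Open Scope ring_scope.

(* Coefficient families indexed by words, i.e., formal tensor series; the
   elements of (R^m)^{\otimes n} are the families carried by the words of
   length n.  The letters of R^m are the elements of 'I_m. *)
Definition tensor (R : realType) (m : nat) := seq 'I_m -> R.

Definition homogeneous (R : realType) (m n : nat) (a : tensor R m) :=
  forall w, size w != n -> a w = 0.

(* Concatenation product: the coefficient at w is the sum over the ways of
   cutting w in two. *)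
Definition tmul (R : realType) (m : nat) (a b : tensor R m) : tensor R m :=
  fun w => \sum_(k < (size w).+1) a (take k w) * b (drop k w).

Definition word_weight (R : realType) (m : nat) (mu : 'rV[R]_m)
    (w : seq 'I_m) : R :=
  \sum_(k <- w) mu 0 k.

Definition dilate (R : realType) (m : nat) (mu : 'rV[R]_m) (h : R)
    (a : tensor R m) : tensor R m :=
  fun w => expR (- (word_weight mu w * h)) * a w.

(* Euclidean norm of the component of degree n *)
Definition tnorm (R : realType) (m n : nat) (a : tensor R m) : R :=
  Num.sqrt (\sum_(w : n.-tuple 'I_m) a w ^+ 2).

(* T(R^m) is {fsfun seq 'I_m -> R with 0}. *)
Definition pairing (R : realType) (m : nat)
    (ell : {fsfun seq 'I_m -> R with 0}) (q : tensor R m) : R :=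
  \sum_(w <- finsupp ell) ell w * q w.

Definition two_param (R : realType) (m : nat) := R -> R -> tensor R m.

Definition weighted_norm (R : realType) (m : nat) (T alpha : R)
    (rho : 'rV[R]_m) (n : nat) (A : two_param R m) : \bar R :=
  ereal_sup [set x | exists u v, [/\ u < v, v <= T, v - u < 1 &
    x = (tnorm n (dilate rho (T - u) (A u v)) / `|v - u| `^ alpha)%:E]].

(* The two levels live on {s <= t <= T}; the first condition extends them by 0
   to total functions, so that a rough path is determined by its values on that
   set. *)
Definition is_rough_path (R : realType) (d : nat) (T alpha : R)
    (rho : 'rV[R]_d) (X : two_param R d * two_param R d) : Prop :=
  [/\ forall s t, ~~ (s <= t <= T) -> X.1 s t = (fun=> 0) /\ X.2 s t = (fun=> 0),
      forall s t, homogeneous 1 (X.1 s t) /\ homogeneous 2 (X.2 s t),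
      exists x : R -> tensor R d, forall s t, s <= t -> t <= T ->
        X.1 s t = (fun w => x t w - x s w),
      (weighted_norm T alpha rho 1 X.1 < +oo)%E /\
      (weighted_norm T (2 * alpha) rho 2 X.2 < +oo)%E &
      forall s u t, s <= u -> u <= t -> t <= T ->
        X.2 s t =
        (fun w => X.2 s u w + X.2 u t w + tmul (X.1 s u) (X.1 u t) w)].

Definition sym2 (R : realType) (m : nat) (a : tensor R m) : tensor R m :=
  fun w => (a w + a (rev w)) / 2.

Definition weakly_geometric (R : realType) (d : nat) (T : R)
    (X : two_param R d * two_param R d) : Prop :=
  forall s t, s <= t -> t <= T ->
    sym2 (X.2 s t) = (fun w => 2^-1 * tmul (X.1 s t) (X.1 s t) w).

Record geo_rough_path (R : realType) (d : nat) (T alpha : R)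
    (rho : 'rV[R]_d) := GeoRoughPath {
  grp_val :> two_param R d * two_param R d;
  grp_rough : is_rough_path T alpha rho grp_val;
  grp_geo : weakly_geometric T grp_val }.

Definition rp_sub (R : realType) (m : nat) (A B : two_param R m) :
    two_param R m :=
  fun s t w => A s t w - B s t w.

Definition rp_dist (R : realType) (d : nat) (T alpha : R) (rho : 'rV[R]_d)
    (X Y : two_param R d * two_param R d) : R :=
  fine (weighted_norm T alpha rho 1 (rp_sub X.1 Y.1) +
        weighted_norm T (2 * alpha) rho 2 (rp_sub X.2 Y.2))%E.

Section tnorm_theory.
Context {R : realType} {m n : nat}.
Implicit Types a b : tensor R m.

Lemma sqr_sum_mul_le (I : finType) (f g : I -> R) :
  (\sum_i f i * g i) ^+ 2 <= (\sum_i f i ^+ 2) * (\sum_i g i ^+ 2).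
Proof.
rewrite -subr_ge0 -(@pmulr_rge0 _ 2)//.
suff -> : 2 * ((\sum_i f i ^+ 2) * (\sum_i g i ^+ 2) - (\sum_i f i * g i) ^+ 2)
    = \sum_i \sum_j (f i * g j - f j * g i) ^+ 2.
  by apply: sumr_ge0 => i _; apply: sumr_ge0 => j _; exact: sqr_ge0.
transitivity (\sum_i \sum_j (f i ^+ 2 * g j ^+ 2 + f j ^+ 2 * g i ^+ 2
    - 2 * ((f i * g i) * (f j * g j)))); last first.
  by apply: eq_bigr => i _; apply: eq_bigr => j _; ring.
under [RHS]eq_bigr do
  rewrite big_split/= big_split/= sumrN -mulr_sumr -mulr_suml -mulr_sumr -mulr_sumr.
rewrite big_split/= big_split/= sumrN -mulr_suml -2!mulr_sumr -mulr_suml.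
ring.
Qed.

Lemma tnorm_ge0 a : 0 <= tnorm n a.
Proof. exact: sqrtr_ge0. Qed.

Lemma ler_tnormD a b : tnorm n (fun w => a w + b w) <= tnorm n a + tnorm n b.
Proof.
have ge0 (c : tensor R m) : 0 <= \sum_(w : n.-tuple 'I_m) c w ^+ 2.
  by apply: sumr_ge0 => i _; exact: sqr_ge0.
rewrite -(@ler_pXn2r _ 2)// ?nnegrE ?addr_ge0 ?tnorm_ge0//.
rewrite sqrrD !sqr_sqrtr//; last exact: (ge0 (fun w => a w + b w)).
under eq_bigr do rewrite sqrrD.
rewrite big_split/= big_split/= lerD2r lerD2l sumrMnl lerMn2r/=.
rewrite -sqrtrM// (le_trans (ler_norm _))// -sqrtr_sqr ler_wsqrtr//.
exact: (sqr_sum_mul_le (fun w : n.-tuple 'I_m => a w) (fun w => b w)).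
Qed.

Lemma tnormN a : tnorm n (fun w => - a w) = tnorm n a.
Proof. by congr Num.sqrt; apply: eq_bigr => w _; rewrite sqrrN. Qed.

Lemma tnorm_le0 a w : tnorm n a <= 0 -> size w = n -> a w = 0.
Proof.
move=> a0 /eqP wn; have h : \sum_(v : n.-tuple 'I_m) a v ^+ 2 <= 0.
  by rewrite -sqrtr_eq0 eq_le a0 tnorm_ge0.
move: h; rewrite (bigD1 (Tuple wn))//= => h; apply/eqP; rewrite -sqrf_eq0 eq_le sqr_ge0.
rewrite andbT (le_trans _ h)// lerDl.
by apply: sumr_ge0 => i _; exact: sqr_ge0.
Qed.

End tnorm_theory.

Section weighted_norm_theory.
Context {R : realType} {m n : nat} (T alpha : R) (rho : 'rV[R]_m).
Implicit Types A B C : two_param R m.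
Local Notation wnorm := (weighted_norm T alpha rho n).

Lemma weighted_norm_ub A u v : u < v -> v <= T -> v - u < 1 ->
  ((tnorm n (dilate rho (T - u) (A u v)) / `|v - u| `^ alpha)%:E <= wnorm A)%E.
Proof. by move=> uv vT vu1; apply: ereal_sup_ubound; exists u, v. Qed.

Lemma weighted_norm_ge0 A : (0 <= wnorm A)%E.
Proof.
have h : T - 2^-1 < T by lra.
have h1 : T - (T - 2^-1) < 1 by lra.
apply: (le_trans _ (weighted_norm_ub A h (lexx _) h1)).
by rewrite lee_fin divr_ge0// ?tnorm_ge0// powR_ge0.
Qed.

Lemma weighted_norm_triangle A B C :
  (wnorm (rp_sub A C) <= wnorm (rp_sub A B) + wnorm (rp_sub B C))%E.
Proof.
apply: ge_ereal_sup => _ [u [v [uv vT vu1 ->]]].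
apply: (le_trans _ (leeD (weighted_norm_ub (rp_sub A B) uv vT vu1)
                         (weighted_norm_ub (rp_sub B C) uv vT vu1))).
rewrite -EFinD lee_fin -mulrDl ler_wpM2r ?invr_ge0 ?powR_ge0//.
apply: (le_trans _ (ler_tnormD _ _)).
rewrite le_eqVlt; apply/orP; left; apply/eqP; congr Num.sqrt.
apply: eq_bigr => w _; congr (_ ^+ 2).
by rewrite /dilate /rp_sub -mulrDr addrA subrK.
Qed.

Lemma weighted_norm_sym A B : wnorm (rp_sub A B) = wnorm (rp_sub B A).
Proof.
rewrite /weighted_norm; congr ereal_sup; apply/seteqP.
by split => _ [u [v [uv vT vu1 ->]]]; exists u, v; split => //;
  rewrite -tnormN; congr (tnorm _ _ / _)%:E; apply/funext => w;
  rewrite /dilate /rp_sub -mulrN opprB.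
Qed.

Lemma weighted_norm_xx A : wnorm (rp_sub A A) = 0%E.
Proof.
apply/eqP; rewrite eq_le weighted_norm_ge0 andbT.
apply: ge_ereal_sup => _ [u [v [uv vT vu1 ->]]].
rewrite lee_fin /tnorm big1 ?sqrtr0 ?mul0r// => w _.
by rewrite /dilate /rp_sub subrr mulr0 expr0n.
Qed.

Lemma weighted_norm_sub_lty A B :
  (wnorm A < +oo)%E -> (wnorm B < +oo)%E -> (wnorm (rp_sub A B) < +oo)%E.
Proof.
move=> Aoo Boo; pose Z : two_param R m := fun _ _ _ => 0.
have E C : wnorm (rp_sub C Z) = wnorm C.
  congr (weighted_norm _ _ _ _ _); apply/funext => u; apply/funext => v.
  by apply/funext => w; rewrite /rp_sub subr0.
apply: (le_lt_trans (weighted_norm_triangle A Z B)).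
by rewrite (weighted_norm_sym Z) !E lte_add_pinfty.
Qed.

Lemma weighted_norm_sub_eq0 A B : wnorm (rp_sub A B) = 0%E ->
  forall u v w, u < v -> v <= T -> v - u < 1 -> size w = n -> A u v w = B u v w.
Proof.
move=> AB0 u v w uv vT vu1 wn.
have := weighted_norm_ub (rp_sub A B) uv vT vu1.
rewrite AB0 lee_fin pmulr_lle0; last first.
  by rewrite invr_gt0 powR_gt0// normr_gt0 subr_eq0 gt_eqF.
move=> /tnorm_le0 /(_ wn) /eqP; rewrite mulf_eq0 gt_eqF ?expR_gt0//=.
by rewrite /rp_sub subr_eq0 => /eqP.
Qed.

End weighted_norm_theory.

Section geo_rough_path_metric.
Context {R : realType} {d : nat} (T alpha : R) (rho : 'rV[R]_d).
Local Notation C := (geo_rough_path T alpha rho).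
Implicit Types X Y Z : C.

HB.instance Definition _ := gen_eqMixin C.
HB.instance Definition _ := gen_choiceMixin C.

Let fin1 X Y :
  weighted_norm T alpha rho 1 (rp_sub X.1 Y.1) \is a fin_num.
Proof.
rewrite ge0_fin_numE ?weighted_norm_ge0//.
by apply: weighted_norm_sub_lty;
  [have [_ _ _ []] := grp_rough X|have [_ _ _ []] := grp_rough Y].
Qed.

Let fin2 X Y :
  weighted_norm T (2 * alpha) rho 2 (rp_sub X.2 Y.2) \is a fin_num.
Proof.
rewrite ge0_fin_numE ?weighted_norm_ge0//.
by apply: weighted_norm_sub_lty;
  [have [_ _ _ []] := grp_rough X|have [_ _ _ []] := grp_rough Y].
Qed.

Let dist X Y : R := rp_dist T alpha rho X Y.

Let distxx X : dist X X = 0.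
Proof. by rewrite /dist /rp_dist !weighted_norm_xx adde0. Qed.

Let dist_sym X Y : dist X Y = dist Y X.
Proof.
by rewrite /dist /rp_dist weighted_norm_sym [X in (_ + X)%E]weighted_norm_sym.
Qed.

Let dist_triangle Y X Z : dist X Z <= dist X Y + dist Y Z.
Proof.
rewrite /dist /rp_dist -fineD ?fin_numD ?fin1 ?fin2//.
apply: fine_le; rewrite ?fin_numD ?fin1 ?fin2//.
by rewrite addeACA leeD// weighted_norm_triangle.
Qed.

Let chen1 X s u t w : s <= u -> u <= t -> t <= T ->
  X.1 s t w = X.1 s u w + X.1 u t w.
Proof.
move=> su ut tT; have [_ _ [x xE] _ _] := grp_rough X.
rewrite !xE// ?(le_trans su)// ?(le_trans ut)//; ring.
Qed.

Let dist_eq0 X Y : dist X Y = 0 -> X = Y.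
Proof.
move=> XY0.
have /eqP : (weighted_norm T alpha rho 1 (rp_sub X.1 Y.1) +
    weighted_norm T (2 * alpha) rho 2 (rp_sub X.2 Y.2))%E = 0%E.
  by rewrite -[LHS]fineK ?fin_numD ?fin1 ?fin2//; congr EFin.
rewrite padde_eq0 ?weighted_norm_ge0// => /andP[/eqP XY1 /eqP XY2].
have [Xs Xh _ _ Xc] := grp_rough X; have [Ys Yh _ _ Yc] := grp_rough Y.
have diag s : s <= T -> X.1 s s = Y.1 s s /\ X.2 s s = Y.2 s s.
  move=> sT; suff H Z : Z.1 s s = (fun=> 0) /\ Z.2 s s = (fun=> 0).
    by have [-> ->] := H X; have [-> ->] := H Y.
  have Z1 : Z.1 s s = (fun=> 0).
    by apply/funext => w; have := chen1 Z w (lexx s) (lexx s) sT; lra.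
  split=> //; apply/funext => w; have [_ _ _ _ Zc] := grp_rough Z.
  have := congr1 (fun f => f w) (Zc s s s (lexx _) (lexx _) sT).
  rewrite /= Z1 /tmul big1 ?addr0; last by move=> i _; rewrite mul0r.
  lra.
have short s t : s < t -> t <= T -> t - s < 1 ->
    X.1 s t = Y.1 s t /\ X.2 s t = Y.2 s t.
  move=> st tT ts1; split; apply/funext => w.
    have [w1|w1] := eqVneq (size w) 1.
      exact: (weighted_norm_sub_eq0 XY1).
    by rewrite (Xh s t).1 ?(Yh s t).1.
  have [w2|w2] := eqVneq (size w) 2.
    exact: (weighted_norm_sub_eq0 XY2).
  by rewrite (Xh s t).2 ?(Yh s t).2.
have step n : forall s t, s <= t -> t <= T -> t - s < n%:R / 2 ->
    X.1 s t = Y.1 s t /\ X.2 s t = Y.2 s t.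
  elim: n => [s t st tT ts|n ih s t]; first by exfalso; lra.
  rewrite le_eqVlt => /orP[/eqP <- sT _|st tT tsn]; first exact: diag.
  have [ts1|ts1] := ltP (t - s) 1; first exact: short.
  have su : s < s + 2^-1 by lra.
  have ut : s + 2^-1 <= t by lra.
  have [E1 E2] : X.1 s (s + 2^-1) = Y.1 s (s + 2^-1) /\
                 X.2 s (s + 2^-1) = Y.2 s (s + 2^-1).
    by apply: short => //; lra.
  have [F1 F2] : X.1 (s + 2^-1) t = Y.1 (s + 2^-1) t /\
                 X.2 (s + 2^-1) t = Y.2 (s + 2^-1) t.
    by apply: ih => //; move: tsn; rewrite -natr1 mulrDl; lra.
  split; last by rewrite (Xc _ _ _ (ltW su) ut tT) (Yc _ _ _ (ltW su) ut tT)
    E1 E2 F1 F2.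
  by apply/funext => w; rewrite (chen1 X w (ltW su) ut tT)
    (chen1 Y w (ltW su) ut tT) E1 F1.
have XY s t : X.1 s t = Y.1 s t /\ X.2 s t = Y.2 s t.
  have [/andP[st tT]|st] := boolP (s <= t <= T); last first.
    by have [-> ->] := Xs _ _ st; have [-> ->] := Ys _ _ st.
  have ts0 : 0 <= 2 * (t - s) by lra.
  apply: (step (Num.bound (2 * (t - s)))) => //.
  have := archi_boundP ts0; lra.
have {}XY : grp_val X = grp_val Y.
  apply: injective_projections; apply/funext => s; apply/funext => t.
    exact: (XY s t).1.
  exact: (XY s t).2.
case: X Y XY {XY0 XY1 XY2 Xs Xh Xc Ys Yh Yc diag short step} =>
  [x xr xg] [y yr yg] /= xy.
by subst y; congr GeoRoughPath; exact: Prop_irrelevance.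
Qed.

HB.instance Definition _ :=
  isMetric.Build R C distxx dist_eq0 dist_sym dist_triangle.

End geo_rough_path_metric.

Section riemann_sums.
Context {R : realType}.
Implicit Types (Xi : R -> R -> R) (s t : R) (p : seq R).

(* The partition s = x_0 < x_1 < ... < x_n = t is encoded, as in
   [itv_partition], by the sequence [:: x_1; ...; x_n]. *)
Definition mesh s t p : R :=
  \big[Num.max/0]_(0 <= k < size p) (nth t p k - nth t (s :: p) k).

Definition riemann_sum Xi s t p : R :=
  \sum_(0 <= k < size p) Xi (nth t (s :: p) k) (nth t p k).

Definition mesh_filter s t : set_system (seq R) :=
  filter_from [set delta : R | 0 < delta]
    (fun delta => [set p | itv_partition s t p /\ mesh s t p < delta]).

Definition mesh_lim Xi s t : R := lim (riemann_sum Xi s t @ mesh_filter s t).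

End riemann_sums.

(* The letter 0 of R^{d+1} is time and [lift ord0 i] is the letter i of R^d. *)
Definition time_aug1 (R : realType) (d : nat) (X1 : two_param R d) :
    two_param R d.+1 :=
  fun s t w =>
    if w is [:: k] then
      if unlift ord0 k is Some i then X1 s t [:: i] else t - s
    else 0.

(* Limit of the left-point Riemann sums; the integrator only enters through its
   increments, which are the entries of X1. *)
Definition young_int (R : realType) (m : nat) (X1 : two_param R m)
    (k l : 'I_m) (s t : R) : R :=
  mesh_lim (fun u v => X1 s u [:: k] * X1 u v [:: l]) s t.

Definition time_aug2 (R : realType) (d : nat)
    (X : two_param R d * two_param R d) : two_param R d.+1 :=
  fun s t w =>
    if w is [:: k; l] then
      match unlift ord0 k, unlift ord0 l with
      | Some i, Some j => X.2 s t [:: i; j]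
      | _, _ => young_int (time_aug1 X.1) k l s t
      end
    else 0.

Definition time_aug (R : realType) (d : nat)
    (X : two_param R d * two_param R d) :
    two_param R d.+1 * two_param R d.+1 :=
  (time_aug1 X.1, time_aug2 X).

(* [efm_level lam X n t] is the level n, as a tensor carried by the words of
   length n; the limits are taken coefficientwise.  [prev] is the level below [cur],
   which is 0 when [cur] is the level 0. *)
Fixpoint efm_level (R : realType) (m : nat) (lam : 'rV[R]_m)
    (X : two_param R m * two_param R m) (n : nat) : R -> tensor R m :=
  match n with
  | 0 => fun _ w => (w == [::])%:R
  | n'.+1 =>
    let cur := efm_level lam X n' in
    let prev := if n' is n''.+1 then efm_level lam X n'' else fun _ _ => 0 in
    fun t w => lim ((fun a => mesh_lim (fun u v =>
      dilate lam (t - u)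
        (fun w' => tmul (cur u) (X.1 u v) w' + tmul (prev u) (X.2 u v) w') w)
      a t) @ -oo)
  end.

Definition efm_signature (R : realType) (m : nat) (lam : 'rV[R]_m)
    (X : two_param R m * two_param R m) (t : R) : tensor R m :=
  fun w => efm_level lam X (size w) t w.

(* Main.v *)
Require Import Defs.
From HB Require Import structures.
From mathcomp Require Import all_boot all_order all_algebra.
From mathcomp Require Import finmap.
From mathcomp Require Import all_classical all_reals all_analysis.
From mathcomp Require Import ring lra.

(** Why the theorem is true.  By the theorem of Stone and Weierstrass
    ([stone_weierstrass]), it suffices that the functions that send a rough path to a
    linear functional of its signature at time [T] form an algebra of continuous
    functions that contains the constants and separates rough paths.

    Representation.  The fading-memory weight of a word is the sum of the weights of
    its letters.  Distributed over the integrators, it turns the signature at [T] into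
    the plain signature over the half-line of the weighted levels [weighted1] and
    [weighted2] ([efm_levelE]); the hypothesis [rho < lam] is exactly what makes these
    levels decay at minus infinity.  They satisfy Chen's relation only up to errors of
    order [3 * alpha], but [3 * alpha > 1], so that their iterated integrals
    [iter_sig] can be constructed by sewing ([sew_increment], [sig_estimates]).  For
    the same reason the entries that mix time and space may be dropped.  An iterated
    integral is then characterized by its second-order local expansion and by its
    decay, since a function whose increments are of order larger than 1 is constant
    ([zero_of_small_increments]).

    Algebra.  The product of two coordinates and the corresponding shuffle sum have the
    same local expansion, thanks to weak geometricity ([sig_shuffle]).

    Continuity.  Coordinates are limits of Riemann sums, uniformly on bounded sets of
    rough paths ([sig_continuous]).

    Separation.  Suppose that [X] and [Y] have the same signature at [T].  The word with
    the single letter of time yields the clock [expR (- (lam 0 ord0 * (T - t)))], and by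
    the shuffle product, polynomials of the clock times any coordinate can be integrated
    in time by a linear functional.  So all moments of the difference of a coordinate
    along [X] and along [Y] vanish, and the coordinate is the same for [X] and [Y] at all
    times ([sig_separates]).  Local expansions of the coordinates with one and two
    letters then recover both levels of the rough path ([sig_injective]). *)

Set Implicit Arguments.
Unset Strict Implicit.
Unset Printing Implicit Defensive.

Import Order.TTheory GRing.Theory Num.Theory.
Import numFieldNormedType.Exports.

Local Open Scope classical_set_scope.
Local Open Scope ring_scope.

(** * Riemann sums along partitions *)
Section riemann_sums_along_lists.
Context {R : realType}.
Implicit Types (Xi : R -> R -> R) (s t u v eta : R) (p q : seq R).

(** The recursive form of [riemann_sum], along which partitions can be cut and
    concatenated without indices. *)
Fixpoint rsum Xi s p : R :=
  if p is x :: q then Xi s x + rsum Xi x q else 0.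

Definition fine_path eta s p := path (fun u v => v - u < eta) s p.

Lemma riemann_sumE Xi s t p : riemann_sum Xi s t p = rsum Xi s p.
Proof.
elim: p s => [|x p ih] s; first by rewrite /riemann_sum big_nil.
by rewrite /riemann_sum/= big_nat_recl//=; congr (_ + _); exact: ih.
Qed.

Lemma mesh_ltP s t p eta : 0 < eta -> (mesh s t p < eta) = fine_path eta s p.
Proof.
move=> eta0; elim: p s => [|x p ih] s; first by rewrite /mesh big_nil.
rewrite /mesh/= big_ltn// big_add1/= gt_max; congr andb; exact: ih.
Qed.

Lemma rsum_cat Xi s p q : rsum Xi s (p ++ q) = rsum Xi s p + rsum Xi (last s p) q.
Proof. by elim: p s => [|x p ih] s /=; rewrite ?add0r// ih addrA. Qed.

Lemma rsum_telescope (f : R -> R) s p :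
  rsum (fun u v => f v - f u) s p = f (last s p) - f s.
Proof. by elim: p s => [|x p ih] s /=; [rewrite subrr|rewrite ih; ring]. Qed.

Lemma rsum_dist Xi Xi' (C eta : R) s t p :
  itv_partition s t p -> fine_path eta s p ->
  (forall u v, s <= u -> u < v -> v <= t -> v - u < eta ->
    `|Xi u v - Xi' u v| <= C * (v - u)) ->
  `|rsum Xi s p - rsum Xi' s p| <= C * (t - s).
Proof.
elim: p s => [|x p ih] s /= sp; first by move: (itv_partition_nil sp) => -> _ _; rewrite !subrr mulr0 normr0.
move=> /andP[xs fp] H.
have xp := itv_partition_cons sp.
have sx : s < x by case: sp => /= /andP[].
have xt := itv_partition_le xp.
have -> : Xi s x + rsum Xi x p - (Xi' s x + rsum Xi' x p) =
  (Xi s x - Xi' s x) + (rsum Xi x p - rsum Xi' x p) by ring.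
rewrite (le_trans (ler_normD _ _))//.
have -> : C * (t - s) = C * (x - s) + C * (t - x) by ring.
apply: lerD; first exact: H; apply: ih => // u v xu; apply: H; exact: le_trans (ltW sx) xu.
Qed.

Lemma rsum_ge Xi (c eta : R) s t p :
  itv_partition s t p -> fine_path eta s p ->
  (forall u v, s <= u -> u < v -> v <= t -> v - u < eta ->
    c * (v - u) <= Xi u v) ->
  c * (t - s) <= rsum Xi s p.
Proof.
elim: p s => [|x p ih] s /= sp; first by move: (itv_partition_nil sp) => -> _ _; rewrite !subrr mulr0.
move=> /andP[xs fp] H.
have xp := itv_partition_cons sp.
have sx : s < x by case: sp => /= /andP[].
have xt := itv_partition_le xp.
have -> : c * (t - s) = c * (x - s) + c * (t - x) by ring.
apply: lerD; first exact: H; apply: ih => // u v xu; apply: H; exact: le_trans (ltW sx) xu.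
Qed.

Lemma exists_fine_partition eta s t : 0 < eta -> s <= t ->
  exists p, itv_partition s t p /\ fine_path eta s p.
Proof.
move=> eta0.
have step n : forall s, s <= t -> t - s < n%:R * (eta / 2) ->
    exists p, itv_partition s t p /\ fine_path eta s p.
  elim: n => [|n ih] {}s; first by rewrite mul0r subr_lt0 => st /(le_lt_trans st); rewrite ltxx.
  rewrite le_eqVlt => /orP[/eqP <- _|st tsn]; first by exists [::].
  have [ts|ts] := ltP (t - s) eta.
    by exists [:: t]; split; [exact: itv_partition1|rewrite /fine_path/= ts].
  have [||p [ptp pf]] := ih (s + eta / 2); first by lra.
    by move: tsn; rewrite -natr1; lra.
  exists (s + eta / 2 :: p); split.
    by case: ptp => pp ll; split => //=; rewrite pp ltrDl divr_gt0.
  by rewrite /fine_path/= -/(fine_path _ _ _) pf andbT; lra.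
move=> st; have eta20 : 0 <= (t - s) / (eta / 2).
  by rewrite divr_ge0 ?subr_ge0 ?divr_ge0// ltW.
apply: (step (Num.bound ((t - s) / (eta / 2)))) => //.
by rewrite -ltr_pdivrMr ?divr_gt0// archi_boundP.
Qed.

Global Instance mesh_filter_filter s t : Filter (mesh_filter s t).
Proof.
apply: filter_from_filter; first by exists 1 => /=.
move=> i j /= i0 j0; exists (Num.min i j); first by rewrite /= lt_min i0.
by move=> p /= [sp]; rewrite lt_min => /andP[].
Qed.

Lemma mesh_filter_proper s t : s <= t -> ProperFilter (mesh_filter s t).
Proof.
move=> st; apply: filter_from_proper => e /= e0.
have [p [pp pf]] := exists_fine_partition e0 st.
by exists p; split => //; rewrite mesh_ltP.
Qed.

Lemma near_mesh eta s t (P : set (seq R)) : 0 < eta ->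
  (forall p, itv_partition s t p -> fine_path eta s p -> P p) ->
  \forall p \near mesh_filter s t, P p.
Proof.
by move=> eta0 H; exists eta => // p /= [sp]; rewrite mesh_ltP//; exact: H.
Qed.

Lemma mesh_limP Xi s t l : s <= t ->
  (forall e, 0 < e -> exists2 eta, 0 < eta & forall p,
    itv_partition s t p -> fine_path eta s p -> `|l - rsum Xi s p| <= e) ->
  mesh_lim Xi s t = l.
Proof.
move=> st H; have PF := mesh_filter_proper st.
apply: cvg_lim => //; apply/cvgrPdist_le => e e0.
have [eta eta0 He] := H _ e0.
by apply: (near_mesh eta0) => p sp fp; rewrite riemann_sumE; exact: He.
Qed.

(** A partition that contains [p] restricts to a partition of every cell of [p],
    so that the errors made on the cells add up. *)
Lemma rsum_refine Xi (C eta : R) p : forall s t q,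
  itv_partition s t p -> itv_partition s t q -> {subset p <= q} ->
  fine_path eta s p ->
  (forall u v r, s <= u -> u < v -> v <= t -> v - u < eta -> itv_partition u v r ->
    `|rsum Xi u r - Xi u v| <= C * (v - u)) ->
  `|rsum Xi s q - rsum Xi s p| <= C * (t - s).
Proof.
elim: p => [|x p ih] s t q sp sq pq.
  move: (itv_partition_nil sp) sq => -> /itv_partitionxx -> _ _.
  by rewrite /= subrr normr0 subrr mulr0.
rewrite /= => /andP[xs fp] H.
have xp := itv_partition_cons sp.
have sx : s < x by case: sp => /= /andP[].
have xt := itv_partition_le xp.
have xq : x \in q by apply: pq; rewrite mem_head.
have sq' : sorted <%O q by case: sq => /path_sorted.
have := in_itv_partition sq' xq; set q1 := itv_partitionL _ _; set q2 := itv_partitionR _ _ => qE.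
have lq1 : last s q1 = x by rewrite /q1 /itv_partitionL last_rcons.
have [q1P q2P] : itv_partition s x q1 /\ itv_partition x t q2.
  case: sq; rewrite qE cat_path last_cat lq1 => /andP[? ?] ?.
  by split; split => //; rewrite lq1.
rewrite qE rsum_cat lq1.
have -> : rsum Xi s q1 + rsum Xi x q2 - (Xi s x + rsum Xi x p) =
  (rsum Xi s q1 - Xi s x) + (rsum Xi x q2 - rsum Xi x p) by ring.
rewrite (le_trans (ler_normD _ _))//.
have -> : C * (t - s) = C * (x - s) + C * (t - x) by ring.
apply: lerD; first exact: H; apply: ih => //.
  move=> y yp; rewrite /q2 /itv_partitionR mem_filter pq ?inE ?yp ?orbT// andbT.
  case: sp => /= /andP[_ /(order_path_min lt_trans)/allP h _]; exact: h.
move=> u v r xu; apply: H; exact: le_trans (ltW sx) xu.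
Qed.

Lemma common_refinement s t p q : itv_partition s t p -> itv_partition s t q ->
  exists r, [/\ itv_partition s t r, {subset p <= r} & {subset q <= r}].
Proof.
move=> sp sq; exists (sort <=%O (undup (p ++ q))).
split; last 2 first.
- by move=> x xp; rewrite mem_sort mem_undup mem_cat xp.
- by move=> x xp; rewrite mem_sort mem_undup mem_cat xp orbT.
set r := sort _ _.
have rmem x : (x \in r) = (x \in p) || (x \in q) by rewrite mem_sort mem_undup mem_cat.
have rs : sorted <%O r by rewrite sort_lt_sorted undup_uniq.
have gtp (x : R) : x \in r -> s < x <= t.
  suff H p' : itv_partition s t p' -> x \in p' -> s < x <= t.
    by rewrite rmem => /orP[]; exact: H.
  move=> sp' xp'; have [/(order_path_min lt_trans)/allP h _] := sp'.
  rewrite h//=; have [k kp <-] := nthP t xp'.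
  by have := @itv_partition_nth_le _ _ s t p' k.+1 kp sp'.
split; first by rewrite lt_path_sortedE rs andbT; apply/allP => x /gtp /andP[].
have [s_t|st] := eqVneq s t.
  move: sp sq; rewrite /r -s_t => /itv_partitionxx -> /itv_partitionxx -> /=.
  by rewrite eqxx.
have tp : t \in p.
  case: (p) sp st => [/itv_partition_nil ->|y p' [_ /= /eqP <-] _]; first by rewrite eqxx.
  exact: mem_last.
have tr : t \in r by rewrite rmem tp.
case: (r) rs tr gtp => // y r' rs tr gtp /=.
rewrite eq_le; have /gtp/andP[_ ->/=] : last y r' \in y :: r' by exact: mem_last.
have [k kr <-] := nthP y tr.
rewrite -[last y r']/(last y (y :: r')) -nth_last.
by apply: (sorted_leq_nth le_trans (@le_refl _ R) y (sub_sorted (@ltW _ R) rs)) => //; rewrite inE.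

Qed.

(** Two partitions are compared through a common refinement; this makes Riemann
    sums Cauchy for the mesh. *)
Lemma rsum_cauchy Xi (C eta : R) s t p q :
  itv_partition s t p -> itv_partition s t q ->
  fine_path eta s p -> fine_path eta s q ->
  (forall u v r, s <= u -> u < v -> v <= t -> v - u < eta -> itv_partition u v r ->
    `|rsum Xi u r - Xi u v| <= C * (v - u)) ->
  `|rsum Xi s p - rsum Xi s q| <= 2 * (C * (t - s)).
Proof.
move=> sp sq fp fq H; have [r [sr pr qr]] := common_refinement sp sq.
have -> : rsum Xi s p - rsum Xi s q =
  - (rsum Xi s r - rsum Xi s p) + (rsum Xi s r - rsum Xi s q) by ring.
rewrite (le_trans (ler_normD _ _))// normrN mulr_natl mulr2n lerD//.
  exact: rsum_refine fp H.
exact: rsum_refine fq H.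
Qed.

Lemma split_path_at (m : R) p s : s <= m -> m < last s p ->
  exists p1 y p2, [/\ p = p1 ++ y :: p2, last s p1 <= m & m < y].
Proof.
elim: p s => [|x p ih] s sm /=; first by rewrite ltNge sm.
have [xm mp|mx _] := leP x m; last by exists [::], x, p.
have [p1 [y [p2 [-> h1 h2]]]] := ih _ xm mp.
by exists (x :: p1), y, p2.
Qed.

End riemann_sums_along_lists.

(** * Powers of a length *)
Section power_of_a_length.
Context {R : realType}.
Implicit Types (h eta theta a b : R).

(** Why an error of order [theta > 1] per cell is harmless: over a partition of
    mesh [eta] the errors add up to the length of the interval times
    [eta `^ (theta - 1)], which vanishes with the mesh. *)
Lemma powR_le_linear h eta theta : 1 < theta -> 0 <= h -> h <= eta ->
  h `^ theta <= eta `^ (theta - 1) * h.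
Proof.
move=> th h0 heta; have -> : theta = (theta - 1) + 1 by ring.
rewrite powRD ?powRr1//; last by apply/implyP; rewrite subrK gt_eqF// (lt_trans _ th).
rewrite addrK ler_wpM2r// ge0_ler_powR ?nnegrE//; first lra.
exact: le_trans heta.
Qed.

(** Two halves of an interval cost strictly less than the interval. *)
Lemma powR_half theta : 1 < theta -> 2 * (2^-1 : R) `^ theta < 1.
Proof.
move=> th; have -> : theta = 1 + (theta - 1) by ring.
rewrite powRD ?powRr1//; last by apply/implyP => _; rewrite invr_eq0 pnatr_eq0.
rewrite mulrA divff ?mul1r ?pnatr_eq0//.
have e1 : (1 : R) = 1 `^ (theta - 1) by rewrite powR1.
rewrite [ltRHS]e1.
rewrite gt0_ltr_powR ?nnegrE ?subr_gt0//.
by rewrite invf_lt1// ltr1n.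
Qed.

(** The denominator [K + 1] instead of [K] covers [K = 0]. *)
Lemma ler_mul_small (K e x : R) : 0 <= K -> 0 < e -> x <= e / (K + 1) -> K * x <= e.
Proof.
move=> K0 e0 xe; apply: le_trans (ler_wpM2l K0 xe) _.
rewrite mulrA ler_pdivrMr; last by rewrite ltr_wpDl.
by rewrite mulrC; apply: ler_wpM2l; [exact: ltW|rewrite lerDl].
Qed.

Lemma exists_small_powR theta K e : 1 < theta -> 0 <= K -> 0 < e ->
  exists eta, [/\ 0 < eta, eta < 1 & K * eta `^ (theta - 1) <= e].
Proof.
move=> th K0 e0; have t0 : theta - 1 != 0 by rewrite subr_eq0 gt_eqF.
pose x := e / (K + 1); have x0 : 0 < x by rewrite divr_gt0// ltr_wpDl.
exists (Num.min 2^-1 (x `^ (theta - 1)^-1)); split.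
- by rewrite lt_min invr_gt0 ltr0n powR_gt0.
- by rewrite gt_min invf_lt1// ltr1n.
- apply: ler_mul_small => //; rewrite -/x.
  have {2}-> : x = (x `^ (theta - 1)^-1) `^ (theta - 1).
    by rewrite -powRrM mulVf// powRr1// ltW.
  apply: ge0_ler_powR.
  + by rewrite subr_ge0 ltW.
  + by rewrite nnegrE le_min invr_ge0 ler0n powR_ge0.
  + by rewrite nnegrE powR_ge0.
  + by rewrite ge_min lexx orbT.
Qed.

Lemma powR_le_powR h a b : 0 <= b -> b <= a -> 0 <= h -> h <= 1 -> h `^ a <= h `^ b.
Proof.
move=> b0 ba; rewrite le_eqVlt => /predU1P[<- _|h0 h1]; last by apply: ger_powR => //; rewrite h0.
have [a0|a0] := eqVneq a 0; last by rewrite powR0// powR_ge0.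
by have -> : a = b by lra.
Qed.

Lemma powR_add_exp h a b : 0 <= a -> 0 <= b -> h `^ a * h `^ b = h `^ (a + b).
Proof.
move=> a0 b0; have [->|h0] := eqVneq h 0; last by rewrite powRD// h0 implybT.
have [->|a0'] := eqVneq a 0; first by rewrite powRr0 mul1r add0r.
by rewrite powR0// mul0r powR0// gt_eqF// ltr_wpDr// lt_neqAle eq_sym a0'.
Qed.

Lemma ler_powR_base a h h' : 0 <= a -> 0 <= h -> h <= h' -> h `^ a <= h' `^ a.
Proof. by move=> a0 h0 hh; rewrite ge0_ler_powR ?nnegrE// (le_trans h0). Qed.

End power_of_a_length.

(** * Sewing on a bounded interval *)
Section sewing_on_an_interval.
Context {R : realType} (theta : R) (theta_gt1 : 1 < theta).
Implicit Types (Xi : R -> R -> R).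

(** The solution [c] of [2 * c * 2^-1 `^ theta + 2 = c], see
    [sewing_const_fix]. *)
Definition sewing_const : R := 2 / (1 - 2 * 2^-1 `^ theta).

Lemma sewing_const_ge2 : 2 <= sewing_const.
Proof.
have := powR_half theta_gt1; have : 0 <= (2^-1 : R) `^ theta by exact: powR_ge0.
move=> h0 h1; rewrite /sewing_const ler_pdivlMr; last lra.
by rewrite ger_pMr//; lra.
Qed.

Lemma sewing_const_fix (D h : R) :
  2 * (sewing_const * D * (h * 2^-1 `^ theta)) + 2 * (D * h) = sewing_const * D * h.
Proof.
have h1 := powR_half theta_gt1.
rewrite /sewing_const; field; lra.
Qed.

Definition almost_additive_on Xi (D a b : R) := forall s u t,
  a <= s -> s <= u -> u <= t -> t <= b -> t - s < 1 ->
  `|Xi s t - Xi s u - Xi u t| <= D * (t - s) `^ theta.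

(** By induction on the partition.  Cut it at the cell [z, y] that contains the
    midpoint of [s, t]: the parts on either side have at most half of the length,
    and inserting [z] and [y] into [s, t] costs two defects of additivity.  The
    constant is the one that is reproduced by this step. *)
Lemma sewing_inequality Xi D a b s t p : 0 <= D -> almost_additive_on Xi D a b ->
  a <= s -> t <= b -> t - s < 1 -> itv_partition s t p ->
  `|rsum Xi s p - Xi s t| <= sewing_const * D * (t - s) `^ theta.
Proof.
move=> D0 H; have [n] := ubnP (size p); elim: n => // n ih in s t p *.
rewrite ltnS => pn as_ tb ts1 sp.
have th0 : 0 <= theta by rewrite (le_trans ler01)// ltW.
have theta0 : theta != 0 by rewrite gt_eqF// (lt_trans _ theta_gt1).
have k2 := sewing_const_ge2; have k0 : 0 <= sewing_const by lra.
have [s_t|st] := eqVneq s t.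
  move: sp as_ ts1; rewrite s_t => /itv_partitionxx -> at_ ts1 /=.
  have := H _ _ _ at_ (lexx t) (lexx t) tb ts1.
  rewrite (subrr t) powR0// !mulr0 normr_le0 => /eqP h.
  by rewrite normr_le0; apply/eqP; lra.
have {}st : s < t by rewrite lt_neqAle st (itv_partition_le sp).
pose m := (s + t) / 2.
have sm : s <= m by rewrite /m; lra.
have mt : m < last s p by case: sp => _ /eqP ->; rewrite /m; lra.
have [p1 [y [p2 [pE zm my]]]] := split_path_at sm mt.
set z := last s p1 in zm; rewrite /m in zm my; clear sm mt m.
move: sp; rewrite pE => -[]; rewrite cat_path last_cat /= -/z.
move=> /andP[pp1 /andP[zy pp2]] lt.
have sp1 : itv_partition s z p1 by split => //; exact/eqP.
have sp2 : itv_partition y t p2 by [].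
have sz := itv_partition_le sp1; have yt := itv_partition_le sp2.
rewrite rsum_cat /= -/z.
have sz1 : (size p1 < n)%N by move: pn; rewrite pE size_cat/= addnS => h; apply: leq_trans h; rewrite ltnS leq_addr.
have sz2 : (size p2 < n)%N by move: pn; rewrite pE size_cat/= addnS => h; apply: leq_trans h; rewrite ltnS leq_addl.
(* an outer part is at most half as long as [s, t] *)
have half v w : s <= v -> v <= w -> w <= t -> w - v <= (t - s) / 2 ->
    (w - v) `^ theta <= (t - s) `^ theta * 2^-1 `^ theta.
  move=> sv vw wt vwh; rewrite -powRM ?ler_powR_base//; lra.
have h1 : `|rsum Xi s p1 - Xi s z| <=
    sewing_const * D * ((t - s) `^ theta * 2^-1 `^ theta).
  apply: (le_trans (ih _ _ _ sz1 _ _ _ sp1)) => //; try lra.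
  by apply: ler_wpM2l; [exact: mulr_ge0|apply: half; lra].
have h2 : `|rsum Xi y p2 - Xi y t| <=
    sewing_const * D * ((t - s) `^ theta * 2^-1 `^ theta).
  apply: (le_trans (ih _ _ _ sz2 _ _ _ sp2)) => //; try lra.
  by apply: ler_wpM2l; [exact: mulr_ge0|apply: half; lra].
have h3 : `|Xi s t - Xi s z - Xi z t| <= D * (t - s) `^ theta.
  by apply: H => //; lra.
have h4 : `|Xi z t - Xi z y - Xi y t| <= D * (t - s) `^ theta.
  apply: (le_trans (H _ _ _ _ (ltW zy) yt _ _)); try lra.
  by rewrite ler_wpM2l// ler_powR_base//; lra.
have -> : rsum Xi s p1 + (Xi z y + rsum Xi y p2) - Xi s t =
  (rsum Xi s p1 - Xi s z) + (rsum Xi y p2 - Xi y t)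
  - (Xi s t - Xi s z - Xi z t) - (Xi z t - Xi z y - Xi y t) by ring.
rewrite -sewing_const_fix.
rewrite (le_trans (ler_normB _ _))// (le_trans (lerD (ler_normB _ _) (lexx _)))//.
rewrite (le_trans (lerD (lerD (ler_normD _ _) (lexx _)) (lexx _)))//; lra.
Qed.

Lemma sewing_linear Xi D a b eta s t p : 0 <= D -> almost_additive_on Xi D a b ->
  a <= s -> t <= b -> itv_partition s t p -> 0 < eta -> eta <= 1 -> t - s < eta ->
  `|rsum Xi s p - Xi s t| <= sewing_const * D * eta `^ (theta - 1) * (t - s).
Proof.
move=> D0 H as_ tb sp eta0 eta1 tse; have st := itv_partition_le sp.
have k2 := sewing_const_ge2.
apply: le_trans (sewing_inequality D0 H as_ tb _ sp) _; first lra.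
rewrite -[leRHS]mulrA; apply: ler_wpM2l; first by rewrite mulr_ge0 ?(le_trans _ k2).
by apply: powR_le_linear => //; lra.
Qed.

(** The Riemann sums are Cauchy, since on the cells of a fine partition the
    sewing inequality is an error of order [theta > 1]. *)
Lemma mesh_lim_sewing Xi D a b s t : 0 <= D -> almost_additive_on Xi D a b ->
  a <= s -> s <= t -> t <= b -> forall e, 0 < e -> exists2 eta, 0 < eta &
    forall p, itv_partition s t p -> fine_path eta s p ->
    `|mesh_lim Xi s t - rsum Xi s p| <= e.
Proof.
move=> D0 H as_ st tb; have PF := mesh_filter_proper st.
have ts0 : 0 <= t - s by rewrite subr_ge0.
have k0 : 0 <= sewing_const := le_trans (ler0n _ 2) sewing_const_ge2.
have K1 : 0 <= 2 * (sewing_const * D * (t - s)) by apply: mulr_ge0 => //; apply: mulr_ge0 => //; apply: mulr_ge0.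
have cau e : 0 < e -> exists2 eta, 0 < eta & forall p q,
    itv_partition s t p -> itv_partition s t q ->
    fine_path eta s p -> fine_path eta s q -> `|rsum Xi s p - rsum Xi s q| < e.
  move=> e0; have e20 : 0 < e / 2 by lra.
  have [eta [eta0 eta1 he]] := exists_small_powR theta_gt1 K1 e20.
  exists eta => // p q sp sq fp fq.
  have := @rsum_cauchy _ Xi (sewing_const * D * eta `^ (theta - 1)) eta s t p q sp sq fp fq _.
  move=> h; apply: le_lt_trans (h _) _.
    move=> u v r su uv vt vue ur; apply: (sewing_linear D0 H _ _ ur) => //; lra.
  lra.
have cv : cvg (riemann_sum Xi s t @ mesh_filter s t).
  apply/cauchy_cvgP/cauchy_exP => e e0.
  have [eta eta0 he] := cau _ e0.
  have [p [sp fp]] := exists_fine_partition eta0 st.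
  exists (rsum Xi s p); apply: (near_mesh eta0) => q sq fq.
  by rewrite /ball/= riemann_sumE; exact: he.
move=> e e0; have /cvgrPdist_le/(_ _ e0) [eta /= eta0 he] := cv.
by exists eta => // p sp fp; rewrite -(riemann_sumE _ _ t); apply: he; split; rewrite ?mesh_ltP.
Qed.

Lemma mesh_lim_additive Xi D a b s u t : 0 <= D -> almost_additive_on Xi D a b ->
  a <= s -> s <= u -> u <= t -> t <= b ->
  mesh_lim Xi s t = mesh_lim Xi s u + mesh_lim Xi u t.
Proof.
move=> D0 H as_ su ut tb; have st := le_trans su ut.
apply/subr0_eq/eqP; rewrite -normr_le0; apply/ler_addgt0Pr => e e0; rewrite add0r.
have e20 : 0 < e / 3 by lra.
have [e1 e10 h1] := mesh_lim_sewing D0 H as_ su (le_trans ut tb) e20.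
have [e2 e20' h2] := mesh_lim_sewing D0 H (le_trans as_ su) ut tb e20.
have [e3 e30 h3] := mesh_lim_sewing D0 H as_ st tb e20.
pose d := Num.min e1 (Num.min e2 e3).
have d0 : 0 < d by rewrite !lt_min e10 e20' e30.
have mono eta p v : d <= eta -> fine_path d v p -> fine_path eta v p.
  by move=> de; apply: sub_path => x y /= /lt_le_trans; exact.
have [p [sp fp]] := exists_fine_partition d0 su.
have [q [uq fq]] := exists_fine_partition d0 ut.
have pq := itv_partition_cat sp uq.
have fpq : fine_path d s (p ++ q).
  by rewrite /fine_path cat_path -/(fine_path _ _ _) fp; case: sp => _ /eqP ->.

have hp : `|mesh_lim Xi s u - rsum Xi s p| <= e / 3.
  by apply: h1 => //; apply: mono fp; rewrite /d !ge_min lexx.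
have hq : `|mesh_lim Xi u t - rsum Xi u q| <= e / 3.
  by apply: h2 => //; apply: mono fq; rewrite /d !ge_min lexx !orbT.
have hpq : `|mesh_lim Xi s t - rsum Xi s (p ++ q)| <= e / 3.
  by apply: h3 => //; apply: mono fpq; rewrite /d !ge_min lexx !orbT.
move: hpq; rewrite rsum_cat; have [_ /eqP ->] := sp => hpq.
have -> : mesh_lim Xi s t - (mesh_lim Xi s u + mesh_lim Xi u t) =
  (mesh_lim Xi s t - (rsum Xi s p + rsum Xi u q))
  - (mesh_lim Xi s u - rsum Xi s p) - (mesh_lim Xi u t - rsum Xi u q) by ring.
rewrite (le_trans (ler_normB _ _))// (le_trans (lerD (ler_normB _ _) (lexx _)))//.
lra.
Qed.

Lemma mesh_lim_local Xi D a b s t : 0 <= D -> almost_additive_on Xi D a b ->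
  a <= s -> s <= t -> t <= b -> t - s < 1 ->
  `|mesh_lim Xi s t - Xi s t| <= sewing_const * D * (t - s) `^ theta.
Proof.
move=> D0 H as_ st tb ts1; apply/ler_addgt0Pr => e e0.
have [eta eta0 h] := mesh_lim_sewing D0 H as_ st tb e0.
have [p [sp fp]] := exists_fine_partition eta0 st.
have -> : mesh_lim Xi s t - Xi s t =
  (rsum Xi s p - Xi s t) + (mesh_lim Xi s t - rsum Xi s p) by ring.
rewrite (le_trans (ler_normD _ _))// lerD ?h//.
exact: sewing_inequality D0 H as_ tb ts1 sp.
Qed.

End sewing_on_an_interval.

(** * Functions whose increments are small *)
Section small_increments.
Context {R : realType} (theta : R) (theta_gt1 : 1 < theta).

(** Along a partition of mesh [eta], at most [C * (b - a) * eta `^ (theta - 1)]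
    is lost.  This replaces the mean value theorem throughout: nothing needs to be
    differentiable. *)
Lemma small_increments_le (f : R -> R) (C a b : R) : 0 <= C -> a <= b ->
  (forall s t, a <= s -> s <= t -> t <= b -> t - s < 1 ->
    - (C * (t - s) `^ theta) <= f t - f s) -> f a <= f b.
Proof.
move=> C0 ab H; rewrite -subr_ge0 -oppr_le0; apply/ler_addgt0Pr => e e0.
rewrite add0r lerNl.
have K0 : 0 <= C * (b - a) by rewrite mulr_ge0// subr_ge0.
have [eta [eta0 eta1 he]] := exists_small_powR theta_gt1 K0 e0.
have [p [pP pf]] := exists_fine_partition eta0 ab.
have := @rsum_ge _ (fun u v => f v - f u) (- (C * eta `^ (theta - 1))) eta _ _ _ pP pf.
rewrite rsum_telescope; have [_ /eqP ->] := pP => h.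
apply: le_trans (h _); last first.
  move=> u v au uv vb vu; apply: le_trans (H _ _ au (ltW uv) vb _); last lra.
  rewrite mulNr lerN2 -mulrA; apply: ler_wpM2l => //; apply: powR_le_linear => //; lra.
by rewrite mulNr lerN2 mulrAC.
Qed.

Lemma small_increments_eq (f : R -> R) (C a b : R) : 0 <= C -> a <= b ->
  (forall s t, a <= s -> s <= t -> t <= b -> t - s < 1 ->
    `|f t - f s| <= C * (t - s) `^ theta) -> f a = f b.
Proof.
move=> C0 ab H; apply/eqP; rewrite eq_le; apply/andP; split.
  apply: (small_increments_le C0 ab) => s t as_ st tb ts.
  by have := H _ _ as_ st tb ts; rewrite ler_norml => /andP[].
rewrite -lerN2; apply: (@small_increments_le (fun x => - f x) _ _ _ C0 ab) => s t as_ st tb ts.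
have := H _ _ as_ st tb ts; rewrite ler_norml => /andP[_].
by move=> h; rewrite -opprD lerN2.
Qed.

End small_increments.

(** * Exponential decay at minus infinity *)
Section decay.
Context {R : realType} (delta T : R) (delta_gt0 : 0 < delta).

Definition decay (t : R) : R := expR (- (delta * (T - t))).

Lemma decay_gt0 t : 0 < decay t. Proof. exact: expR_gt0. Qed.

Lemma decay_ge0 t : 0 <= decay t. Proof. exact: expR_ge0. Qed.

Lemma ler_decay s t : s <= t -> decay s <= decay t.
Proof.
by move=> st; rewrite ler_expR lerN2; apply: ler_wpM2l; [exact: ltW|lra].
Qed.

Lemma decay_le1 t : t <= T -> decay t <= 1.
Proof.
move=> tT; rewrite -expR0 ler_expR oppr_le0 mulr_ge0 ?subr_ge0//; exact: ltW.
Qed.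

Lemma decay_half t : decay (t - 2^-1) = decay t * expR (- (delta / 2)).
Proof. by rewrite /decay -expRD; congr expR; field. Qed.

Lemma decay_small K e : 0 <= K -> 0 < e ->
  exists2 a0, a0 <= T & forall a, a <= a0 -> K * decay a <= e.
Proof.
move=> K0 e0; pose x := e / (K + 1); have x0 : 0 < x by rewrite divr_gt0// ltr_wpDl.
exists (Num.min T (T + ln x / delta)); first by rewrite ge_min lexx.
move=> a; rewrite le_min => /andP[aT ax]; apply: ler_mul_small => //; rewrite -/x.
have -> : x = expR (ln x) by rewrite lnK ?posrE.
rewrite ler_expR lerNl.
have : delta * (a - T) <= ln x by rewrite mulrC -ler_pdivlMr//; lra.
lra.
Qed.

End decay.

(** * Sewing from minus infinity *)
Section sewing_from_minus_infinity.
Context {R : realType} (theta : R) (theta_gt1 : 1 < theta).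
Context (delta T : R) (delta_gt0 : 0 < delta).
Local Notation decay := (decay delta T).

(** The integral over the half-line up to [t] of the germ [Xi]. *)
Definition sew (Xi : R -> R -> R) (t : R) : R :=
  lim ((fun a => mesh_lim Xi a t) @ -oo).

(** The half-line is covered by intervals of length 1/2, on which the integral is
    at most [1 + sewing_const theta] times the weight; the weights form a geometric
    series of ratio [expR (- (delta / 2))]. *)
Definition sew_const : R := (1 + sewing_const theta) / (1 - expR (- (delta / 2))).

Let q := expR (- (delta / 2)).

Let q_lt1 : q < 1.
Proof. by rewrite /q -expR0 ltr_expR oppr_lt0 divr_gt0. Qed.

Let k_ge2 : 2 <= sewing_const theta. Proof. exact: sewing_const_ge2. Qed.

Lemma sewing_const_le : sewing_const theta <= sew_const.
Proof.
have q1 := q_lt1; have q0 : 0 < q by exact: expR_gt0.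
have k2 := k_ge2.
rewrite /sew_const -/q ler_pdivlMr ?subr_gt0//.
apply: (@le_trans _ _ (sewing_const theta * 1)); last lra.
by apply: ler_wpM2l; lra.
Qed.

Lemma sew_const_ge0 : 0 <= sew_const.
Proof. have := k_ge2; have := sewing_const_le; lra. Qed.

Section one_integrand.
Context (Xi : R -> R -> R) (C : R) (C_ge0 : 0 <= C).
Hypothesis Xi_almost_additive : forall s u t, s <= u -> u <= t -> t <= T ->
  t - s < 1 -> `|Xi s t - Xi s u - Xi u t| <= C * decay t * (t - s) `^ theta.
Hypothesis Xi_bounded : forall s t, s <= t -> t <= T -> t - s < 1 ->
  `|Xi s t| <= C * decay t.

Let almost a b : b <= T -> almost_additive_on theta Xi (C * decay b) a b.
Proof.
move=> bT s u t as_ su ut tb ts.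
apply: (le_trans (Xi_almost_additive su ut (le_trans tb bT) ts)).
apply: ler_wpM2r; first exact: powR_ge0.
by apply: ler_wpM2l => //; exact: ler_decay.
Qed.

Let Cd_ge0 t : 0 <= C * decay t. Proof. by rewrite mulr_ge0 ?decay_ge0. Qed.

Let Jadd s u t : s <= u -> u <= t -> t <= T ->
  mesh_lim Xi s t = mesh_lim Xi s u + mesh_lim Xi u t.
Proof.
move=> su ut tT.
exact: (mesh_lim_additive theta_gt1 (Cd_ge0 T) (almost (a := s) (lexx T))).
Qed.

Let Jlocal s t : s <= t -> t <= T -> t - s < 1 ->
  `|mesh_lim Xi s t - Xi s t| <= sewing_const theta * (C * decay t) * (t - s) `^ theta.
Proof.
move=> st tT ts.
exact: (mesh_lim_local theta_gt1 (Cd_ge0 t) (almost (a := s) tT)).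
Qed.

Let Jshort s t : s <= t -> t <= T -> t - s < 1 ->
  `|mesh_lim Xi s t| <= (1 + sewing_const theta) * (C * decay t).
Proof.
move=> st tT ts.
rewrite -[X in `|X|](subrK (Xi s t)) (le_trans (ler_normD _ _))//.
rewrite mulrDl mul1r addrC; apply: lerD; first exact: Xi_bounded.
apply: (le_trans (Jlocal st tT ts)).
rewrite -[leRHS]mulr1; apply: ler_wpM2l.
  by rewrite mulr_ge0// (le_trans _ k_ge2).
rewrite -[leRHS](powRr0 (t - s)); apply: powR_le_powR => //; last exact: ltW.
  by rewrite (le_trans ler01)// ltW.
by rewrite subr_ge0.
Qed.

Let B t : R := sew_const * (C * decay t).

(* By induction on the number of half units: the last half unit contributes
   [(1 + sewing_const theta) * C * decay t], and shifting [t] by 1/2 multiplies [B]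
   by [q]. *)
Let Jbound a t : a <= t -> t <= T -> `|mesh_lim Xi a t| <= B t.
Proof.
have B1 t' : (1 + sewing_const theta) * (C * decay t') <= B t'.
  apply: ler_wpM2r => //; rewrite /sew_const -/q ler_pdivlMr ?subr_gt0//.
  apply: ler_piMr; first by rewrite addr_ge0// (le_trans _ k_ge2).
  by rewrite gerBl expR_ge0.
have step n : forall t, a <= t -> t <= T -> t - a < n%:R / 2 ->
    `|mesh_lim Xi a t| <= B t.
  elim: n => [|n ih] {}t at_ tT tn; first by exfalso; lra.
  have [ta|ta] := ltP (t - a) 1; first by apply: (le_trans (Jshort at_ tT ta)).
  rewrite (@Jadd a (t - 2^-1) t)//; [|lra|lra].
  rewrite (le_trans (ler_normD _ _))//.
  apply: (@le_trans _ _ (B (t - 2^-1) + (1 + sewing_const theta) * (C * decay t))).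
    apply: lerD; last by apply: Jshort => //; lra.
    apply: ih; [lra|lra|].
    by move: tn; rewrite -natr1; lra.
  rewrite /B decay_half -/q /sew_const -/q le_eqVlt; apply/orP; left; apply/eqP.
  by field; rewrite subr_eq0 gt_eqF.
move=> at_ tT; have ta0 : 0 <= 2 * (t - a) by rewrite mulr_ge0// subr_ge0.
apply: (step (Num.bound (2 * (t - a)))) => //.
have := archi_boundP ta0; lra.
Qed.

Let sew_tail a t : a <= t -> t <= T -> `|sew Xi t - mesh_lim Xi a t| <= B a.
Proof.
move=> at_ tT.
have Bsmall e : 0 < e -> exists2 a0, a0 <= T & forall b, b <= a0 -> B b <= e.
  move=> e0; have K0 : 0 <= sew_const * C by rewrite mulr_ge0// sew_const_ge0.
  have [a0 a0T h] := decay_small T delta_gt0 K0 e0.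
  by exists a0 => // b ba; rewrite /B mulrA; exact: h.
have Jdiff b b' : b' <= b -> b <= t -> `|mesh_lim Xi b t - mesh_lim Xi b' t| <= B b.
  move=> b'b bt; rewrite (@Jadd b' b t)// opprD addrCA subrr addr0 normrN.
  by apply: Jbound => //; exact: le_trans tT.
have cv : cvg ((fun a => mesh_lim Xi a t) @ -oo).
  apply/cauchy_cvgP/cauchy_exP => e e0.
  have e20 : 0 < e / 2 by lra.
  have [a0 a0T h] := Bsmall _ e20.
  pose c := Num.min a0 t; exists (mesh_lim Xi c t).
  suff: \forall b \near -oo_ R, ball (mesh_lim Xi c t) e (mesh_lim Xi b t) by [].
  near=> b; rewrite /ball/=; apply: (le_lt_trans (Jdiff _ _ _ _)).
  - by near: b; apply: nbhs_ninfty_le; exact: num_real.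
  - by rewrite ge_min lexx orbT.
  - by apply: le_lt_trans (h _ _) _; [rewrite ge_min lexx|lra].
apply/ler_addgt0Pr => e e0.
have /cvgrPdist_le/(_ _ e0) cv' := cv.
have [b [ba hb]] : exists b, b <= a /\ `|sew Xi t - mesh_lim Xi b t| <= e.
  near (-oo_ R) => b; exists b; split; last by near: b.
  by near: b; apply: nbhs_ninfty_le; exact: num_real.
have -> : sew Xi t - mesh_lim Xi a t =
  (mesh_lim Xi b t - mesh_lim Xi a t) + (sew Xi t - mesh_lim Xi b t) by ring.
by rewrite (le_trans (ler_normD _ _))// lerD// distrC Jdiff.
Unshelve. all: by end_near. Qed.

Lemma sew_bound t : t <= T -> `|sew Xi t| <= sew_const * C * decay t.
Proof.
move=> tT; have := sew_tail (lexx t) tT.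
have -> : mesh_lim Xi t t = 0 by have := Jadd (lexx t) (lexx t) tT; lra.
by rewrite subr0 /B mulrA.
Qed.

Lemma sew_additive s t : s <= t -> t <= T -> sew Xi t - sew Xi s = mesh_lim Xi s t.
Proof.
move=> st tT; apply/subr0_eq/eqP; rewrite -normr_le0; apply/ler_addgt0Pr => e e0.
have sC : 0 <= 2 * sew_const * C.
  by apply: mulr_ge0 => //; apply: mulr_ge0 => //; exact: sew_const_ge0.
have [a0 a0T h] := decay_small T delta_gt0 sC e0.
pose a := Num.min a0 s.
have as_ : a <= s by rewrite ge_min lexx orbT.
have at_ := le_trans as_ st.
have -> : sew Xi t - sew Xi s - mesh_lim Xi s t =
  (sew Xi t - mesh_lim Xi a t) - (sew Xi s - mesh_lim Xi a s).
  by rewrite (Jadd as_ st tT); ring.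
rewrite add0r (le_trans (ler_normB _ _))//.
rewrite (le_trans (lerD (sew_tail at_ tT) (sew_tail as_ (le_trans st tT))))//.
have -> : B a + B a = 2 * sew_const * C * decay a by rewrite /B; ring.
by apply: h; rewrite ge_min lexx.
Qed.

(** Together with the decay at minus infinity, this local expansion characterizes
    the primitive [sew Xi]; all later arguments only use these two properties. *)
Lemma sew_increment s t : s <= t -> t <= T -> t - s < 1 ->
  `|sew Xi t - sew Xi s - Xi s t| <= sew_const * C * decay t * (t - s) `^ theta.
Proof.
move=> st tT ts; rewrite sew_additive//; apply: (le_trans (Jlocal st tT ts)).
apply: ler_wpM2r; first exact: powR_ge0.
by rewrite -[leRHS]mulrA; apply: ler_wpM2r => //; exact: sewing_const_le.
Qed.

End one_integrand.
End sewing_from_minus_infinity.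

(** * Orders of smallness, uniformly over a family *)
Section uniform_orders.
Context {R : realType} (T delta : R) (delta_gt0 : 0 < delta) {Idx : Type} (S : set Idx).
Local Notation decay := (decay delta T).
Implicit Types (f g : Idx -> R -> R -> R -> R) (b : bool) (a : R).

Definition weight b (t : R) : R := if b then decay t else 1.

(** The constant is the same for all [x] in [S]: estimates on one path and
    estimates that are uniform on bounded sets of paths are then the same lemmas,
    and the uniform ones yield continuity in the path.  If [b], the quantity also
    decays at minus infinity.  Functions of two times [s, t] are the case where
    [f] ignores [u]. *)
Definition bigO b a f := exists2 C : R, 0 <= C & forall x, S x -> forall s u t,
  s <= u -> u <= t -> t <= T -> t - s < 1 ->
  `|f x s u t| <= C * weight b t * (t - s) `^ a.

Lemma weight_ge0 b t : 0 <= weight b t.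
Proof. by case: b => //=; exact: decay_ge0. Qed.

Lemma ler_weight b s t : s <= t -> weight b s <= weight b t.
Proof. by case: b => //= st; exact: ler_decay. Qed.

Lemma weight_orb b b' t : t <= T -> weight b t * weight b' t <= weight (b || b') t.
Proof.
move=> tT; have d1 := decay_le1 delta_gt0 tT; have d0 := decay_ge0 delta T t.
by case: b b' => [] []; rewrite /= ?mul1r ?mulr1//; apply: ler_piMl.
Qed.

Lemma eq_bigO b a f g : bigO b a f ->
  (forall x s u t, S x -> s <= u -> u <= t -> t <= T -> t - s < 1 ->
    g x s u t = f x s u t) -> bigO b a g.
Proof. by move=> [C C0 H] fg; exists C => // x Sx s u t *; rewrite fg//; exact: H. Qed.

Lemma bigOD b a f g : bigO b a f -> bigO b a g ->
  bigO b a (fun x s u t => f x s u t + g x s u t).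
Proof.
move=> [C C0 H] [C' C'0 H']; exists (C + C'); first exact: addr_ge0.
move=> x Sx s u t su ut tT ts; rewrite !mulrDl (le_trans (ler_normD _ _))//.
by apply: lerD; [exact: H|exact: H'].
Qed.

Lemma bigON b a f : bigO b a f -> bigO b a (fun x s u t => - f x s u t).
Proof. by move=> [C C0 H]; exists C => // x Sx s u t *; rewrite normrN; exact: H. Qed.

Lemma bigOB b a f g : bigO b a f -> bigO b a g ->
  bigO b a (fun x s u t => f x s u t - g x s u t).
Proof. by move=> hf hg; apply: bigOD => //; exact: bigON. Qed.

Lemma bigOM b b' a a' f g : 0 <= a -> 0 <= a' -> bigO b a f -> bigO b' a' g ->
  bigO (b || b') (a + a') (fun x s u t => f x s u t * g x s u t).
Proof.
move=> a0 a'0 [C C0 H] [C' C'0 H']; exists (C * C'); first exact: mulr_ge0.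
move=> x Sx s u t su ut tT ts; rewrite normrM -powR_add_exp//.
apply: (le_trans (ler_pM _ _ (H _ Sx _ _ _ su ut tT ts) (H' _ Sx _ _ _ su ut tT ts))) => //.
have -> : C * weight b t * (t - s) `^ a * (C' * weight b' t * (t - s) `^ a') =
  (C * C') * (weight b t * weight b' t) * ((t - s) `^ a * (t - s) `^ a') by ring.
apply: ler_wpM2r; first by rewrite mulr_ge0 ?powR_ge0.
by apply: ler_wpM2l; [exact: mulr_ge0|exact: weight_orb].
Qed.

Lemma bigO_le b b' a a' f : b' ==> b -> 0 <= a' -> a' <= a ->
  bigO b a f -> bigO b' a' f.
Proof.
move=> bb a'0 aa [C C0 H]; exists C => // x Sx s u t su ut tT ts.
apply: (le_trans (H _ Sx _ _ _ su ut tT ts)).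
have st := le_trans su ut.
apply: ler_pM; rewrite ?mulr_ge0 ?weight_ge0 ?powR_ge0//.
  apply: ler_wpM2l => //.
  by case: b b' bb {H} => [] []//= _; exact: decay_le1.
by apply: powR_le_powR => //; [rewrite subr_ge0|exact: ltW].
Qed.

Lemma bigO_left b a (f : Idx -> R -> R -> R) : 0 <= a ->
  bigO b a (fun x s _ t => f x s t) -> bigO b a (fun x s u _ => f x s u).
Proof.
move=> a0 [C C0 H]; exists C => // x Sx s u t su ut tT ts.
apply: (le_trans (H x Sx s s u (lexx s) su (le_trans ut tT) _)); first lra.
apply: ler_pM; rewrite ?mulr_ge0 ?weight_ge0 ?powR_ge0//.
  by apply: ler_wpM2l => //; exact: ler_weight.
by apply: ler_powR_base => //; lra.
Qed.

Lemma bigO_right b a (f : Idx -> R -> R -> R) : 0 <= a ->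
  bigO b a (fun x s _ t => f x s t) -> bigO b a (fun x _ u t => f x u t).
Proof.
move=> a0 [C C0 H]; exists C => // x Sx s u t su ut tT ts.
apply: (le_trans (H x Sx u u t (lexx u) ut tT _)); first lra.
apply: ler_pM; rewrite ?mulr_ge0 ?weight_ge0 ?powR_ge0//.
by apply: ler_powR_base => //; lra.
Qed.

Lemma bigO_cst b a : bigO b a (fun _ _ _ _ => 0).
Proof. by exists 0 => // x Sx s u t *; rewrite normr0 !mul0r. Qed.

Lemma bigO_fun0 (f : Idx -> R -> R) : (exists2 C : R, 0 <= C & forall x t, S x -> t <= T -> `|f x t| <= C) ->
  [/\ bigO false 0 (fun x s _ _ => f x s), bigO false 0 (fun x _ u _ => f x u) &
      bigO false 0 (fun x _ _ t => f x t)].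
Proof.
move=> [C C0 H]; split; exists C => // x Sx s u t su ut tT ts;
  rewrite powRr0 !mulr1; apply: H => //; first exact: le_trans (le_trans su ut) tT.
exact: le_trans ut tT.
Qed.

End uniform_orders.

(** * Iterated integrals against an almost rough path *)
Section iterated_integrals.
Context {R : realType} (T alpha delta : R) {I : eqType}.
Local Notation theta := (3 * alpha).
Local Notation decay := (decay delta T).

(** The second-order Taylor germ of the integral of [E r'] against the letter
    [k].  Words are read backwards here and below: the head of [r] is the letter
    that is integrated last, so that prefixing a letter is integrating. *)
Definition germ (E : seq I -> R -> R) (A1 : R -> R -> I -> R)
    (A2 : R -> R -> I -> I -> R) (r : seq I) (u v : R) : R :=
  if r is k :: r' then
    E r' u * A1 u v k + (if r' is l :: r'' then E r'' u * A2 u v l k else 0)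
  else 0.

Fixpoint iter_sig (A1 : R -> R -> I -> R) (A2 : R -> R -> I -> I -> R)
    (r : seq I) : R -> R :=
  if r is k :: r' then
    sew (fun u v => iter_sig A1 A2 r' u * A1 u v k +
      (if r' is l :: r'' then iter_sig A1 A2 r'' u * A2 u v l k else 0))
  else fun=> 1.

Lemma iter_sig_cons A1 A2 k r :
  iter_sig A1 A2 (k :: r) = sew (germ (iter_sig A1 A2) A1 A2 (k :: r)).
Proof. by []. Qed.

Arguments iter_sig : simpl never.

Context (alpha_gt : 1 / 3 < alpha) (delta_gt0 : 0 < delta).
Context {Idx : Type} (S : set Idx).
Context (A1 : Idx -> R -> R -> I -> R) (A2 : Idx -> R -> R -> I -> I -> R).
Local Notation bigO := (@bigO R T delta Idx S).

(** The first two levels of a rough path whose integrators carry exponential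
    weights.  The weights destroy the exact relation of Chen, but only up to the
    order [3 * alpha > 1], which sewing cannot see. *)
Record almost_rough : Prop := AlmostRough {
  ar_level1 : forall k, bigO true alpha (fun x s _ t => A1 x s t k);
  ar_level2 : forall l k, bigO true (2 * alpha) (fun x s _ t => A2 x s t l k);
  ar_chen1 : forall k, bigO true theta
    (fun x s u t => A1 x s t k - A1 x s u k - A1 x u t k);
  ar_chen2 : forall l k, bigO true theta (fun x s u t =>
    A2 x s t l k - A2 x s u l k - A2 x u t l k - A1 x s u l * A1 x u t k) }.

Context (HA : almost_rough).
Local Notation E x := (iter_sig (A1 x) (A2 x)).
Local Notation Xi x := (germ (E x) (A1 x) (A2 x)).

Let theta_gt1 : 1 < theta. Proof. by move: alpha_gt; lra. Qed.
Let a0 : 0 <= alpha. Proof. by move: alpha_gt; lra. Qed.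
Let a20 : 0 <= 2 * alpha. Proof. by move: alpha_gt; lra. Qed.
Let th0 : 0 <= theta. Proof. by move: alpha_gt; lra. Qed.

Definition sig_bounded r := exists2 C : R, 0 <= C & forall x t, S x -> t <= T ->
  `|E x r t| <= C.

Definition sig_expands r :=
  bigO true theta (fun x s _ t => E x r t - E x r s - Xi x r s t).

Lemma germ_level1 r : sig_bounded r -> forall k,
  bigO true alpha (fun x s _ t => E x r s * A1 x s t k).
Proof.
move=> /(@bigO_fun0 R T delta Idx S)[br _ _] k.
have := bigOM delta_gt0 (lexx 0) a0 br (ar_level1 HA k); rewrite add0r; exact.
Qed.

Lemma germ_level2 r : sig_bounded r -> forall l k,
  bigO true (2 * alpha) (fun x s _ t => E x r s * A2 x s t l k).
Proof.
move=> /(@bigO_fun0 R T delta Idx S)[br _ _] l k.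
have := bigOM delta_gt0 (lexx 0) a20 br (ar_level2 HA l k); rewrite add0r; exact.
Qed.

Lemma germ_order r : (forall r', (size r' < size r)%N -> sig_bounded r') ->
  bigO true alpha (fun x s _ t => Xi x r s t).
Proof.
case: r => [_|k r H]; first exact: bigO_cst.
have h1 : bigO true alpha (fun x s _ t => E x r s * A1 x s t k).
  by apply: germ_level1; exact: H.
have h2 : bigO true alpha (fun x s _ t =>
    if r is l :: r'' then E x r'' s * A2 x s t l k else 0).
  case: r H {h1} => [_|l r H]; first exact: bigO_cst.
  apply: (@bigO_le _ _ _ delta_gt0 _ _ true true (2 * alpha)) => //; first by move: a0; lra.
  by apply: germ_level2; apply: H => /=; rewrite ltnS.
by apply: eq_bigO (bigOD h1 h2) _.
Qed.

(** The defect of additivity is the sum of the two defects of Chen's relation,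
    multiplied by bounded functions, and of two remainders: that of the expansion
    of [E (l :: r)] at order 1 (of order [2 * alpha]) against [A1], and the
    increment of [E r] (of order [alpha]) against [A2].  Each has the order
    [3 * alpha]. *)
Lemma germ_almost_additive k r :
  (forall r', (size r' <= size r)%N -> sig_bounded r' /\ sig_expands r') ->
  bigO true theta
    (fun x s u t => Xi x (k :: r) s t - Xi x (k :: r) s u - Xi x (k :: r) u t).
Proof.
move=> H; have [br er] := H r (leqnn _).
have /(@bigO_fun0 R T delta Idx S)[brs _ _] := br.
have c1 : bigO true theta (fun x s u t =>
    E x r s * (A1 x s t k - A1 x s u k - A1 x u t k)).
  have := bigOM delta_gt0 (lexx 0) th0 brs (ar_chen1 HA k); rewrite add0r; exact.
case: r H br er brs c1 => [H _ _ _ c1|l r H br er _ c1].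
  by apply: eq_bigO c1 _ => x s u t _ _ _ _ _; rewrite /germ /=; ring.
have [br' er'] := H r (leqnSn _).
have /(@bigO_fun0 R T delta Idx S)[brs' _ _] := br'.
have c2 : bigO true theta (fun x s u t => E x r s *
    (A2 x s t l k - A2 x s u l k - A2 x u t l k - A1 x s u l * A1 x u t k)).
  have := bigOM delta_gt0 (lexx 0) th0 brs' (ar_chen2 HA l k); rewrite add0r; exact.
have c3 : bigO true theta (fun x s u t =>
    (E x (l :: r) u - E x (l :: r) s - E x r s * A1 x s u l) * A1 x u t k).
  have -> : theta = 2 * alpha + alpha by ring.
  apply: (@bigOM _ _ _ delta_gt0 _ _ true true) => //; last first.
    by apply: (bigO_right a0); exact: ar_level1.
  apply: (@bigO_left _ _ _ delta_gt0 _ _ _ _ (fun x s t =>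
    E x (l :: r) t - E x (l :: r) s - E x r s * A1 x s t l)) => //.
  have g2 : bigO true (2 * alpha) (fun x s _ t =>
      if r is l' :: r'' then E x r'' s * A2 x s t l' l else 0).
    case: (r) H => [_|l' r'' H]; first exact: bigO_cst.
    by apply: germ_level2; apply: (H r'' _).1; rewrite /= ltnW.
  have e2 : bigO true (2 * alpha) (fun x s _ t =>
      E x (l :: r) t - E x (l :: r) s - Xi x (l :: r) s t).
    by apply: (@bigO_le _ _ _ delta_gt0 _ _ true true theta) er => //; move: a0; lra.
  apply: eq_bigO (bigOD e2 g2) _ => x s u t _ _ _ _ _; rewrite /germ /= opprD !addrA subrK //.
have c4 : bigO true theta (fun x s u t => (E x r u - E x r s) * A2 x u t l k).
  have -> : theta = alpha + 2 * alpha by ring.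
  apply: (@bigOM _ _ _ delta_gt0 _ _ true true) => //; last first.
    by apply: (bigO_right a20); exact: ar_level2.
  apply: (@bigO_left _ _ _ delta_gt0 _ _ _ _ (fun x s t => E x r t - E x r s)) => //.
  have g1 : bigO true alpha (fun x s _ t => Xi x r s t).
    by apply: germ_order => r' r'r; apply: (H r' _).1; rewrite /= ltnW// ltnS ltnW.
  have e1 : bigO true alpha (fun x s _ t => E x r t - E x r s - Xi x r s t).
    by apply: (@bigO_le _ _ _ delta_gt0 _ _ true true theta) er' => //; move: a0; lra.
  apply: eq_bigO (bigOD e1 g1) _ => x s u t _ _ _ _ _; ring.
apply: eq_bigO (bigOB (bigOB (bigOD c1 c2) c3) c4) _ => x s u t _ _ _ _ _; rewrite /germ /=; ring.
Qed.

(** Boundedness and expansion of shorter words make the germ of a longer word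
    almost additive, so that sewing proves them for the longer word.  The constants
    only depend on those of [almost_rough]. *)
Lemma sig_estimates r : [/\ sig_bounded r, sig_expands r & r != [::] ->
  exists2 C : R, 0 <= C & forall x t, S x -> t <= T -> `|E x r t| <= C * decay t].
Proof.
have [n] := ubnP (size r); elim: n => // n ih in r *.
case: r => [_|k r]; last rewrite /= ltnS => rn.
  split=> //; first by exists 1 => // x t *; rewrite normr1.
  by apply: eq_bigO (bigO_cst _ _ _ _ _) _ => x s u t _ _ _ _ _; rewrite /= !subrr.
have H r' : (size r' <= size r)%N -> sig_bounded r' /\ sig_expands r'.
  by move=> r'r; have [] := ih r' (leq_ltn_trans r'r rn).
have [C1 C10 h1] := germ_almost_additive k H.
have [C2 C20 h2] : bigO true alpha (fun x s _ t => Xi x (k :: r) s t).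
  by apply: germ_order => r' /H[].
pose C := C1 + C2; have C0 : 0 <= C by exact: addr_ge0.
have k0 := sew_const_ge0 theta_gt1 delta_gt0.
have hadd x (Sx : S x) s u t : s <= u -> u <= t -> t <= T -> t - s < 1 ->
    `|Xi x (k :: r) s t - Xi x (k :: r) s u - Xi x (k :: r) u t| <=
    C * decay t * (t - s) `^ theta.
  move=> su ut tT ts; apply: (le_trans (h1 x Sx _ _ _ su ut tT ts)).
  apply: ler_wpM2r; first exact: powR_ge0.
  by apply: ler_wpM2r; [exact: decay_ge0|rewrite lerDl].
have hbnd x (Sx : S x) s t : s <= t -> t <= T -> t - s < 1 ->
    `|Xi x (k :: r) s t| <= C * decay t.
  move=> st tT ts; apply: (le_trans (h2 x Sx _ _ _ (lexx s) st tT ts)).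
  apply: (@le_trans _ _ (C2 * decay t)); last first.
    by apply: ler_wpM2r; [exact: decay_ge0|rewrite lerDr].
  rewrite -[leRHS]mulr1; apply: ler_wpM2l.
    by apply: mulr_ge0 => //; exact: decay_ge0.
  rewrite -[leRHS](powRr0 (t - s)); apply: powR_le_powR => //; last exact: ltW.
  by rewrite subr_ge0.
have dec x t : S x -> t <= T ->
    `|E x (k :: r) t| <= sew_const theta delta * C * decay t.
  move=> Sx tT; rewrite iter_sig_cons.
  exact: (sew_bound theta_gt1 delta_gt0 C0 (hadd x Sx) (hbnd x Sx)).
split.
- exists (sew_const theta delta * C); first exact: mulr_ge0.
  move=> x t Sx tT; apply: (le_trans (dec x t Sx tT)); apply: ler_piMr.
    exact: mulr_ge0.
  exact: decay_le1.
- exists (sew_const theta delta * C); first exact: mulr_ge0.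
  move=> x Sx s u t su ut tT ts; rewrite iter_sig_cons.
  exact: (sew_increment theta_gt1 delta_gt0 C0 (hadd x Sx) (hbnd x Sx)
    (le_trans su ut) tT ts).
- by move=> _; exists (sew_const theta delta * C) => //; exact: mulr_ge0.
Qed.

End iterated_integrals.

Arguments iter_sig : simpl never.

(** * Recognizing a primitive from its local expansion *)
Section riemann_sums_of_a_primitive.
Context {R : realType} (theta : R) (theta_gt1 : 1 < theta).

Lemma rsum_primitive (f : R -> R) (Xi : R -> R -> R) (C eta a t : R) p :
  0 <= C -> 0 < eta -> eta <= 1 ->
  (forall s u, a <= s -> s <= u -> u <= t -> u - s < 1 ->
    `|f u - f s - Xi s u| <= C * (u - s) `^ theta) ->
  itv_partition a t p -> fine_path eta a p ->
  `|f t - f a - rsum Xi a p| <= C * eta `^ (theta - 1) * (t - a).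
Proof.
move=> C0 eta0 eta1 H ap fp.
have {1}-> : t = last a p by case: ap => _ /eqP ->.
rewrite -(rsum_telescope f); apply: rsum_dist ap fp _ => u v au uv vt vu.
apply: (le_trans (H _ _ au (ltW uv) vt (lt_le_trans vu eta1))).
by rewrite -mulrA; apply: ler_wpM2l => //; apply: powR_le_linear => //; lra.
Qed.

Lemma mesh_lim_primitive (f : R -> R) (Xi : R -> R -> R) (C a t : R) :
  0 <= C -> a <= t ->
  (forall s u, a <= s -> s <= u -> u <= t -> u - s < 1 ->
    `|f u - f s - Xi s u| <= C * (u - s) `^ theta) ->
  mesh_lim Xi a t = f t - f a.
Proof.
move=> C0 at_ H; apply: mesh_limP => // e e0.
have K0 : 0 <= C * (t - a) by rewrite mulr_ge0// subr_ge0.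
have [eta [eta0 eta1 he]] := exists_small_powR theta_gt1 K0 e0.
exists eta => // p ap fp.
apply: (le_trans (rsum_primitive C0 eta0 (ltW eta1) H ap fp)).
by rewrite mulrAC.
Qed.

End riemann_sums_of_a_primitive.

(** * The shuffle identity *)

(** For words read backwards: either head can be the letter integrated last. *)
Fixpoint shuffle {I : Type} (u : seq I) : seq I -> seq (seq I) :=
  fix sh v := match u, v with
  | [::], _ => [:: v]
  | _, [::] => [:: u]
  | i :: u', j :: v' => map (cons i) (shuffle u' v) ++ map (cons j) (sh v')
  end.

Section shuffle_identity.
Context {R : realType} (T alpha delta : R) {I : eqType}.
Local Notation theta := (3 * alpha).
Local Notation decay := (decay delta T).
Context (alpha_gt : 1 / 3 < alpha) (delta_gt0 : 0 < delta).
Context {Idx : Type} (S : set Idx).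
Context (A1 : Idx -> R -> R -> I -> R) (A2 : Idx -> R -> R -> I -> I -> R).
Local Notation bigO := (@bigO R T delta Idx S).
Context (HA : almost_rough T alpha delta S A1 A2).
Local Notation E x := (iter_sig (A1 x) (A2 x)).
Local Notation Xi x := (germ (E x) (A1 x) (A2 x)).

Let theta_gt1 : 1 < theta. Proof. by move: alpha_gt; lra. Qed.
Let a0 : 0 <= alpha. Proof. by move: alpha_gt; lra. Qed.
Let a20 : 0 <= 2 * alpha. Proof. by move: alpha_gt; lra. Qed.
Let th0 : 0 <= theta. Proof. by move: alpha_gt; lra. Qed.

Lemma sig_bounds r : sig_bounded T S A1 A2 r.
Proof. by have [] := sig_estimates alpha_gt delta_gt0 HA r. Qed.

Lemma sig_expansion r : sig_expands T alpha delta S A1 A2 r.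
Proof. by have [] := sig_estimates alpha_gt delta_gt0 HA r. Qed.

Lemma sig_decay r : r != [::] ->
  exists2 C : R, 0 <= C & forall x t, S x -> t <= T -> `|E x r t| <= C * decay t.
Proof. by have [] := sig_estimates alpha_gt delta_gt0 HA r. Qed.

Lemma sig_increment r : bigO true alpha (fun x s _ t => E x r t - E x r s).
Proof.
have h1 : bigO true alpha (fun x s _ t => Xi x r s t).
  by apply: (germ_order alpha_gt delta_gt0 HA) => r' _; exact: sig_bounds.
have h2 : bigO true alpha (fun x s _ t => E x r t - E x r s - Xi x r s t).
  by apply: (@bigO_le _ _ _ delta_gt0 _ _ true true theta) (sig_expansion r) => //; move: a0; lra.
by apply: eq_bigO (bigOD h2 h1) _ => x s u t _ _ _ _ _; rewrite subrK.
Qed.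

Let germ2 x k r s t : R := if r is l :: r' then E x r' s * A2 x s t l k else 0.

Let germ2_order k r : bigO true (2 * alpha) (fun x s _ t => germ2 x k r s t).
Proof.
case: r => [|l r]; first exact: bigO_cst.
by apply: (germ_level2 alpha_gt delta_gt0 HA); exact: sig_bounds.
Qed.

(** In the language of rough paths: [E r] is the derivative of [E (k :: r)] with
    respect to the letter [k]. *)
Lemma sig_increment_level1 k r : bigO true (2 * alpha) (fun x s _ t =>
  E x (k :: r) t - E x (k :: r) s - E x r s * A1 x s t k).
Proof.
have h2 : bigO true (2 * alpha) (fun x s _ t =>
    E x (k :: r) t - E x (k :: r) s - Xi x (k :: r) s t).
  by apply: (@bigO_le _ _ _ delta_gt0 _ _ true true theta) (sig_expansion _) => //; move: a0; lra.
apply: eq_bigO (bigOD h2 (germ2_order k r)) _ => x s u t _ _ _ _ _.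
by rewrite /germ /germ2 /= opprD !addrA subrK.
Qed.

(** The uniqueness principle behind the shuffle identity: increments of order
    [theta > 1] make [f] constant, and [f] vanishes at minus infinity. *)
Lemma zero_of_small_increments (f : Idx -> R -> R) :
  bigO false theta (fun x s _ t => f x t - f x s) ->
  (forall x, S x -> exists2 C : R, 0 <= C & forall t, t <= T -> `|f x t| <= C * decay t) ->
  forall x t, S x -> t <= T -> f x t = 0.
Proof.
move=> [C C0 H] fd x t Sx tT; have [K K0 hK] := fd x Sx.
apply/eqP; rewrite -normr_le0; apply/ler_addgt0Pr => e e0; rewrite add0r.
have [b0 b0T hb] := decay_small T delta_gt0 K0 e0.
pose b := Num.min b0 t; have bt : b <= t by rewrite ge_min lexx orbT.
have <- : f x b = f x t.
  apply: (small_increments_eq theta_gt1 C0 bt) => s t' bs st' t't ts.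
  have := H x Sx s s t' (lexx s) st' (le_trans t't tT) ts.
  by rewrite mulr1.
apply: (le_trans (hK _ (le_trans bt tT))).
by apply: hb; rewrite ge_min lexx.
Qed.

Lemma bigO_sum (J : Type) (L : seq J) b a (f : J -> Idx -> R -> R -> R -> R) :
  (forall j, bigO b a (f j)) -> bigO b a (fun x s u t => \sum_(j <- L) f j x s u t).
Proof.
move=> H; elim: L => [|j L ih].
  by apply: eq_bigO (bigO_cst _ _ _ _ _) _ => x s u t _ _ _ _ _; rewrite big_nil.
by apply: eq_bigO (bigOD (H j) ih) _ => x s u t _ _ _ _ _; rewrite big_cons.
Qed.

Lemma sum_decay (J : Type) (L : seq J) (r : J -> seq I) (c : J -> R) :
  (forall j, r j != [::]) ->
  exists2 C : R, 0 <= C & forall x t, S x -> t <= T ->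
    `|\sum_(j <- L) c j * E x (r j) t| <= C * decay t.
Proof.
move=> H; elim: L => [|j L [C C0 ih]].
  by exists 0 => // x t Sx tT; rewrite big_nil normr0 mul0r.
have [K K0 hK] := sig_decay (H j).
exists (`|c j| * K + C); first by rewrite addr_ge0// mulr_ge0.
move=> x t Sx tT; rewrite big_cons mulrDl (le_trans (ler_normD _ _))//.
apply: lerD; last exact: ih.
by rewrite normrM -mulrA; apply: ler_wpM2l => //; exact: hK.
Qed.

Hypothesis geo : forall i j, bigO true theta
  (fun x s _ t => A1 x s t i * A1 x s t j - (A2 x s t i j + A2 x s t j i)).

Lemma shuffle_nil_l (u : seq I) : shuffle [::] u = [:: u].
Proof. by case: u. Qed.

Lemma shuffle_nil_r (u : seq I) : shuffle u [::] = [:: u].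
Proof. by case: u. Qed.

Lemma shuffle_cons (i j : I) u v : shuffle (i :: u) (j :: v) =
  map (cons i) (shuffle u (j :: v)) ++ map (cons j) (shuffle (i :: u) v).
Proof. by []. Qed.

Let sum_germ2 i j u v x s :
  E x u s * E x (j :: v) s = \sum_(w <- shuffle u (j :: v)) E x w s ->
  E x u s * E x v s = \sum_(w <- shuffle u v) E x w s ->
  (forall k u', u = k :: u' ->
    E x u' s * E x (j :: v) s = \sum_(w <- shuffle u' (j :: v)) E x w s) ->
  forall t, \sum_(w <- shuffle u (j :: v)) germ2 x i w s t =
    germ2 x i u s t * E x (j :: v) s + E x u s * E x v s * A2 x s t j i.
Proof.
case: u => [|k u] h1 h2 h3 t.
  by rewrite !shuffle_nil_l big_seq1 /germ2 mul0r add0r [E x [::] s]/iter_sig mul1r.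
rewrite shuffle_cons big_cat/= !big_map/= -!mulr_suml -h2 -(h3 k u erefl); ring.
Qed.

Let sum_germ2_r i j u v x s :
  E x (i :: u) s * E x v s = \sum_(w <- shuffle (i :: u) v) E x w s ->
  E x u s * E x v s = \sum_(w <- shuffle u v) E x w s ->
  (forall k v', v = k :: v' ->
    E x (i :: u) s * E x v' s = \sum_(w <- shuffle (i :: u) v') E x w s) ->
  forall t, \sum_(w <- shuffle (i :: u) v) germ2 x j w s t =
    germ2 x j v s t * E x (i :: u) s + E x u s * E x v s * A2 x s t i j.
Proof.
case: v => [|k v] h1 h2 h3 t.
  by rewrite !shuffle_nil_r big_seq1 /germ2 mul0r add0r [E x [::] s]/iter_sig mulr1.
rewrite shuffle_cons big_cat/= !big_map/= -!mulr_suml -h2 -(h3 k v erefl); ring.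
Qed.

(** The product rule.  By induction on the total length, the difference of the two
    sides has increments of order [3 * alpha]: in the increment of a product of two
    signatures, the only terms that are not yet matched by the shuffle sum are the
    products of two first-order terms, [A1 i * A1 j], against [A2 i j + A2 j i], and
    by geometricity these agree up to that order. *)
Lemma sig_shuffle u v x t : S x -> t <= T ->
  E x u t * E x v t = \sum_(w <- shuffle u v) E x w t.
Proof.
have [n] := ubnP (size u + size v); elim: n => // n ih in u v x t *.
case: u => [_ Sx tT|i u].
  by rewrite shuffle_nil_l big_seq1 [E x [::] t]/iter_sig mul1r.
case: v => [_ Sx tT|j v].
  by rewrite shuffle_nil_r big_seq1 [E x [::] t]/iter_sig mulr1.
rewrite /= addSn addnS ltnS => uvn Sx tT; apply/subr0_eq.
pose f x t := E x (i :: u) t * E x (j :: v) t -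
  \sum_(w <- shuffle (i :: u) (j :: v)) E x w t.
have ih' u' v' x' t' : (size u' + size v' <= size u + size v + 1)%N -> S x' -> t' <= T ->
    E x' u' t' * E x' v' t' = \sum_(w <- shuffle u' v') E x' w t'.
  by move=> uv'; apply: ih; apply: leq_ltn_trans uvn; rewrite -addn1.
(* The last two letters of a shuffle come both from [i :: u], both from
   [j :: v], or one from each. *)
have sumE x' s t' : S x' -> s <= T ->
    \sum_(w <- shuffle (i :: u) (j :: v)) Xi x' w s t' =
    Xi x' (i :: u) s t' * E x' (j :: v) s + Xi x' (j :: v) s t' * E x' (i :: u) s +
    E x' u s * E x' v s * (A2 x' s t' i j + A2 x' s t' j i).
  move=> Sx' sT; rewrite shuffle_cons big_cat/= !big_map.
  have germE k L : \sum_(w <- L) Xi x' (k :: w) s t' =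
      (\sum_(w <- L) E x' w s) * A1 x' s t' k + \sum_(w <- L) germ2 x' k w s t'.
    by rewrite mulr_suml -big_split.
  have e1 : E x' u s * E x' (j :: v) s = \sum_(w <- shuffle u (j :: v)) E x' w s.
    by apply: ih' => //=; rewrite addnS addn1.
  have e2 : E x' (i :: u) s * E x' v s = \sum_(w <- shuffle (i :: u) v) E x' w s.
    by apply: ih' => //=; rewrite addSn addn1.
  have e3 : E x' u s * E x' v s = \sum_(w <- shuffle u v) E x' w s.
    by apply: ih' => //; rewrite leq_addr.
  rewrite !germE -e1 -e2 (sum_germ2 i e1 e3); last first.
    by move=> k u' uE; apply: ih' => //=; rewrite uE /= addn1 addnS !addSn leqnSn.
  rewrite (sum_germ2_r j e2 e3); last first.
    by move=> k v' vE; apply: ih' => //=; rewrite vE /= addn1 !addnS ?addSn leqnSn.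
  rewrite /germ -!/(germ2 _ _ _ _ _); ring.
pose g1 x s t := E x (i :: u) t - E x (i :: u) s - E x u s * A1 x s t i.
pose g2 x s t := E x (j :: v) t - E x (j :: v) s - E x v s * A1 x s t j.
have b0 w : bigO false 0 (fun x s _ _ => E x w s).
  by have [] := bigO_fun0 delta (sig_bounds w).
have mul0 a w g : 0 <= a -> bigO true a g -> bigO true a (fun x s u t => E x w s * g x s u t).
  move=> ga hg; have := bigOM delta_gt0 (lexx 0) ga (b0 w) hg; rewrite add0r; exact.
have c1 : bigO true theta (fun x s _ t => g1 x s t * (E x (j :: v) t - E x (j :: v) s)).
  have -> : theta = 2 * alpha + alpha by ring.
  apply: (@bigOM _ _ _ delta_gt0 _ _ true true) => //; last exact: sig_increment.
  exact: sig_increment_level1.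
have c2 : bigO true theta (fun x s _ t => (E x u s * A1 x s t i) * g2 x s t).
  have -> : theta = alpha + 2 * alpha by ring.
  apply: (@bigOM _ _ _ delta_gt0 _ _ true true) => //; last exact: sig_increment_level1.
  by apply: mul0 => //; exact: (ar_level1 HA).
have c3 := mul0 _ u _ th0 (mul0 _ v _ th0 (geo i j)).
have c4 := mul0 _ (i :: u) _ th0 (sig_expansion (j :: v)).
have c5 := mul0 _ (j :: v) _ th0 (sig_expansion (i :: u)).
have c6 := bigO_sum (shuffle (i :: u) (j :: v)) (fun w => sig_expansion w).
apply: (@zero_of_small_increments f _ _ x t Sx tT).
  apply: (@bigO_le _ _ _ delta_gt0 _ _ true false theta) => //.
  apply: eq_bigO (bigOB (bigOD (bigOD (bigOD (bigOD c1 c2) c3) c4) c5) c6) _.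
  move=> x' s u' t' Sx' su' u't' t'T _.
  rewrite !sumrB sumE//; last exact: le_trans (le_trans su' u't') t'T.
  by rewrite /f /g1 /g2; ring.
move=> x' Sx'.
have [K1 K10 h1] := @sig_decay (i :: u) isT.
have [K2 K20 h2] := sig_bounds (j :: v).
have [K3 K30 h3] : exists2 C : R, 0 <= C & forall x t, S x -> t <= T ->
    `|\sum_(w <- shuffle (i :: u) (j :: v)) E x w t| <= C * decay t.
  rewrite shuffle_cons.
  have [K3 K30 h3] := @sum_decay _ (shuffle u (j :: v)) (cons i) (fun=> 1) (fun=> isT).
  have [K4 K40 h4] := @sum_decay _ (shuffle (i :: u) v) (cons j) (fun=> 1) (fun=> isT).
  exists (K3 + K4); first exact: addr_ge0.
  move=> y t' Sy t'T; rewrite big_cat/= !big_map mulrDl (le_trans (ler_normD _ _))//.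
  have s1 (L : seq (seq I)) k :
      \sum_(w <- L) 1 * E y (k :: w) t' = \sum_(w <- L) E y (k :: w) t'.
    by apply: eq_bigr => w _; rewrite mul1r.
  by move: (h3 y t' Sy t'T) (h4 y t' Sy t'T); rewrite !s1 => *; apply: lerD.
exists (K1 * K2 + K3); first by rewrite addr_ge0// mulr_ge0.
move=> t' t'T; rewrite /f mulrDl (le_trans (ler_normB _ _))//.
apply: lerD; last exact: h3.
rewrite normrM mulrAC; apply: ler_pM => //; [exact: h1|exact: h2].
Qed.

End shuffle_identity.

(** * Linear functionals of the signature *)
Section word_functionals.
Context {R : realType} {I : eqType}.
Implicit Types (e : seq I -> R) (L : seq (R * seq I)).

Definition ev e L : R := \sum_(p <- L) p.1 * e p.2.

Definition shuffle_mul L L' : seq (R * seq I) :=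
  flatten [seq flatten [seq [seq (p.1 * q.1, w) | w <- shuffle p.2 q.2] | q <- L'] | p <- L].

Lemma ev_cons e p L : ev e (p :: L) = p.1 * e p.2 + ev e L.
Proof. by rewrite /ev big_cons. Qed.

Lemma ev_nil e : ev e [::] = 0.
Proof. by rewrite /ev big_nil. Qed.

Lemma ev_cat e L L' : ev e (L ++ L') = ev e L + ev e L'.
Proof. by rewrite /ev big_cat. Qed.

Lemma ev_mul e L L' :
  (forall u v, e u * e v = \sum_(w <- shuffle u v) e w) ->
  ev e (shuffle_mul L L') = ev e L * ev e L'.
Proof.
move=> he; rewrite /ev /shuffle_mul big_flatten/= big_map mulr_suml.
apply: eq_bigr => p _; rewrite big_flatten/= big_map mulr_sumr.
apply: eq_bigr => q _; rewrite big_map/= -mulr_sumr -he; ring.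
Qed.

End word_functionals.

(** * Inequalities for exponentials and powers *)
Section exponential_inequalities.
Context {R : realType}.
Implicit Types y : R.

Lemma expR_sub1_le y : expR y - 1 <= y * expR y.
Proof.
have := expR_ge1Dx (- y); rewrite expRN => h.
have e0 : 0 < expR y := expR_gt0 y.
have : (1 - y) * expR y <= (expR y)^-1 * expR y by apply: ler_wpM2r => //; exact: ltW.
rewrite mulVf ?gt_eqF//; lra.
Qed.

Lemma expR_sub1D_le y : 0 <= y -> expR y - 1 - y <= y ^+ 2 * expR y.
Proof.
move=> y0; have h := expR_sub1_le y.
have : y * (expR y - 1) <= y * (y * expR y) by apply: ler_wpM2l.
rewrite expr2; lra.
Qed.

Lemma powR_bernoulli y n : 0 <= y -> 1 + n%:R * y <= (1 + y) ^+ n.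
Proof.
move=> y0; elim: n => [|n ih]; first by rewrite mul0r addr0 expr0.
rewrite exprS -natr1; apply: (@le_trans _ _ ((1 + y) * (1 + n%:R * y))).
  have : 0 <= n%:R * y * y by rewrite !mulr_ge0.
  lra.
by apply: ler_wpM2l => //; rewrite addr_ge0.
Qed.

End exponential_inequalities.

(** * The signature at the terminal time determines its past *)
Section separation.
Context {R : realType} (T alpha delta : R) {I : eqType}.
Local Notation theta := (3 * alpha).
Local Notation decayd := (decay delta T).
Context (alpha_gt : 1 / 3 < alpha) (alpha_le : alpha <= 1 / 2) (delta_gt0 : 0 < delta).
Context {Idx : Type} (S : set Idx).
Context (A1 : Idx -> R -> R -> I -> R) (A2 : Idx -> R -> R -> I -> I -> R).
Local Notation bigO := (@bigO R T delta Idx S).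
Context (HA : almost_rough T alpha delta S A1 A2).
Local Notation E x := (iter_sig (A1 x) (A2 x)).
Local Notation Xi x := (germ (E x) (A1 x) (A2 x)).
Hypothesis geo : forall i j, bigO true theta
  (fun x s _ t => A1 x s t i * A1 x s t j - (A2 x s t i j + A2 x s t j i)).
Context (o : I) (mu : R) (mu_gt0 : 0 < mu) (delta_le : delta <= mu).
Local Notation clock := (decay mu T).
Hypothesis A1_clock : forall x s t, S x -> s <= t -> t <= T ->
  A1 x s t o = clock s * (t - s).
Hypothesis A2_clock : forall x s t l, S x -> s <= t -> t <= T -> A2 x s t l o = 0.

Let theta_gt1 : 1 < theta. Proof. by move: alpha_gt; lra. Qed.

Let clock_ge0 t : 0 <= clock t. Proof. exact: decay_ge0. Qed.

Let clock_le1 t : t <= T -> clock t <= 1. Proof. exact: decay_le1. Qed.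

Lemma clock_increment s t : clock t - clock s = clock s * (expR (mu * (t - s)) - 1).
Proof. by rewrite mulrBr mulr1 /decay -expRD; congr (expR _ - _); ring. Qed.

Lemma clock_increment_ge s t : mu * (clock s * (t - s)) <= clock t - clock s.
Proof.
rewrite clock_increment mulrCA; apply: ler_wpM2l => //.
have := expR_ge1Dx (mu * (t - s)); lra.
Qed.

Lemma clock_order : bigO false theta
  (fun _ s _ t => clock t - clock s - mu * (clock s * (t - s))).
Proof.
exists (mu ^+ 2 * expR mu); first by rewrite mulr_ge0 ?sqr_ge0// expR_ge0.
move=> x Sx s u t su ut tT ts; rewrite mulr1.
have st := le_trans su ut; have h0 : 0 <= t - s by rewrite subr_ge0.
have hm : 0 <= mu * (t - s) by rewrite mulr_ge0// ltW.
rewrite clock_increment.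
have -> : clock s * (expR (mu * (t - s)) - 1) - mu * (clock s * (t - s)) =
  clock s * (expR (mu * (t - s)) - 1 - mu * (t - s)) by ring.
have e0 : 0 <= expR (mu * (t - s)) - 1 - mu * (t - s).
  have := expR_ge1Dx (mu * (t - s)); lra.
rewrite ger0_norm ?mulr_ge0//.
apply: (@le_trans _ _ ((mu * (t - s)) ^+ 2 * expR (mu * (t - s)))).
  apply: le_trans (expR_sub1D_le hm); apply: ler_piMl => //.
  by apply: clock_le1; exact: le_trans tT.
rewrite exprMn -[leRHS]mulrA [expR mu * _]mulrC -[leLHS]mulrA.
apply: ler_wpM2l; first exact: sqr_ge0.
apply: ler_pM; rewrite ?sqr_ge0 ?expR_ge0//.
  rewrite -powR_mulrn//; apply: powR_le_powR => //; last exact: ltW.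
    by move: alpha_gt; lra.
  by move: alpha_le; lra.
by rewrite ler_expR; apply: ler_piMr; [exact: ltW|exact: ltW].
Qed.

Lemma bigOZ a (c : R) (f : Idx -> R -> R -> R -> R) : bigO false a f ->
  bigO false a (fun x s u t => c * f x s u t).
Proof.
move=> [C C0 H]; exists (`|c| * C); first exact: mulr_ge0.
move=> x Sx s u t su ut tT ts; rewrite normrM -!mulrA; apply: ler_wpM2l => //.
by rewrite mulrA; exact: H.
Qed.

Let expansion r : bigO false theta (fun x s _ t => E x r t - E x r s - Xi x r s t).
Proof.
apply: (@bigO_le _ _ _ delta_gt0 _ _ true false theta) => //; last first.
  exact: (sig_expansion alpha_gt delta_gt0 HA).
by rewrite (le_trans ler01)// ltW.
Qed.

Let germ_clock x r s t : S x -> s <= t -> t <= T ->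
  Xi x (o :: r) s t = E x r s * (clock s * (t - s)).
Proof.
move=> Sx st tT; rewrite /germ A1_clock//.
by case: r => [|l r]; rewrite ?A2_clock// ?mulr0 addr0.
Qed.

(** The letter [o] integrates [d clock / mu], so that polynomials of the clock are
    linear functionals of the signature, through the shuffle product. *)
Lemma sig_clock x t : S x -> t <= T -> mu * E x [:: o] t = clock t.
Proof.
move=> Sx tT; apply/subr0_eq; move: x t Sx tT.
apply: (@zero_of_small_increments _ _ _ _ alpha_gt delta_gt0 _ S
  (fun x t => mu * E x [:: o] t - clock t)).
- apply: eq_bigO (bigOB (bigOZ mu (expansion [:: o])) clock_order) _.
  move=> x s u t Sx su ut tT ts; rewrite germ_clock//; last exact: le_trans ut.
  by rewrite [E x [::] s]/iter_sig; ring.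
- move=> x Sx; have [K K0 h] := sig_decay alpha_gt delta_gt0 HA (isT : [:: o] != [::]).
  exists (mu * K + 1) => [|t tT]; first by rewrite addr_ge0// mulr_ge0// ltW.
  rewrite mulrDl mul1r (le_trans (ler_normB _ _))//; apply: lerD.
    rewrite normrM gtr0_norm// -mulrA; apply: ler_wpM2l; [exact: ltW|exact: h].
  rewrite ger0_norm// ler_expR lerN2; apply: ler_wpM2r => //; by rewrite subr_ge0.
Qed.

Definition clock_int (L : seq (R * seq I)) := [seq (p.1, o :: p.2) | p <- L].

Lemma ev_clock_int L : bigO false theta (fun x s _ t =>
  ev (E x ^~ t) (clock_int L) - ev (E x ^~ s) (clock_int L) -
  ev (E x ^~ s) L * (clock s * (t - s))).
Proof.
apply: eq_bigO (bigO_sum L (fun p => bigOZ p.1 (expansion (o :: p.2)))) _.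
move=> x s u t Sx su ut tT ts; rewrite /ev /clock_int !big_map mulr_suml -!sumrB.
by apply: eq_bigr => p _; rewrite germ_clock//; [ring|exact: le_trans ut].
Qed.

Section two_paths.
Context (x y : Idx) (Sx : S x) (Sy : S y) (xyT : forall r, E x r T = E y r T).

Let D L t := ev (E x ^~ t) L - ev (E y ^~ t) L.

Let D_T L : D L T = 0.
Proof.
rewrite /D /ev (eq_bigr (fun p => p.1 * E y p.2 T)) ?subrr// => p _.
by rewrite xyT.
Qed.

Let D_clock_int L : exists2 C : R, 0 <= C & forall s t, s <= t -> t <= T -> t - s < 1 ->
  `|D (clock_int L) t - D (clock_int L) s - D L s * (clock s * (t - s))| <=
    C * (t - s) `^ theta.
Proof.
have [C C0 H] := ev_clock_int L; exists (C + C); first exact: addr_ge0.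
move=> s t st tT ts.
have := H x Sx s s t (lexx s) st tT ts; have := H y Sy s s t (lexx s) st tT ts.
rewrite mulr1 /= => hy hx.
have -> : D (clock_int L) t - D (clock_int L) s - D L s * (clock s * (t - s)) =
  (ev (E x ^~ t) (clock_int L) - ev (E x ^~ s) (clock_int L) -
     ev (E x ^~ s) L * (clock s * (t - s))) -
  (ev (E y ^~ t) (clock_int L) - ev (E y ^~ s) (clock_int L) -
     ev (E y ^~ s) L * (clock s * (t - s))) by rewrite /D; ring.
by rewrite mulrDl (le_trans (ler_normB _ _))// lerD.
Qed.

Let D_decay L : exists2 C : R, 0 <= C & forall t, t <= T ->
  `|D (clock_int L) t| <= C * decayd t.
Proof.
have [C C0 H] := sum_decay alpha_gt delta_gt0 HA L (r := fun p => o :: p.2)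
  (fun p => p.1) (fun=> isT).
exists (C + C); first exact: addr_ge0.
move=> t tT; rewrite mulrDl /D /ev /clock_int !big_map (le_trans (ler_normB _ _))//.
by apply: lerD; exact: H.
Qed.

Variables (a b : R).

Let P : seq (R * seq I) :=
  (1, [::]) :: shuffle_mul [:: (mu, [:: o]); (- clock a, [::])]
                           [:: (- mu, [:: o]); (clock b, [::])].

Let Q r n : seq (R * seq I) := iter n (shuffle_mul P) [:: (1, r)].

Let p t := 1 + (clock t - clock a) * (clock b - clock t).

Let ev_Q z r n t : S z -> t <= T -> ev (E z ^~ t) (Q r n) = p t ^+ n * E z r t.
Proof.
move=> Sz tT.
have he u v : E z u t * E z v t = \sum_(w <- shuffle u v) E z w t.
  exact: (sig_shuffle alpha_gt delta_gt0 HA geo).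
have evP : ev (E z ^~ t) P = p t.
  rewrite /P ev_cons ev_mul// !ev_cons !ev_nil /= [E z [::] t]/iter_sig !mulNr sig_clock//.
  by rewrite /p; ring.
elim: n => [|n ih]; first by rewrite /Q/= ev_cons ev_nil /=; ring.
by rewrite /Q iterS ev_mul// -/(Q r n) ih evP exprS mulrA.
Qed.

Let p_out t : a <= b -> b <= T -> t <= T -> ~~ (a <= t <= b) -> 0 <= p t <= 1.
Proof.
move=> ab bT tT h.
have ca := ler_decay T mu_gt0 ab; have cb := clock_le1 bT; have ct := clock_le1 tT.
have ca0 := clock_ge0 a; have cb0 := clock_ge0 b; have ct0 := clock_ge0 t.
have n1 (u v : R) : 0 <= u -> u <= 1 -> 0 <= v -> v <= 1 -> 0 <= u * v <= 1.
  by move=> *; rewrite mulr_ge0// mulr_ile1.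
move: h; rewrite negb_and -!ltNge => /orP[/ltW ta|/ltW bt].
  have cta := ler_decay T mu_gt0 ta.
  have : 0 <= (clock a - clock t) * (clock b - clock t) <= 1 by apply: n1; lra.
  rewrite /p; lra.
have cbt := ler_decay T mu_gt0 bt.
have : 0 <= (clock t - clock a) * (clock t - clock b) <= 1 by apply: n1; lra.
rewrite /p; lra.
Qed.

Let p_in t : a <= t -> t <= b -> 1 <= p t.
Proof.
move=> at_ tb; have := ler_decay T mu_gt0 at_; have := ler_decay T mu_gt0 tb => h1 h2.
by rewrite /p lerDl mulr_ge0// subr_ge0.
Qed.

Let Dr r t := E x r t - E y r t.

Let D_Q r n t : t <= T -> D (Q r n) t = p t ^+ n * Dr r t.
Proof. by move=> tT; rewrite /D !ev_Q// /Dr; ring. Qed.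

(** A moment argument.  Let [p] be the quadratic polynomial of the clock that is at
    least 1 on [a, b] and has values in [0, 1] elsewhere.  The functional
    [clock_int (Q r n)] integrates [p ^+ n * Dr r] against the clock over the whole
    past, and it vanishes at the terminal time, because the two signatures agree
    there.  But the part outside [a, b] is bounded by [M / mu] for all [n], while the
    part inside is nonnegative and grows like [(1 + kappa) ^+ n] on the middle third
    [a', b']. *)
Lemma no_positive_gap r c : a < b -> b <= T -> 0 < c ->
  ~ (forall t, a <= t -> t <= b -> c <= E x r t - E y r t).
Proof.
move=> ab bT c0 hc.
have th0 : 0 <= theta by rewrite (le_trans ler01)// ltW.
pose a' := a + (b - a) / 3; pose b' := b - (b - a) / 3.
have aa' : a < a' by rewrite /a'; lra.
have a'b' : a' < b' by rewrite /a' /b'; lra.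
have b'b : b' < b by rewrite /b'; lra.
have aT : a <= T by rewrite (le_trans _ bT)// ltW.
have cgt0 t : 0 < clock t by exact: decay_gt0.
have cinc s t : s < t -> clock s < clock t.
  move=> st; rewrite -subr_gt0; apply: lt_le_trans (clock_increment_ge s t).
  by rewrite !mulr_gt0// subr_gt0.
have [M M0 hM] : exists2 M, 0 <= M & forall t, t <= T -> `|Dr r t| <= M.
  have [C C0 H] := sig_bounds alpha_gt delta_gt0 HA r.
  exists (C + C) => [|t tT]; first exact: addr_ge0.
  by rewrite (le_trans (ler_normB _ _))// lerD// H.
pose kappa := (clock a' - clock a) * (clock b - clock b').
have kappa0 : 0 < kappa by rewrite /kappa mulr_gt0// subr_gt0 cinc.
have kappa1 : 0 <= 1 + kappa by rewrite addr_ge0// ltW.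
pose c1 := c * clock a * (b' - a').
have c10 : 0 < c1 by rewrite /c1 !mulr_gt0// subr_gt0.
(* impossible for large [n], by Bernoulli's inequality *)
suff bnd n : (1 + kappa) ^+ n * c1 <= M / mu.
  pose n := Num.bound (M / mu / c1 / kappa).
  have := bnd n; apply/negP; rewrite -ltNge -ltr_pdivrMr//.
  apply: lt_le_trans (powR_bernoulli n (ltW kappa0)).
  have : M / mu / c1 / kappa < n%:R.
    by apply: archi_boundP; rewrite !divr_ge0// ltW.
  rewrite ltr_pdivrMr//; lra.
have [C C0 H] := D_clock_int (Q r n).
(* adding the integral of [M] makes the integrand nonnegative everywhere *)
pose Phi t := D (clock_int (Q r n)) t + M / mu * clock t.
have Phi_inc s t : s <= t -> t <= T -> t - s < 1 ->
    (p s ^+ n * Dr r s + M) * (clock s * (t - s)) - C * (t - s) `^ theta <= Phi t - Phi s.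
  move=> st tT ts; have := H s t st tT ts.
  rewrite D_Q; last exact: le_trans tT.
  rewrite ler_norml => /andP[h _].
  have h2 : M * (clock s * (t - s)) <= M / mu * (clock t - clock s).
    apply: (@le_trans _ _ (M / mu * (mu * (clock s * (t - s))))).
      by rewrite [leRHS]mulrA divfK// gt_eqF.
    by apply: ler_wpM2l; [rewrite divr_ge0// ltW|exact: clock_increment_ge].
  have -> : Phi t - Phi s = (D (clock_int (Q r n)) t - D (clock_int (Q r n)) s) +
    M / mu * (clock t - clock s) by rewrite /Phi; ring.
  rewrite mulrDl; lra.
have Dr_ge s : s <= T -> - M <= p s ^+ n * Dr r s.
  move=> sT; have [/andP[as_ sb]|h] := boolP (a <= s <= b).
    apply: (@le_trans _ _ 0); first by rewrite oppr_le0.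
    rewrite mulr_ge0//; last by apply: le_trans (hc _ as_ sb); exact: ltW.
    by rewrite exprn_ge0// (le_trans ler01)// p_in.
  have /andP[p0 p1] := p_out (ltW ab) bT sT h.
  have : `|p s ^+ n * Dr r s| <= M.
    rewrite normrM -[leRHS]mul1r; apply: ler_pM => //; last exact: hM.
    by rewrite ger0_norm ?exprn_ge0// exprn_ile1.
  by rewrite ler_norml => /andP[].
have Phi_mono s t : s <= t -> t <= T -> Phi s <= Phi t.
  move=> st tT; apply: (small_increments_le theta_gt1 C0 st) => u v su uv vt uv1.
  have vT := le_trans vt tT.
  apply: le_trans (Phi_inc u v uv vT uv1); rewrite lerBrDl subrr.
  apply: mulr_ge0; last by rewrite mulr_ge0// subr_ge0.
  by rewrite -lerBlDr sub0r; apply: Dr_ge; exact: le_trans vT.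
have Phi_mid : (1 + kappa) ^+ n * c1 <= Phi b' - Phi a'.
  pose c2 := (1 + kappa) ^+ n * c * clock a.
  suff : Phi a' - c2 * a' <= Phi b' - c2 * b' by rewrite /c1 /c2; lra.
  apply: (small_increments_le theta_gt1 (f := fun t => Phi t - c2 * t) C0 (ltW a'b')).
  move=> u v su uv vt uv1; have vT : v <= T by lra.
  have -> : Phi v - c2 * v - (Phi u - c2 * u) = Phi v - Phi u - c2 * (v - u) by ring.
  suff : c2 * (v - u) <= (p u ^+ n * Dr r u + M) * (clock u * (v - u)).
    have := Phi_inc u v uv vT uv1; lra.
  rewrite mulrA; apply: ler_wpM2r; first by rewrite subr_ge0.
  have au : a <= u by lra.
  have ub : u <= b by lra.
  apply: ler_pM => //.
  - by apply: mulr_ge0; [exact: exprn_ge0|exact: ltW].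
  - rewrite -[leLHS]addr0; apply: lerD => //; apply: ler_pM => //; last exact: hc.
    + exact: exprn_ge0.
    + exact: ltW.
    apply: lerXn2r; rewrite ?nnegrE//.
      by rewrite (le_trans ler01)// p_in.
    rewrite /p lerD2l /kappa; apply: ler_pM; rewrite ?subr_ge0.
    + by apply: ler_decay => //; lra.
    + by apply: ler_decay => //; lra.
    + by apply: lerB => //; apply: ler_decay.
    + by apply: lerB => //; apply: ler_decay => //; lra.
  - exact: ler_decay.
have Phi_T : Phi T = M / mu.
  by rewrite /Phi D_T add0r /decay subrr mulr0 oppr0 expR0 mulr1.
have Phi_ge0 : 0 <= Phi a'.
  have [K K0 hK] := D_decay (Q r n).
  rewrite -oppr_le0; apply/ler_addgt0Pr => e e0; rewrite add0r.
  have [b0 b0T hb] := decay_small T delta_gt0 K0 e0.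
  pose s := Num.min b0 a'.
  have sa : s <= a' by rewrite ge_min lexx orbT.
  have sT : s <= T by rewrite ge_min b0T.
  have a'T : a' <= T by lra.
  rewrite (@le_trans _ _ (- Phi s)) ?lerN2 ?Phi_mono//.
  have h1 : - D (clock_int (Q r n)) s <= e.
    rewrite (le_trans (ler_norm _))// normrN (le_trans (hK s sT))//.
    by apply: hb; rewrite ge_min lexx.
  have h2 : 0 <= M / mu * clock s by rewrite mulr_ge0// divr_ge0// ltW.
  by rewrite /Phi opprD; lra.
have b'T : b' <= T by lra.
by have := Phi_mono b' T b'T (lexx T); rewrite Phi_T; lra.
Qed.

End two_paths.

(** The coordinates are continuous in time, so that a gap at one time persists on
    an interval. *)
Lemma sig_separates x y : S x -> S y -> (forall r, E x r T = E y r T) ->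
  forall r t, t <= T -> E x r t = E y r t.
Proof.
suff main x' y' : S x' -> S y' -> (forall r, E x' r T = E y' r T) ->
    forall r t, t <= T -> E x' r t <= E y' r t.
  move=> Sx Sy xy r t tT; apply/eqP; rewrite eq_le !main//.
move=> Sx Sy xy r t tT; rewrite leNgt; apply/negP => gap.
pose c := (E x' r t - E y' r t) / 2.
have c0 : 0 < c by rewrite divr_gt0// subr_gt0.
have [C C0 H] := sig_increment alpha_gt delta_gt0 HA r.
have K0 : 0 <= 2 * C by rewrite mulr_ge0.
have th1 : 1 < 1 + alpha by move: alpha_gt; lra.
have [eta [eta0 eta1]] := exists_small_powR th1 K0 c0.
rewrite addrAC subrr add0r => he.
apply: (no_positive_gap Sx Sy xy (a := t - eta) (b := t) (r := r) _ tT c0); first lra.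
move=> s s1 s2; have ts1 : t - s < 1 by lra.
have hh z : S z -> `|E z r t - E z r s| <= C * eta `^ alpha.
  move=> Sz; apply: (le_trans (H z Sz s s t (lexx s) s2 tT ts1)).
  apply: ler_pM => //; rewrite ?mulr_ge0 ?decay_ge0 ?powR_ge0//.
    by apply: ler_piMr => //; exact: decay_le1.
  by apply: ler_powR_base; [move: alpha_gt; lra|lra|lra].
have e1 : 2 * (C * eta `^ alpha) <= c by rewrite mulrA.
have := hh x' Sx; have := hh y' Sy; rewrite !ler_norml => /andP[? ?] /andP[? ?].
move: e1; rewrite /c; lra.
Qed.

End separation.

(** * Coordinates of tensors *)
Section tensor_coordinates.
Context {R : realType} {m : nat}.

Lemma tnorm_coord n (a : tensor R m) w : size w = n -> `|a w| <= tnorm n a.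
Proof.
move=> /eqP wn; rewrite -sqrtr_sqr /tnorm ler_wsqrtr// (bigD1 (Tuple wn))//= lerDl.
by apply: sumr_ge0 => i _; exact: sqr_ge0.
Qed.

Lemma tmul_homogeneous1 (a b : tensor R m) i j : homogeneous 1 a -> homogeneous 1 b ->
  tmul a b [:: i; j] = a [:: i] * b [:: j].
Proof.
move=> ha hb; rewrite /tmul 3!big_ord_recl big_ord0 /= /bump/=.
by rewrite (ha [::])// (hb [::])// mul0r mulr0 add0r !addr0.
Qed.

Lemma word_weight1 (mu : 'rV[R]_m) i : word_weight mu [:: i] = mu 0 i.
Proof. by rewrite /word_weight big_seq1. Qed.

Lemma word_weight2 (mu : 'rV[R]_m) i j : word_weight mu [:: i; j] = mu 0 i + mu 0 j.
Proof. by rewrite /word_weight big_cons big_seq1. Qed.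

Lemma dilate_coord_le (T alpha M : R) (rho : 'rV[R]_m) n (A : two_param R m) u v w :
  (weighted_norm T alpha rho n A <= M%:E)%E -> size w = n ->
  u < v -> v <= T -> v - u < 1 ->
  `|A u v w| <= M * expR (word_weight rho w * (T - u)) * (v - u) `^ alpha.
Proof.
move=> nA wn uv vT vu.
have := le_trans (weighted_norm_ub alpha rho A uv vT vu) nA.
have h0 : 0 < v - u by rewrite subr_gt0.
rewrite lee_fin gtr0_norm// ler_pdivrMr ?powR_gt0// => h.
have := le_trans (tnorm_coord (dilate rho (T - u) (A u v)) wn) h.
rewrite /dilate normrM ger0_norm ?expR_ge0// expRN mulrC ler_pdivrMr ?expR_gt0//.
by rewrite mulrAC.
Qed.

End tensor_coordinates.

Lemma exists_pos_lower_bound {R : realType} {I : finType} (f : I -> R) :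
  (forall i, 0 < f i) -> exists2 delta, 0 < delta & forall i, delta <= f i.
Proof.
move=> f0; exists (\big[Num.min/1]_i f i); first by apply: lt_bigmin.
by move=> i; exact: bigmin_le.
Qed.

(** * The weighted levels of a time-augmented rough path *)
Section weighted_levels.
Context {R : realType} {d : nat} (T alpha : R) (lam : 'rV[R]_d.+1) (rho : 'rV[R]_d).
Local Notation C := (geo_rough_path T alpha rho).
Implicit Types X : C.

(** The weight of a word is the sum of the weights of its letters, so that the
    dilations can be distributed over the integrators: up to a factor that depends
    only on the current time, the fading-memory signature is the iterated integral
    against [expR (- (lam 0 k * (T - s)))] times the increments of the letter [k]. *)
Definition weighted1 X (s t : R) (k : 'I_d.+1) : R :=
  decay (lam 0 k) T s * time_aug1 X.1 s t [:: k].

(** The entries that involve time are replaced by 0.  They are of order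
    [1 + alpha >= 3 * alpha] and thus do not contribute to any integral, see
    [time_aug2_order]. *)
Definition space2 X (s t : R) (l k : 'I_d.+1) : R :=
  match unlift ord0 l, unlift ord0 k with
  | Some i, Some j => X.2 s t [:: i; j]
  | _, _ => 0
  end.

Definition weighted2 X (s t : R) (l k : 'I_d.+1) : R :=
  decay (lam 0 l + lam 0 k) T s * space2 X s t l k.

(** A bounded set of rough paths, on which all estimates are uniform. *)
Definition norm_le (M : R) : set C := [set X |
  (weighted_norm T alpha rho 1 X.1 <= M%:E)%E /\
  (weighted_norm T (2 * alpha) rho 2 X.2 <= M%:E)%E].

Lemma increment_additive X s u t w : s <= u -> u <= t -> t <= T ->
  X.1 s t w = X.1 s u w + X.1 u t w.
Proof.
move=> su ut tT; have [_ _ [x xE] _ _] := grp_rough X.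
rewrite !xE// ?(le_trans su)// ?(le_trans ut)//; ring.
Qed.

Lemma increment_refl X s w : s <= T -> X.1 s s w = 0.
Proof. by move=> sT; have := increment_additive X w (lexx s) (lexx s) sT; lra. Qed.

Lemma second_chen X s u t i j : s <= u -> u <= t -> t <= T ->
  X.2 s t [:: i; j] = X.2 s u [:: i; j] + X.2 u t [:: i; j] +
    X.1 s u [:: i] * X.1 u t [:: j].
Proof.
move=> su ut tT; have [_ Xh _ _ Xc] := grp_rough X.
rewrite (Xc _ _ _ su ut tT) tmul_homogeneous1//; [exact: (Xh _ _).1|exact: (Xh _ _).1].
Qed.

Lemma second_refl X s i j : s <= T -> X.2 s s [:: i; j] = 0.
Proof.
move=> sT; have := second_chen X i j (lexx s) (lexx s) sT.
by rewrite increment_refl// mul0r; lra.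
Qed.

Lemma second_sym X s t i j : s <= t -> t <= T ->
  X.1 s t [:: i] * X.1 s t [:: j] = X.2 s t [:: i; j] + X.2 s t [:: j; i].
Proof.
move=> st tT; have [_ Xh _ _ _] := grp_rough X.
have := congr1 (fun f => f [:: i; j]) (grp_geo X st tT).
rewrite /sym2 tmul_homogeneous1 /=; [|exact: (Xh _ _).1|exact: (Xh _ _).1].
by rewrite [rev _]/=; lra.
Qed.

Lemma increment_le M X s t i : norm_le M X -> s <= t -> t <= T -> t - s < 1 ->
  0 < alpha -> 0 <= M ->
  `|X.1 s t [:: i]| <= M * expR (rho 0 i * (T - s)) * (t - s) `^ alpha.
Proof.
move=> [X1 _]; rewrite le_eqVlt => /predU1P[<- sT _ _ M0|st tT ts _ _].
  by rewrite increment_refl// normr0 !mulr_ge0 ?expR_ge0 ?powR_ge0.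
have := dilate_coord_le X1 (erefl : size [:: i] = 1%N) st tT ts.
by rewrite word_weight1.
Qed.

Lemma second_le M X s t i j : norm_le M X -> s <= t -> t <= T -> t - s < 1 ->
  0 < alpha -> 0 <= M ->
  `|X.2 s t [:: i; j]| <=
    M * expR ((rho 0 i + rho 0 j) * (T - s)) * (t - s) `^ (2 * alpha).
Proof.
move=> [_ X2]; rewrite le_eqVlt => /predU1P[<- sT _ _ M0|st tT ts _ _].
  by rewrite second_refl// normr0 !mulr_ge0 ?expR_ge0 ?powR_ge0.
have := dilate_coord_le X2 (erefl : size [:: i; j] = 2%N) st tT ts.
by rewrite word_weight2.
Qed.

Context (alpha_gt : 1 / 3 < alpha) (alpha_le : alpha <= 1 / 2).
Context (delta : R) (delta_gt0 : 0 < delta).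
Hypothesis lam_gt0 : forall k, 0 < lam 0 k.
Hypothesis delta_clock : delta <= lam 0 ord0.
Hypothesis delta_space : forall i : 'I_d, delta <= lam 0 (lift ord0 i) - rho 0 i.
Context (M : R) (M_ge0 : 0 <= M).
Local Notation theta := (3 * alpha).
Local Notation bigO := (@bigO R T delta C (norm_le M)).

Let a0 : 0 < alpha. Proof. by move: alpha_gt; lra. Qed.
Let th0 : 0 <= theta. Proof. by move: alpha_gt; lra. Qed.

(* the growth allowed by [rho] is beaten by the weight *)
Let weight_le (c r s t : R) : delta <= c - r -> s <= t -> t <= T ->
  decay c T s * expR (r * (T - s)) <= decay delta T t.
Proof.
move=> cr st tT; apply: le_trans (ler_decay T delta_gt0 st).
rewrite /decay -expRD ler_expR.
have : delta * (T - s) <= (c - r) * (T - s).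
  by apply: ler_wpM2r => //; rewrite subr_ge0 (le_trans st).
lra.
Qed.

Lemma weighted1_time_order : bigO true 1 (fun X s _ t => weighted1 X s t ord0).
Proof.
exists 1 => // X _ s u t su ut tT ts; have st := le_trans su ut.
rewrite /weighted1 /time_aug1 unlift_none normrM ger0_norm ?decay_ge0//.
rewrite ger0_norm ?subr_ge0// powRr1 ?subr_ge0// mul1r.
apply: ler_wpM2r; first by rewrite subr_ge0.
have := @weight_le (lam 0 ord0) 0 s t; rewrite subr0 mul0r expR0 mulr1; exact.
Qed.

Lemma weighted1_order k : bigO true alpha (fun X s _ t => weighted1 X s t k).
Proof.
case: (unliftP ord0 k) => [i|] -> ; last first.
  apply: (@bigO_le _ _ _ delta_gt0 _ _ true true 1) weighted1_time_order => //.
    exact: ltW.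
  by move: alpha_le; lra.
exists M => // X XM s u t su ut tT ts; have st := le_trans su ut.
rewrite /weighted1 /time_aug1 liftK normrM ger0_norm ?decay_ge0//.
apply: le_trans (ler_wpM2l (decay_ge0 _ _ _) (increment_le i XM st tT ts a0 M_ge0)) _.
rewrite mulrA mulrCA; apply: ler_wpM2r; first exact: powR_ge0.
by apply: ler_wpM2l => //; exact: weight_le.
Qed.

Lemma weighted2_order l k : bigO true (2 * alpha) (fun X s _ t => weighted2 X s t l k).
Proof.
have z := bigO_cst T delta (norm_le M) true (2 * alpha).
case: (unliftP ord0 l) => [i|] ->; last first.
  by apply: eq_bigO z _ => X s u t *; rewrite /weighted2 /space2 unlift_none mulr0.
case: (unliftP ord0 k) => [j|] ->; last first.
  by apply: eq_bigO z _ => X s u t *; rewrite /weighted2 /space2 unlift_none liftK mulr0.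
exists M => // X XM s u t su ut tT ts; have st := le_trans su ut.
rewrite /weighted2 /space2 !liftK normrM ger0_norm ?decay_ge0//.
apply: le_trans (ler_wpM2l (decay_ge0 _ _ _) (second_le i j XM st tT ts a0 M_ge0)) _.
rewrite mulrA mulrCA; apply: ler_wpM2r; first exact: powR_ge0.
apply: ler_wpM2l => //; apply: weight_le => //.
have := delta_space i; have := delta_space j; move: delta_gt0; lra.
Qed.

Lemma weight_shift_order c : 0 <= c ->
  bigO false 1 (fun _ s u _ => expR (- (c * (u - s))) - 1).
Proof.
move=> c0; exists c => // X _ s u t su ut tT ts; rewrite mulr1 powRr1; last by lra.
have h0 : 0 <= c * (u - s) by rewrite mulr_ge0// subr_ge0.
have := expR_ge1Dx (- (c * (u - s))) => h.
have h1 : expR (- (c * (u - s))) <= 1 by rewrite -expR0 ler_expR oppr_le0.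
rewrite ler0_norm ?subr_le0//.
apply: (@le_trans _ _ (c * (u - s))); first lra.
by apply: ler_wpM2l => //; lra.
Qed.

Lemma decay_shift c s u : decay c T s = expR (- (c * (u - s))) * decay c T u.
Proof. by rewrite /decay -expRD; congr expR; ring. Qed.

Let bigO1 b a (f g : C -> R -> R -> R -> R) : 0 <= a -> theta <= 1 + a ->
  bigO b 1 f -> bigO true a g ->
  bigO true theta (fun x s u t => f x s u t * g x s u t).
Proof.
move=> a_ge0 ta hf hg.
have := bigOM delta_gt0 ler01 a_ge0 hf hg; rewrite orbT => h.
exact: (@bigO_le _ _ _ delta_gt0 _ _ true true (1 + a)) h.
Qed.

Lemma weighted1_chen k : bigO true theta
  (fun X s u t => weighted1 X s t k - weighted1 X s u k - weighted1 X u t k).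
Proof.
have h := bigO1 (ltW a0) _ (weight_shift_order (ltW (lam_gt0 k)))
  (bigO_right (ltW a0) (weighted1_order k)).
apply: eq_bigO (h _) _; first by move: alpha_le; lra.
move=> X s u t _ su ut tT ts.
have add1 : time_aug1 X.1 s t [:: k] = time_aug1 X.1 s u [:: k] + time_aug1 X.1 u t [:: k].
  rewrite /time_aug1; case: unliftP => [i _|_]; [exact: increment_additive|ring].
by rewrite /weighted1 add1 (decay_shift _ s u); ring.
Qed.

Let time_product l k : l = ord0 \/ k = ord0 -> bigO true theta
  (fun X s u t => weighted1 X s u l * weighted1 X u t k).
Proof.
have ta : theta <= 1 + alpha by move: alpha_le; lra.
case=> ->.
  apply: (bigO1 (ltW a0) ta (b := true)).
    exact: (bigO_left delta_gt0 ler01 weighted1_time_order).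
  exact: (bigO_right (ltW a0) (weighted1_order k)).
have := bigO1 (ltW a0) ta (bigO_right ler01 weighted1_time_order)
  (bigO_left delta_gt0 (ltW a0) (weighted1_order l)).
by move=> h; apply: eq_bigO h _ => X s u t *; rewrite mulrC.
Qed.

(** Chen's relation is exact before weighting; moving the base point of a weight
    from [s] to [u] is an error of order 1, and a product of two increments one of
    which is a time increment has the order [1 + alpha]. *)
Lemma weighted2_chen l k : bigO true theta (fun X s u t =>
  weighted2 X s t l k - weighted2 X s u l k - weighted2 X u t l k -
  weighted1 X s u l * weighted1 X u t k).
Proof.
case: (unliftP ord0 l) => [i lE|lE]; last first.
  apply: eq_bigO (bigON (time_product (l := l) (k := k) (or_introl lE))) _ => X s u t *.
  by rewrite /weighted2 /space2 lE unlift_none !mulr0 !subr0 sub0r.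
case: (unliftP ord0 k) => [j kE|kE]; last first.
  apply: eq_bigO (bigON (time_product (l := l) (k := k) (or_intror kE))) _ => X s u t *.
  by rewrite /weighted2 /space2 lE kE unlift_none liftK !mulr0 !subr0 sub0r.
have a20 : 0 <= 2 * alpha by rewrite mulr_ge0// ltW.
have ta : theta <= 1 + 2 * alpha by move: alpha_le; lra.
have h1 := bigO1 a20 ta (weight_shift_order (addr_ge0 (ltW (lam_gt0 l)) (ltW (lam_gt0 k))))
  (bigO_right a20 (weighted2_order l k)).
have h2 : bigO true (2 * alpha) (fun X s u t => weighted1 X s u l * weighted1 X u t k).
  have -> : 2 * alpha = alpha + alpha by ring.
  apply: (@bigOM _ _ _ delta_gt0 _ _ true true); rewrite ?(ltW a0)//.
    exact: (bigO_left delta_gt0 (ltW a0) (weighted1_order l)).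
  exact: (bigO_right (ltW a0) (weighted1_order k)).
have h3 := bigO1 a20 ta (weight_shift_order (ltW (lam_gt0 k))) h2.
apply: eq_bigO (bigOD h1 h3) _ => X s u t _ su ut tT ts.
rewrite /weighted2 /space2 /weighted1 /time_aug1 lE kE !liftK (second_chen X i j su ut tT).
have decayD a b v : decay (a + b) T v = decay a T v * decay b T v.
  by rewrite /decay -expRD; congr expR; ring.
have -> : expR (- ((lam 0 (lift ord0 i) + lam 0 (lift ord0 j)) * (u - s))) =
  expR (- (lam 0 (lift ord0 i) * (u - s))) * expR (- (lam 0 (lift ord0 j) * (u - s))).
  by rewrite -expRD; congr expR; ring.
rewrite !decayD (decay_shift _ s u) (decay_shift (lam 0 (lift ord0 j)) s u); ring.
Qed.

Lemma weighted_almost_rough :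
  almost_rough T alpha delta (norm_le M) weighted1 weighted2.
Proof.
split; [exact: weighted1_order|exact: weighted2_order|exact: weighted1_chen|exact: weighted2_chen].
Qed.

Lemma weighted_geometric i j : bigO true theta (fun X s _ t =>
  weighted1 X s t i * weighted1 X s t j - (weighted2 X s t i j + weighted2 X s t j i)).
Proof.
have ta : theta <= 1 + alpha by move: alpha_le; lra.
case: (unliftP ord0 i) => [i' iE|iE]; last first.
  apply: eq_bigO (bigO1 (ltW a0) ta weighted1_time_order (weighted1_order j)) _.
  move=> X s u t *; rewrite /weighted2 /space2 iE unlift_none.
  by case: unliftP => *; rewrite !mulr0 addr0 subr0.
case: (unliftP ord0 j) => [j' jE|jE]; last first.
  apply: eq_bigO (bigO1 (ltW a0) ta weighted1_time_order (weighted1_order i)) _.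
  move=> X s u t *; rewrite /weighted2 /space2 iE jE unlift_none liftK.
  by rewrite !mulr0 addr0 subr0 mulrC.
apply: eq_bigO (bigO_cst _ _ _ _ _) _ => X s u t _ su ut tT ts.
rewrite /weighted2 /space2 /weighted1 /time_aug1 iE jE !liftK.
have decayD a b v : decay (a + b) T v = decay a T v * decay b T v.
  by rewrite /decay -expRD; congr expR; ring.
have := second_sym X i' j' (le_trans su ut) tT; rewrite !decayD => h.
apply/eqP; rewrite subr_eq0; apply/eqP; rewrite mulrACA h; ring.
Qed.

End weighted_levels.

Arguments weighted1 {R d T alpha} lam {rho} X s t k.
Arguments weighted2 {R d T alpha} lam {rho} X s t l k.
Arguments norm_le {R d T alpha rho} M.

(** * Bounds on limits of Riemann sums *)
Section young_bounds.
Context {R : realType}.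
Implicit Types (Xi : R -> R -> R) (s t : R).

Lemma fine_path_length s t p : itv_partition s t p -> fine_path (t - s + 1) s p.
Proof.
suff H eta : t - s < eta -> itv_partition s t p -> fine_path eta s p by apply: H; lra.
elim: p s => //= x p ih s ts sp; have xp := itv_partition_cons sp.
have sx : s < x by case: sp => /= /andP[].
have xt := itv_partition_le xp; rewrite /fine_path/= -/(fine_path _ _ _) ih//; lra.
Qed.

(** No convergence is assumed: without a limit, [lim] is 0. *)
Lemma mesh_lim_bound Xi s t B : s <= t -> 0 <= B ->
  (forall p, itv_partition s t p -> `|rsum Xi s p| <= B) -> `|mesh_lim Xi s t| <= B.
Proof.
move=> st B0 H; have PF := mesh_filter_proper st.
have [cv|dv] := pselect (cvg (riemann_sum Xi s t @ mesh_filter s t)); last first.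
  by rewrite /mesh_lim dvgP// normr0.
apply/ler_addgt0Pr => e e0.
have /cvgrPdist_le/(_ _ e0) [eta /= eta0 he] := cv.
have [p [sp fp]] := exists_fine_partition eta0 st.
have h : `|mesh_lim Xi s t - riemann_sum Xi s t p| <= e.
  by apply: he; split; rewrite ?mesh_ltP.
rewrite riemann_sumE in h.
rewrite -[X in `|X|](subrK (rsum Xi s p)) (le_trans (ler_normD _ _))// addrC lerD//.
exact: H.
Qed.

Lemma rsum_bound_left Xi s t B : 0 <= B ->
  (forall u v, s <= u -> u < v -> v <= t -> `|Xi u v| <= B * (v - u)) ->
  forall p, itv_partition s t p -> `|rsum Xi s p| <= B * (t - s).
Proof.
move=> B0 H p sp.
have := @rsum_dist _ Xi (fun _ _ => 0) B _ s t p sp (fine_path_length sp).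
have -> : rsum (fun _ _ => 0 : R) s p = 0.
  by elim: (p) (s) => //= x q ih y; rewrite ih addr0.
by rewrite subr0; apply => u v *; rewrite subr0; exact: H.
Qed.

Lemma eq_rsum Xi Xi' s t p : itv_partition s t p ->
  (forall u v, s <= u -> u < v -> v <= t -> Xi u v = Xi' u v) ->
  rsum Xi s p = rsum Xi' s p.
Proof.
move=> sp H; apply/subr0_eq/eqP; rewrite -normr_le0 -(mul0r (t - s)).
apply: (rsum_dist sp (fine_path_length sp)) => u v su uv vt _.
by rewrite H// subrr normr0 mul0r.
Qed.

(** By parts: [(u - s) * (Y v - Y u)] is an increment of [(u - s) * Y u] minus
    [(v - u) * Y v]. *)
Lemma rsum_bound_right (Y : R -> R) s t B : 0 <= B -> s <= t ->
  (forall u, s <= u -> u <= t -> `|Y u| <= B) ->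
  forall p, itv_partition s t p ->
  `|rsum (fun u v => (u - s) * (Y v - Y u)) s p| <= (2 * B) * (t - s).
Proof.
move=> B0 st H p sp.
pose F u := (u - s) * Y u.
have h : `|rsum (fun u v => (u - s) * (Y v - Y u)) s p -
    rsum (fun u v => F v - F u) s p| <= B * (t - s).
  apply: (rsum_dist sp (fine_path_length sp)) => u v su uv vt _.
  have -> : (u - s) * (Y v - Y u) - (F v - F u) = - (Y v * (v - u)) by rewrite /F; ring.
  rewrite normrN normrM (@gtr0_norm _ (v - u)) ?subr_gt0//.
  apply: ler_wpM2r; [lra|apply: H => //; lra].
move: h; rewrite rsum_telescope; have [_ /eqP ->] := sp => h.
have hF : `|F t - F s| <= B * (t - s).
  rewrite /F subrr mul0r subr0 normrM ger0_norm ?subr_ge0// mulrC.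
  by apply: ler_wpM2r; [rewrite subr_ge0|exact: H].
rewrite -[X in `|X|](subrK (F t - F s)) (le_trans (ler_normD _ _))//; lra.
Qed.

End young_bounds.

(** * The fading-memory signature as an iterated integral *)
Section efm_levels.
Context {R : realType} {d : nat} (T alpha : R) (lam : 'rV[R]_d.+1) (rho : 'rV[R]_d).
Local Notation C := (geo_rough_path T alpha rho).
Context (X : C).
Context (alpha_gt : 1 / 3 < alpha) (alpha_le : alpha <= 1 / 2).
Context (M : R) (M_ge0 : 0 <= M) (XM : norm_le M X).
Local Notation theta := (3 * alpha).

Let a0 : 0 < alpha. Proof. by move: alpha_gt; lra. Qed.

(** One of the two factors in the Riemann sums is the increment of time, which is of
    order 1; if it is the integrand, a summation by parts makes it the integrator. *)
Lemma young_int_order (k l : 'I_d.+1) (a : R) : k = ord0 \/ l = ord0 ->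
  exists2 B, 0 <= B & forall s t, a <= s -> s <= t -> t <= T -> t - s < 1 ->
    `|young_int (time_aug1 X.1) k l s t| <= B * (t - s) `^ theta.
Proof.
move=> kl.
pose B0 := \sum_i M * expR (`|rho 0 i| * (T - a)) + 1.
have B00 : 0 <= B0.
  by rewrite addr_ge0// sumr_ge0// => i _; rewrite mulr_ge0 ?expR_ge0.
exists (2 * B0); first by rewrite mulr_ge0.
move=> s t as_ st tT ts.
have h0 : 0 <= t - s by rewrite subr_ge0.
have incr i u : s <= u -> u <= t -> `|X.1 s u [:: i]| <= B0 * (t - s) `^ alpha.
  move=> su ut; have us : u - s < 1 by lra.
  apply: (le_trans (increment_le i XM su (le_trans ut tT) us a0 M_ge0)).
  apply: ler_pM; rewrite ?powR_ge0 ?mulr_ge0 ?expR_ge0//; last first.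
    by apply: ler_powR_base; [exact: ltW|lra|lra].
  rewrite /B0 (bigD1 i)//= -addrA ler_wpDr//.
    by rewrite addr_ge0// sumr_ge0// => j _; rewrite mulr_ge0 ?expR_ge0.
  apply: ler_wpM2l => //; rewrite ler_expR.
  apply: (@le_trans _ _ (`|rho 0 i| * (T - s))).
    by apply: ler_wpM2r; [lra|exact: ler_norm].
  by apply: ler_wpM2l => //; lra.
have B01 : 1 <= B0.
  by rewrite /B0 lerDr sumr_ge0// => i _; rewrite mulr_ge0 ?expR_ge0.
have hpow : (t - s) `^ alpha * (t - s) <= (t - s) `^ theta.
  have -> : (t - s) `^ alpha * (t - s) = (t - s) `^ (alpha + 1).
    by rewrite -{2}(powRr1 h0) powR_add_exp// ltW.
  apply: powR_le_powR => //; [by move: a0; lra| |exact: ltW].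
  by move: alpha_le; lra.
have fin B : 0 <= B -> B <= 2 * (B0 * (t - s) `^ alpha) ->
    B * (t - s) <= 2 * B0 * (t - s) `^ theta.
  move=> _ hB; apply: (@le_trans _ _ (2 * (B0 * (t - s) `^ alpha) * (t - s))).
    exact: ler_wpM2r.
  have -> : 2 * (B0 * (t - s) `^ alpha) * (t - s) =
    2 * B0 * ((t - s) `^ alpha * (t - s)) by ring.
  by apply: ler_wpM2l => //; exact: mulr_ge0.
have Bp : 0 <= B0 * (t - s) `^ alpha by rewrite mulr_ge0 ?powR_ge0.
have hleft (f : R -> R) B : 0 <= B -> B <= 2 * (B0 * (t - s) `^ alpha) ->
    (forall u, s <= u -> u <= t -> `|f u| <= B) ->
    `|mesh_lim (fun u v => f u * (v - u)) s t| <= 2 * B0 * (t - s) `^ theta.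
  move=> hB0 hB hf; apply: (le_trans _ (fin _ hB0 hB)).
  apply: mesh_lim_bound => //; first exact: mulr_ge0.
  apply: rsum_bound_left => // u v su uv vt.
  rewrite normrM (@gtr0_norm _ (v - u)) ?subr_gt0//.
  by apply: ler_wpM2r; [rewrite subr_ge0 ltW|apply: hf; lra].
have pow1 : t - s <= (t - s) `^ alpha.
   rewrite -{1}(powRr1 h0); apply: powR_le_powR => //; [exact: ltW| |exact: ltW].
  by move: alpha_le; lra.
rewrite /young_int /time_aug1.
case: (unliftP ord0 l) => [j lE|_].
  have -> : k = ord0 by case: kl lE => [//|->] /eqP; rewrite (negbTE (neq_lift _ _)).
  rewrite unlift_none.
  pose Y u := X.1 s u [:: j].
  apply: (le_trans _ (fin (2 * (B0 * (t - s) `^ alpha)) (mulr_ge0 (ler0n _ 2) Bp) (lexx _))).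
  apply: mesh_lim_bound => //; first by rewrite mulr_ge0// mulr_ge0.
  move=> p sp; have := rsum_bound_right (Y := Y) Bp st (incr j) sp.
  rewrite (eq_rsum sp (Xi' := fun u v => (u - s) * (Y v - Y u)))// => u v su uv vt.
  by rewrite /Y (increment_additive X [:: j] su (ltW uv) (le_trans vt tT)); ring.
case: (unliftP ord0 k) => [i kE|_].
  by apply: (hleft (fun u => X.1 s u [:: i]) _ Bp _ (incr i)); lra.
apply: (hleft (fun u => u - s) ((t - s) `^ alpha)) => [| |u su ut].
- exact: powR_ge0.
- have : 1 * (t - s) `^ alpha <= B0 * (t - s) `^ alpha.
    by apply: ler_wpM2r => //; exact: powR_ge0.
  by have := powR_ge0 (t - s) alpha; lra.
- by rewrite ger0_norm ?subr_ge0//; apply: le_trans pow1; lra.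
Qed.

Lemma time_aug2_order (l k : 'I_d.+1) (a : R) :
  exists2 B, 0 <= B & forall s t, a <= s -> s <= t -> t <= T -> t - s < 1 ->
    `|time_aug2 X s t [:: l; k] - space2 X s t l k| <= B * (t - s) `^ theta.
Proof.
rewrite /time_aug2 /space2.
case: (unliftP ord0 l) => [i _|lE]; last first.
  have [B B0 H] := @young_int_order l k a (or_introl lE).
  by exists B => // s t *; rewrite subr0; exact: H.
case: (unliftP ord0 k) => [j _|kE]; last first.
  have [B B0 H] := @young_int_order l k a (or_intror kE).
  by exists B => // s t *; rewrite subr0; exact: H.
by exists 0 => // s t *; rewrite subrr normr0 mul0r.
Qed.

Context (delta : R) (delta_gt0 : 0 < delta).
Hypothesis lam_gt0 : forall k, 0 < lam 0 k.
Hypothesis delta_clock : delta <= lam 0 ord0.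
Hypothesis delta_space : forall i : 'I_d, delta <= lam 0 (lift ord0 i) - rho 0 i.

Local Notation E := (iter_sig (weighted1 lam X) (weighted2 lam X)).
Local Notation Xi := (germ E (weighted1 lam X) (weighted2 lam X)).

Let theta_gt1 : 1 < theta. Proof. by move: alpha_gt; lra. Qed.

Let HA : almost_rough T alpha delta (norm_le M : set C)
  (weighted1 lam (rho := rho)) (weighted2 lam (rho := rho)).
Proof. exact: weighted_almost_rough. Qed.

Lemma tmul_homogeneousr m n (a b : tensor R m) u v : homogeneous n b -> size v = n ->
  tmul a b (u ++ v) = a u * b v.
Proof.
move=> hb vn; have us : (size u < (size (u ++ v)).+1)%N by rewrite size_cat ltnS leq_addr.
rewrite /tmul (bigD1 (Ordinal us))//= take_size_cat// drop_size_cat// big1 ?addr0//.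
move=> i iu; rewrite hb ?mulr0// size_drop.
apply: contra iu => /eqP h; apply/eqP/val_inj => /=.
have ile : (i <= size u + size v)%N by rewrite -size_cat -ltnS ltn_ord.
have h' : (size u + size v - i)%N = n by rewrite -size_cat.
by have /eqP := subnKC ile; rewrite h' vn eqn_add2r => /eqP.
Qed.

Lemma time_aug1_homogeneous u v : homogeneous 1 (time_aug1 X.1 u v).
Proof. by move=> [|k [|l w]]. Qed.

Lemma time_aug2_homogeneous u v : homogeneous 2 (time_aug2 X u v).
Proof. by move=> [|k [|l [|j w]]]. Qed.

Lemma word_weight_rcons m (mu : 'rV[R]_m) w k :
  word_weight mu (rcons w k) = word_weight mu w + mu 0 k.
Proof. by rewrite /word_weight -cats1 big_cat/= big_seq1. Qed.

Let step (t a : R) (w : seq 'I_d.+1) (Xi' : R -> R -> R) (c : R) :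
  0 < c -> a <= t -> t <= T ->
  (exists2 B, 0 <= B & forall s u, a <= s -> s <= u -> u <= t -> u - s < 1 ->
    `|Xi' s u - c * Xi w s u| <= B * (u - s) `^ theta) ->
  mesh_lim Xi' a t = c * E w t - c * E w a.
Proof.
move=> c0 at_ tT [B B0 H].
have [K K0 hK] := sig_expansion alpha_gt delta_gt0 HA w.
apply: (@mesh_lim_primitive _ _ theta_gt1 (fun t => c * E w t) Xi' (c * K + B)) => //.
  by rewrite addr_ge0// mulr_ge0// ltW.
move=> s u as_ su ut us.
have -> : c * E w u - c * E w s - Xi' s u =
  c * (E w u - E w s - Xi w s u) - (Xi' s u - c * Xi w s u) by ring.
rewrite mulrDl (le_trans (ler_normB _ _))// lerD ?H//.
rewrite normrM gtr0_norm// -mulrA; apply: ler_wpM2l; first exact: ltW.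
have := hK X XM s s u (lexx s) su (le_trans ut tT) us.
move=> /le_trans; apply; apply: ler_wpM2r; first exact: powR_ge0.
by apply: ler_piMr => //; apply: decay_le1 => //; exact: le_trans tT.
Qed.

Let limit (t : R) (w : seq 'I_d.+1) (c : R) (f : R -> R) : t <= T -> w != [::] ->
  (forall a, a <= t -> f a = c * E w t - c * E w a) -> lim (f @ -oo) = c * E w t.
Proof.
move=> tT w0 H; apply: cvg_lim => //; apply/cvgrPdist_le => e e0.
have [K K0 hK] := sig_decay alpha_gt delta_gt0 HA w0.
have K1 : 0 <= `|c| * K by rewrite mulr_ge0.
have [b0 b0T hb] := decay_small T delta_gt0 K1 e0.
near=> a.
have at_ : a <= t by near: a; apply: nbhs_ninfty_le; exact: num_real.
have ab : a <= b0 by near: a; apply: nbhs_ninfty_le; exact: num_real.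
rewrite H// opprB addrCA subrr addr0 normrM.
apply: le_trans (hb a ab); rewrite -mulrA; apply: ler_wpM2l => //.
exact: hK X a XM (le_trans at_ tT).
Unshelve. all: by end_near. Qed.

Let efm_level1 t w : efm_level lam (time_aug X) 1 t w =
  lim ((fun a => mesh_lim (fun u v => dilate lam (t - u) (fun w' =>
    tmul (fun w => (w == [::])%:R) (time_aug1 X.1 u v) w' +
    tmul (fun=> 0) (time_aug2 X u v) w') w) a t) @ -oo).
Proof. by []. Qed.

Let efm_level2 n t w : efm_level lam (time_aug X) n.+2 t w =
  lim ((fun a => mesh_lim (fun u v => dilate lam (t - u) (fun w' =>
    tmul (efm_level lam (time_aug X) n.+1 u) (time_aug1 X.1 u v) w' +
    tmul (efm_level lam (time_aug X) n u) (time_aug2 X u v) w') w) a t) @ -oo).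
Proof. by []. Qed.

(** By induction on the length, the Riemann sums that define a level have, up to the
    constant [expR (word_weight lam w * (T - t))], the germ of [E (rev w)] as summand,
    apart from the entries of the second level that involve time, which are of order
    [3 * alpha]. *)
Lemma efm_levelE n w t : size w = n -> t <= T ->
  efm_level lam (time_aug X) n t w = expR (word_weight lam w * (T - t)) * E (rev w) t.
Proof.
have [N] := ubnP n; elim: N => // N ih in n w t *.
case: n => [|[|n]]; rewrite ?ltnS => nN.
- move=> /size0nil -> tT.
  by rewrite /= /word_weight big_nil mul0r expR0 mul1r.
- case/lastP: w => [//|w k]; rewrite size_rcons => -[/size0nil ->] tT.
  rewrite efm_level1; apply: limit => // a at_; apply: step => //; first exact: expR_gt0.
  exists 0 => // s u as_ su ut us; rewrite mul0r normr_le0 subr_eq0; apply/eqP.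
  rewrite /dilate (_ : rcons _ _ = [::] ++ [:: k])//.
  rewrite (tmul_homogeneousr _ _ (@time_aug1_homogeneous _ _))//.
  rewrite [X in _ * (_ + X)](_ : _ = 0); last by rewrite /tmul big1// => i _; rewrite mul0r.
  have wt : expR (- (word_weight lam [:: k] * (t - s))) =
      expR (word_weight lam [:: k] * (T - t)) * decay (lam 0 k) T s.
    by rewrite /decay -expRD word_weight1; congr expR; ring.
  rewrite [[::] ++ [:: k]]/= (_ : Xi (rev [:: k]) s u = weighted1 lam X s u k).
    by rewrite wt mul1r addr0 /weighted1 mulrA.
  by rewrite (_ : rev [:: k] = [:: k])// /germ (_ : E [::] s = 1)// mul1r addr0.
case/lastP: w => [//|w k]; rewrite size_rcons => -[+] tT.
case/lastP: w => [//|w l]; rewrite size_rcons => -[wn].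
rewrite efm_level2 rev_rcons.
have : forall s, s <= T -> efm_level lam (time_aug X) n.+1 s (rcons w l) =
    expR (word_weight lam (rcons w l) * (T - s)) * E (rev (rcons w l)) s.
  by move=> s sT; apply: ih => //; rewrite size_rcons wn.
have : forall s, s <= T -> efm_level lam (time_aug X) n s w =
    expR (word_weight lam w * (T - s)) * E (rev w) s.
  by move=> s sT; apply: ih => //; exact: ltnW.
move: (efm_level lam (time_aug X) n) (efm_level lam (time_aug X) n.+1) => L0 L1 ih2 ih1.
apply: limit => // a at_; apply: step => //; first exact: expR_gt0.
have [B B0 HB] := time_aug2_order l k a.
have [K K0 hK] := sig_bounds alpha_gt delta_gt0 HA (rev w).
pose c := expR (word_weight lam (rcons (rcons w l) k) * (T - t)).
have c0 : 0 < c by exact: expR_gt0.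
exists (c * (K * B)); first by apply: mulr_ge0; [exact: ltW|exact: mulr_ge0].
move=> s u as_ su ut us; have sT : s <= T by rewrite (le_trans su)// (le_trans ut).
have e1 b : tmul b (time_aug1 X.1 s u) (rcons (rcons w l) k) =
    b (rcons w l) * time_aug1 X.1 s u [:: k].
  by rewrite -cats1 (tmul_homogeneousr _ _ (@time_aug1_homogeneous _ _)).
have e2 b : tmul b (time_aug2 X s u) (rcons (rcons w l) k) =
    b w * time_aug2 X s u [:: l; k].
  by rewrite -!cats1 -catA (tmul_homogeneousr _ _ (@time_aug2_homogeneous _ _)).
rewrite -/c /dilate e1 e2 ih1// ih2//.
have w1 : expR (- (word_weight lam (rcons (rcons w l) k) * (t - s))) *
    expR (word_weight lam (rcons w l) * (T - s)) = c * decay (lam 0 k) T s.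
  by rewrite /c /decay -!expRD !word_weight_rcons; congr expR; ring.
have w2 : expR (- (word_weight lam (rcons (rcons w l) k) * (t - s))) *
    expR (word_weight lam w * (T - s)) = c * decay (lam 0 l + lam 0 k) T s.
  by rewrite /c /decay -!expRD !word_weight_rcons; congr expR; ring.
have -> : Xi (k :: rev (rcons w l)) s u =
    E (rev (rcons w l)) s * (decay (lam 0 k) T s * time_aug1 X.1 s u [:: k]) +
    E (rev w) s * (decay (lam 0 l + lam 0 k) T s * space2 X s u l k).
  by rewrite rev_rcons.
rewrite [X in `|X|](_ : _ = c * (E (rev w) s * (decay (lam 0 l + lam 0 k) T s *
  (time_aug2 X s u [:: l; k] - space2 X s u l k)))); last first.
  by rewrite mulrDr !mulrA w1 w2; ring.
rewrite normrM gtr0_norm// -!mulrA; apply: ler_wpM2l; first exact: ltW.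
rewrite normrM; apply: ler_pM => //; first exact: hK.
rewrite normrM ger0_norm ?decay_ge0//.
apply: (@le_trans _ _ (1 * (B * (u - s) `^ theta))); last by rewrite mul1r.
apply: ler_pM => //; [exact: decay_ge0| |apply: HB => //; exact: le_trans tT].
by apply: decay_le1 => //; rewrite addr_gt0.
Qed.

End efm_levels.

(** * Continuity of the signature in the rough path *)
Section continuity_by_uniform_approximation.
Context {R : realType} {C : topologicalType}.

Lemma continuous_of_approx (f : C -> R) (x0 : C) :
  (forall e, 0 < e -> exists g : C -> R, {for x0, continuous g} /\
    \forall y \near x0, `|f y - g y| <= e) -> {for x0, continuous f}.
Proof.
move=> H; apply/cvgrPdist_le => e e0; have e30 : 0 < e / 3 by lra.
have [g [/cvgrPdist_le/(_ _ e30) cg fg]] := H _ e30.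
have fg0 := nbhs_singleton fg.
near=> y.
have -> : f x0 - f y = (f x0 - g x0) + (g x0 - g y) - (f y - g y) by ring.
rewrite (le_trans (ler_normB _ _))// (le_trans (lerD (ler_normD _ _) (lexx _)))//.
have h1 : `|g x0 - g y| <= e / 3 by near: y.
have h2 : `|f y - g y| <= e / 3 by near: y.
lra.
Unshelve. all: by end_near. Qed.

End continuity_by_uniform_approximation.

Section metric_space_continuity.
Context {R : realType} {C : metricType R}.
Implicit Types X Y : C.

Lemma near_mdist X (r : R) : 0 < r -> \forall Y \near X, mdist X Y < r.
Proof. by move=> r0; have := nbhsx_ballx X _ r0; rewrite ballEmdist. Qed.

Lemma lipschitz_continuous (f : C -> R) X (k : R) :
  (forall Y, `|f X - f Y| <= k * mdist X Y) -> {for X, continuous f}.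
Proof.
move=> H; apply/cvgrPdist_le => e e0.
near=> Y.
have XY : mdist X Y < e / (`|k| + 1).
  by near: Y; apply: near_mdist; rewrite divr_gt0// ltr_wpDl.
apply: (le_trans (H Y)); apply: (@le_trans _ _ (`|k| * mdist X Y)).
  by apply: ler_wpM2r; [exact: mdist_ge0|exact: ler_norm].
by apply: ler_mul_small => //; exact: ltW.
Unshelve. all: by end_near. Qed.

End metric_space_continuity.

Section continuity.
Context {R : realType} {d : nat} (T alpha : R) (lam : 'rV[R]_d.+1) (rho : 'rV[R]_d).
Local Notation C := (geo_rough_path T alpha rho).
Implicit Types X Y : C.
Context (alpha_gt : 1 / 3 < alpha) (alpha_le : alpha <= 1 / 2).

Lemma weighted_norms_le_dist X Y :
  (weighted_norm T alpha rho 1 (rp_sub X.1 Y.1) <= (mdist X Y)%:E)%E /\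
  (weighted_norm T (2 * alpha) rho 2 (rp_sub X.2 Y.2) <= (mdist X Y)%:E)%E.
Proof.
have [_ _ _ [X1 X2] _] := grp_rough X; have [_ _ _ [Y1 Y2] _] := grp_rough Y.
have f1 : weighted_norm T alpha rho 1 (rp_sub X.1 Y.1) \is a fin_num.
  by rewrite ge0_fin_numE ?weighted_norm_ge0 ?weighted_norm_sub_lty.
have f2 : weighted_norm T (2 * alpha) rho 2 (rp_sub X.2 Y.2) \is a fin_num.
  by rewrite ge0_fin_numE ?weighted_norm_ge0 ?weighted_norm_sub_lty.
have -> : (mdist X Y)%:E = (weighted_norm T alpha rho 1 (rp_sub X.1 Y.1) +
    weighted_norm T (2 * alpha) rho 2 (rp_sub X.2 Y.2))%E.
  by rewrite -[RHS]fineK ?fin_numD ?f1 ?f2.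
by rewrite leeDl ?leeDr ?weighted_norm_ge0.
Qed.

Lemma norm_le_exists X : exists2 M : R, 0 <= M & norm_le M X.
Proof.
have [_ _ _ [X1 X2] _] := grp_rough X.
have f1 : weighted_norm T alpha rho 1 X.1 \is a fin_num.
  by rewrite ge0_fin_numE ?weighted_norm_ge0.
have f2 : weighted_norm T (2 * alpha) rho 2 X.2 \is a fin_num.
  by rewrite ge0_fin_numE ?weighted_norm_ge0.
pose M1 := fine (weighted_norm T alpha rho 1 X.1).
pose M2 := fine (weighted_norm T (2 * alpha) rho 2 X.2).
have M10 : 0 <= M1 by rewrite fine_ge0 ?weighted_norm_ge0.
have M20 : 0 <= M2 by rewrite fine_ge0 ?weighted_norm_ge0.
exists (M1 + M2); first exact: addr_ge0.
by split; rewrite -[leLHS]fineK// lee_fin ?lerDl ?lerDr.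
Qed.

Lemma norm_le_near X M : norm_le M X -> \forall Y \near X, norm_le (M + 1) Y.
Proof.
move=> [X1 X2]; apply: filterS (near_mdist X ltr01) => Y XY.
have [d1 d2] := weighted_norms_le_dist X Y.
pose Z : two_param R d := fun _ _ _ => 0.
have subZ (A : two_param R d) : rp_sub A Z = A.
  by apply/funext => s; apply/funext => t; apply/funext => w; rewrite /rp_sub subr0.
have tri n a (A A' : two_param R d) : (weighted_norm T a rho n A' <= M%:E)%E ->
    (weighted_norm T a rho n (rp_sub A' A) <= (mdist X Y)%:E)%E ->
    (weighted_norm T a rho n A <= (M + 1)%:E)%E.
  move=> h1 h2; rewrite -(subZ A); apply: le_trans (weighted_norm_triangle _ _ _ A A' Z) _.
  rewrite weighted_norm_sym subZ addeC EFinD; apply: leeD => //.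
  by apply: (le_trans h2); rewrite lee_fin ltW.
by split; [apply: tri X1 d1|apply: tri X2 d2].
Qed.

Lemma increment_continuous s t i X : s <= t -> t <= T -> t - s < 1 ->
  {for X, continuous (fun Y : C => Y.1 s t [:: i])}.
Proof.
rewrite le_eqVlt => /predU1P[<- sT _|st tT ts].
  apply: (lipschitz_continuous (k := 0)) => Y.
  by rewrite !increment_refl// subrr normr0 mul0r.
apply: (lipschitz_continuous (k :=
   expR (word_weight rho [:: i] * (T - s)) * (t - s) `^ alpha)) => Y.
have [h _] := weighted_norms_le_dist X Y.
have := dilate_coord_le h (erefl : size [:: i] = 1%N) st tT ts.
by rewrite -mulrA mulrC.
Qed.

Lemma second_continuous s t i j X : s <= t -> t <= T -> t - s < 1 ->
  {for X, continuous (fun Y : C => Y.2 s t [:: i; j])}.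
Proof.
rewrite le_eqVlt => /predU1P[<- sT _|st tT ts].
  apply: (lipschitz_continuous (k := 0)) => Y.
  by rewrite !second_refl// subrr normr0 mul0r.
apply: (lipschitz_continuous (k :=
   expR (word_weight rho [:: i; j] * (T - s)) * (t - s) `^ (2 * alpha))) => Y.
have [_ h] := weighted_norms_le_dist X Y.
have := dilate_coord_le h (erefl : size [:: i; j] = 2%N) st tT ts.
by rewrite -mulrA mulrC.
Qed.

Lemma weighted1_continuous s t k X : s <= t -> t <= T -> t - s < 1 ->
  {for X, continuous (fun Y : C => weighted1 lam Y s t k)}.
Proof.
move=> st tT ts; apply: continuousM; first exact: cst_continuous.
rewrite /time_aug1; case: unliftP => [i _|_]; last exact: cst_continuous.
exact: increment_continuous.
Qed.

Lemma weighted2_continuous s t l k X : s <= t -> t <= T -> t - s < 1 ->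
  {for X, continuous (fun Y : C => weighted2 lam Y s t l k)}.
Proof.
move=> st tT ts; apply: continuousM; first exact: cst_continuous.
rewrite /space2; case: unliftP => [i _|_]; last exact: cst_continuous.
case: unliftP => [j _|_]; last exact: cst_continuous.
exact: second_continuous.
Qed.

Context (delta : R) (delta_gt0 : 0 < delta).
Hypothesis lam_gt0 : forall k, 0 < lam 0 k.
Hypothesis delta_clock : delta <= lam 0 ord0.
Hypothesis delta_space : forall i : 'I_d, delta <= lam 0 (lift ord0 i) - rho 0 i.

Local Notation theta := (3 * alpha).
Local Notation E X := (iter_sig (weighted1 lam X) (weighted2 lam X)).
Local Notation Xi X := (germ (E X) (weighted1 lam X) (weighted2 lam X)).

Let theta_gt1 : 1 < theta. Proof. by move: alpha_gt; lra. Qed.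

Lemma rsum_continuous (f : C -> R -> R -> R) X p s t :
  itv_partition s t p -> fine_path 1 s p -> t <= T ->
  (forall u v, u <= v -> v <= T -> v - u < 1 -> {for X, continuous (fun Y => f Y u v)}) ->
  {for X, continuous (fun Y => rsum (f Y) s p)}.
Proof.
elim: p s => [|x p ih] s sp fp tT H /=; first exact: cst_continuous.
have xp := itv_partition_cons sp; move: fp => /= /andP[xs fp].
have sx : s < x by case: sp => /= /andP[].
have xt := itv_partition_le xp.
have c1 : {for X, continuous (fun Y => f Y s x)}.
  by apply: H => //; [exact: ltW|exact: le_trans tT].
exact: (continuousD c1 (ih x xp fp tT H)).
Qed.

(** Near a given path, [E Y r t] is a uniform limit of Riemann sums: the expansion
    of [E Y r] and its decay at minus infinity hold with constants that are uniform on
    bounded sets.  Each Riemann sum is a polynomial in entries of the path and in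
    signatures of shorter words. *)
Lemma sig_continuous r t X : t <= T -> {for X, continuous (fun Y : C => E Y r t)}.
Proof.
have [n] := ubnP (size r); elim: n => // n ih in r t X *.
case: r => [_ tT|k r]; first exact: cst_continuous.
rewrite /= ltnS => rn tT; apply: continuous_of_approx => e e0.
have [M M0 XM] := norm_le_exists X.
have M10 : 0 <= M + 1 by rewrite addr_ge0.
have HA : almost_rough T alpha delta (norm_le (M + 1) : set C)
  (weighted1 lam (rho := rho)) (weighted2 lam (rho := rho)) by exact: weighted_almost_rough.
have [K K0 hK] := sig_decay alpha_gt delta_gt0 HA (isT : k :: r != [::]).
have [K' K'0 hK'] := sig_expansion alpha_gt delta_gt0 HA (k :: r).
have e20 : 0 < e / 2 by lra.
have [a0 a0T ha0] := decay_small T delta_gt0 K0 e20.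
pose a := Num.min a0 t; have at_ : a <= t by rewrite ge_min lexx orbT.
have aT : a <= T by rewrite ge_min a0T.
have K'1 : 0 <= K' * (t - a) by rewrite mulr_ge0// subr_ge0.
have [eta [eta0 eta1 heta]] := exists_small_powR theta_gt1 K'1 e20.
have [p [ap fp]] := exists_fine_partition eta0 at_.
exists (fun Y => rsum (Xi Y (k :: r)) a p); split.
  apply: (rsum_continuous ap _ tT).
    by apply: sub_path fp => x y /= /lt_trans; apply.
  move=> u v uv vT vu; have uT := le_trans uv vT.
  have c1 : {for X, continuous (fun Y => E Y r u * weighted1 lam Y u v k)}.
    by apply: continuousM; [exact: ih|exact: weighted1_continuous].
  have c2 : {for X, continuous (fun Y =>
      if r is l :: r' then E Y r' u * weighted2 lam Y u v l k else 0)}.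
    case: (r) rn => [_|l r' rn]; first exact: cst_continuous.
    by apply: continuousM; [apply: ih => //; exact: ltnW|exact: weighted2_continuous].
  exact: (continuousD c1 c2).
have := norm_le_near XM; apply: filterS => Y YM.
have h1 : `|E Y (k :: r) t - E Y (k :: r) a - rsum (Xi Y (k :: r)) a p| <= e / 2.
  apply: (@le_trans _ _ (K' * eta `^ (theta - 1) * (t - a))).
    apply: (rsum_primitive theta_gt1 K'0 eta0 (ltW eta1) _ ap fp) => s u as_ su ut us.
    have uT := le_trans ut tT.
    apply: (le_trans (hK' Y YM s s u (lexx s) su uT us)).
    apply: ler_wpM2r; first exact: powR_ge0.
    by apply: ler_piMr => //; exact: decay_le1.
  by rewrite mulrAC.
have h2 : `|E Y (k :: r) a| <= e / 2.
  apply: (le_trans (hK Y a YM aT)).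
  by apply: ha0; rewrite ge_min lexx.
rewrite -[X in `|X|](subrK (E Y (k :: r) a)) (le_trans (ler_normD _ _))//.
rewrite addrAC; lra.
Qed.

(** * The signature at the terminal time determines the rough path *)
Lemma additive_small_eq0 (G : R -> R -> R) (mu K : R) : 0 < mu -> 0 <= K ->
  (forall s u t, s <= u -> u <= t -> t <= T -> G s t = G s u + G u t) ->
  (forall s t, s <= t -> t <= T -> t - s < 1 ->
    `|decay mu T s * G s t| <= K * (t - s) `^ theta) ->
  forall s t, s <= t -> t <= T -> G s t = 0.
Proof.
move=> mu0 K0 Gadd Gle a t at_ tT.
have Gaa : G a a = 0 by have := Gadd a a a (lexx _) (lexx _) (le_trans at_ tT); lra.
have d0 : 0 < decay mu T a by exact: decay_gt0.
rewrite -Gaa; apply/esym.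
apply: (@small_increments_eq _ _ theta_gt1 (G a) (K / decay mu T a)) => //.
  by rewrite divr_ge0// ltW.
move=> s u as_ su ut us; have uT := le_trans ut tT.
rewrite (Gadd a s u)// addrAC subrr add0r mulrAC ler_pdivlMr//.
apply: le_trans (Gle s u su uT us).
rewrite normrM ger0_norm ?decay_ge0// mulrC; apply: ler_wpM2r => //.
exact: ler_decay.
Qed.

(** The signatures of [X] and [Y] agree at all times.  By the expansion of the word
    [i], the first levels agree up to the order [3 * alpha], hence, being additive,
    they agree.  Then so do the second levels, by the expansion of the word [i j]. *)
Lemma sig_injective X Y : (forall r, E X r T = E Y r T) -> X = Y.
Proof.
move=> XYT.
have [M1 M10 XM1] := norm_le_exists X; have [M2 M20 YM2] := norm_le_exists Y.
pose M := M1 + M2; have M0 : 0 <= M by exact: addr_ge0.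
have mono (m : R) (Z : C) : m <= M -> norm_le m Z -> norm_le M Z.
  by move=> mM [Z1 Z2]; split; [apply: (le_trans Z1)|apply: (le_trans Z2)]; rewrite lee_fin.
have XM : norm_le M X by apply: mono XM1; rewrite lerDl.
have YM : norm_le M Y by apply: mono YM2; rewrite lerDr.
have HA : almost_rough T alpha delta (norm_le M : set C)
  (weighted1 lam (rho := rho)) (weighted2 lam (rho := rho)) by exact: weighted_almost_rough.
have XYE r t : t <= T -> E X r t = E Y r t.
  apply: (sig_separates (o := ord0) alpha_gt alpha_le delta_gt0 HA _ (lam_gt0 ord0) delta_clock
    _ _ XM YM XYT).
  - by move=> i j; exact: weighted_geometric.
  - by move=> Z s u _ _ _; rewrite /weighted1 /time_aug1 unlift_none.
  - move=> Z s u l _ _ _; rewrite /weighted2 /space2 unlift_none.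
    by case: unlift => *; rewrite mulr0.
have germ_close r : exists2 K, 0 <= K & forall s t, s <= t -> t <= T -> t - s < 1 ->
    `|Xi X r s t - Xi Y r s t| <= K * (t - s) `^ theta.
  have [K K0 hK] := sig_expansion alpha_gt delta_gt0 HA r.
  exists (K + K) => [|s t st tT ts]; first exact: addr_ge0.
  have sT := le_trans st tT.
  have le (Z : C) : norm_le M Z -> `|E Z r t - E Z r s - Xi Z r s t| <= K * (t - s) `^ theta.
    move=> ZM; apply: (le_trans (hK Z ZM s s t (lexx s) st tT ts)).
    apply: ler_wpM2r; first exact: powR_ge0.
    by apply: ler_piMr => //; exact: decay_le1.
  have := le X XM; have := le Y YM; rewrite !XYE// => h1 h2.
  have -> : Xi X r s t - Xi Y r s t = (E Y r t - E Y r s - Xi Y r s t) -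
    (E Y r t - E Y r s - Xi X r s t) by ring.
  by rewrite (le_trans (ler_normB _ _))// mulrDl lerD.
have level1 i s t : s <= t -> t <= T -> X.1 s t [:: i] = Y.1 s t [:: i].
  move=> st tT; apply/subr0_eq.
  have [K K0 hK] := germ_close [:: lift ord0 i].
  apply: (additive_small_eq0 (G := fun s t => X.1 s t [:: i] - Y.1 s t [:: i])
    (lam_gt0 (lift ord0 i)) K0) => //.
    move=> a b c ab bc cT.
    by rewrite (increment_additive X _ ab bc cT) (increment_additive Y _ ab bc cT); ring.
  move=> a b ab bT ba; apply: le_trans (hK a b ab bT ba); rewrite le_eqVlt; apply/orP; left.
  apply/eqP; congr `|_|; rewrite /germ (_ : E X [::] a = 1)// (_ : E Y [::] a = 1)//.
  by rewrite /weighted1 /time_aug1 liftK; ring.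
have level2 i j s t : s <= t -> t <= T -> X.2 s t [:: i; j] = Y.2 s t [:: i; j].
  move=> st tT; apply/subr0_eq.
  have [K K0 hK] := germ_close [:: lift ord0 j; lift ord0 i].
  apply: (additive_small_eq0 (G := fun s t => X.2 s t [:: i; j] - Y.2 s t [:: i; j])
    (addr_gt0 (lam_gt0 (lift ord0 i)) (lam_gt0 (lift ord0 j))) K0) => //.
    move=> a b c ab bc cT.
    rewrite (second_chen X _ _ ab bc cT) (second_chen Y _ _ ab bc cT).
    by rewrite !level1//; [ring|exact: le_trans cT].
  move=> a b ab bT ba; apply: le_trans (hK a b ab bT ba); rewrite le_eqVlt; apply/orP; left.
  apply/eqP; congr `|_|; rewrite /germ (_ : E X [::] a = 1)// (_ : E Y [::] a = 1)//.
  rewrite XYE; last exact: le_trans bT.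
  by rewrite /weighted1 /weighted2 /space2 /time_aug1 !liftK level1//; ring.
have [Xs Xh _ _ _] := grp_rough X; have [Ys Yh _ _ _] := grp_rough Y.
have XY : grp_val X = grp_val Y.
  apply: injective_projections; apply/funext => s; apply/funext => t.
    have [/andP[st tT]|st] := boolP (s <= t <= T).
      apply/funext => w; have [|w1] := eqVneq (size w) 1%N.
        by case: w => [|i [|]]// _; exact: level1.
      by rewrite (Xh s t).1 ?(Yh s t).1.
    by have [-> _] := Xs _ _ st; have [-> _] := Ys _ _ st.
  have [/andP[st tT]|st] := boolP (s <= t <= T).
    apply/funext => w; have [|w2] := eqVneq (size w) 2%N.
      by case: w => [|i [|j [|]]]// _; exact: level2.
    by rewrite (Xh s t).2 ?(Yh s t).2.
  by have [_ ->] := Xs _ _ st; have [_ ->] := Ys _ _ st.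
case: (X) (Y) XY => [x xr xg] [y yr yg] /= xy.
by subst y; congr GeoRoughPath; exact: Prop_irrelevance.
Qed.

End continuity.

(** * The theorem of Stone and Weierstrass *)
Section absolute_value_by_polynomials.
Context {R : realType}.

(** Newton's iteration for [p ^+ 2 = y ^+ 2] with a constant slope; it increases to
    the absolute value on [-1, 1] and involves only polynomials in [y]. *)
Fixpoint abs_approx (n : nat) (y : R) : R :=
  if n is n'.+1 then
    abs_approx n' y + (y ^+ 2 - abs_approx n' y ^+ 2) / 2
  else 0.

Lemma abs_approx_bounds n (y : R) : `|y| <= 1 ->
  0 <= abs_approx n y <= `|y| /\
  `|y| - abs_approx n y <= `|y| * (1 - `|y| / 2) ^+ n.
Proof.
move=> y1; have y0 := normr_ge0 y; have yy : y ^+ 2 = `|y| ^+ 2 by rewrite real_normK ?num_real.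
elim: n => [|n [/andP[p0 py] ih]] /=; first by rewrite lexx y0 subr0 expr0 mulr1.
rewrite yy; set p := abs_approx n y in p0 py ih *.
have E : `|y| - (p + (`|y| ^+ 2 - p ^+ 2) / 2) = (`|y| - p) * (1 - (`|y| + p) / 2) by field.
have d0 : 0 <= `|y| - p by rewrite subr_ge0.
have f0 : 0 <= 1 - (`|y| + p) / 2 by lra.
split.
  apply/andP; split; last by rewrite -subr_ge0 E mulr_ge0.
  have : p ^+ 2 <= `|y| ^+ 2 by rewrite lerXn2r.
  lra.
rewrite E exprSr mulrA; apply: ler_pM => //; lra.
Qed.

(** With [x] the absolute value, [x * (1 - x / 2) ^+ n] is of order [1 / n] by
    Bernoulli's inequality. *)
Lemma abs_approx_error n (y : R) : `|y| <= 1 ->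
  `| `|y| - abs_approx n.+1 y| <= 2 / n.+1%:R.
Proof.
move=> y1; have [/andP[_ py] h] := abs_approx_bounds n.+1 y1.
rewrite ger0_norm ?subr_ge0//; apply: (le_trans h).
have y0 := normr_ge0 y.
set q := (1 - `|y| / 2) ^+ n.+1.
have q0 : 0 <= q by rewrite exprn_ge0//; lra.
have : (1 + n.+1%:R * (`|y| / 2)) * q <= 1.
  apply: (@le_trans _ _ ((1 + `|y| / 2) ^+ n.+1 * q)).
    by apply: ler_wpM2r => //; apply: powR_bernoulli; lra.
  rewrite /q -exprMn; apply: exprn_ile1; first by apply: mulr_ge0; lra.
  have : 0 <= (`|y| / 2) ^+ 2 by exact: sqr_ge0.
  rewrite expr2; lra.
rewrite ler_pdivlMr ?ltr0n// => hq; have : n.+1%:R * (`|y| / 2) * q <= 1 by lra.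
lra.
Qed.

End absolute_value_by_polynomials.

Section stone_weierstrass.
Context {T : topologicalType} {R : realType} (K : set T) (A : set (T -> R)).
Hypothesis compactK : compact K.
Hypothesis A_continuous : forall f, A f -> continuous f.
Hypothesis A_cst : forall c, A (fun=> c).
Hypothesis A_add : forall f g, A f -> A g -> A (fun x => f x + g x).
Hypothesis A_mul : forall f g, A f -> A g -> A (fun x => f x * g x).
Hypothesis A_separates : forall x y, K x -> K y -> x <> y -> exists2 f, A f & f x <> f y.

Definition uniform_closure : set (T -> R) := [set f | continuous f /\
  forall e, 0 < e -> exists2 g, A g & forall x, K x -> `|f x - g x| <= e].
Local Notation B := uniform_closure.

Let A_sub f : A f -> B f.
Proof.
move=> Af; split; first exact: A_continuous.
by move=> e e0; exists f => // x _; rewrite subrr normr0 ltW.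
Qed.

Let B_add f g : B f -> B g -> B (fun x => f x + g x).
Proof.
move=> [cf hf] [cg hg]; split; first by move=> x; apply: continuousD; [exact: cf|exact: cg].
move=> e e0; have e20 : 0 < e / 2 by lra.
have [f' Af' hf'] := hf _ e20; have [g' Ag' hg'] := hg _ e20.
exists (fun x => f' x + g' x); first exact: A_add.
move=> x Kx; have -> : f x + g x - (f' x + g' x) = (f x - f' x) + (g x - g' x) by ring.
by rewrite (le_trans (ler_normD _ _))// [leRHS]splitr lerD ?hf' ?hg'.
Qed.

Let B_scale c f : B f -> B (fun x => c * f x).
Proof.
move=> [cf hf]; split.
  by move=> x; apply: continuousM; [exact: cst_continuous|exact: cf].
move=> e e0; have c1 : 0 < `|c| + 1 by rewrite ltr_wpDl.
have [f' Af' hf'] := hf _ (divr_gt0 e0 c1).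
exists (fun x => c * f' x); first by apply: A_mul.
move=> x Kx; rewrite -mulrBr normrM.
by apply: ler_mul_small => //; exact: hf'.
Qed.

Let A_abs_approx f c n : A f -> A (fun x => abs_approx n (c * f x)).
Proof.
move=> Af; have Acf : A (fun x => c * f x) by apply: A_mul.
elim: n => [|n ih] /=; first exact: A_cst.
have -> : (fun x => abs_approx n (c * f x) +
    ((c * f x) ^+ 2 - abs_approx n (c * f x) ^+ 2) / 2) =
  (fun x => abs_approx n (c * f x) + (2^-1 * ((c * f x) * (c * f x)) +
    (- 2^-1) * (abs_approx n (c * f x) * abs_approx n (c * f x)))).
  by apply/funext => x; ring.
apply: A_add => //; apply: A_add; apply: A_mul => //; exact: A_mul.
Qed.

Let bounded_on_K (f : T -> R) : continuous f -> exists2 N : R, 0 < N & forall x, K x -> `|f x| <= N.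
Proof.
move=> cf; have cfK : compact (f @` K).
  by apply: continuous_compact => //; exact: continuous_subspaceT.
have [N [_ hN]] := @compact_bounded R R^o _ cfK.
exists (`|N| + 1); first by rewrite ltr_wpDl.
move=> x Kx; apply: (hN (`|N| + 1)); last by exists x.
by rewrite (le_lt_trans (ler_norm _))// ltrDl.
Qed.

Let A_abs f : A f -> B (fun x => `|f x|).
Proof.
move=> Af; split.
  by move=> x; exact: (cvg_norm (A_continuous Af (x := x))).
move=> e e0; have [N N0 hN] := bounded_on_K (A_continuous Af).
pose n := Num.bound (2 * N / e).
have nN : 2 * N / e < n.+1%:R.
  apply: lt_le_trans (_ : n%:R <= _); last by rewrite ler_nat.
  by apply: archi_boundP; rewrite divr_ge0 ?mulr_ge0 ?ltW.
exists (fun x => N * abs_approx n.+1 (N^-1 * f x)).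
  by apply: A_mul => //; exact: A_abs_approx.
move=> x Kx.
have y1 : `|N^-1 * f x| <= 1.
  by rewrite normrM gtr0_norm ?invr_gt0// mulrC ler_pdivrMr// mul1r hN.
have -> : `|f x| - N * abs_approx n.+1 (N^-1 * f x) =
    N * (`|N^-1 * f x| - abs_approx n.+1 (N^-1 * f x)).
  rewrite normrM gtr0_norm ?invr_gt0//; field; exact: lt0r_neq0.
rewrite normrM gtr0_norm//.
apply: (@le_trans _ _ (N * (2 / n.+1%:R))).
  by apply: ler_wpM2l; [exact: ltW|exact: abs_approx_error].
rewrite mulrA ler_pdivrMr ?ltr0n//.
by move: nN; rewrite ltr_pdivrMr//; lra.
Qed.

Let B_abs f : B f -> B (fun x => `|f x|).
Proof.
move=> [cf hf]; split.
  by move=> x; exact: (cvg_norm (cf x)).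
move=> e e0; have e20 : 0 < e / 2 by lra.
have [g Ag hg] := hf _ e20.
have [_ /(_ _ e20)[h Ah hh]] := A_abs Ag.
exists h => // x Kx.
have -> : `|f x| - h x = (`|f x| - `|g x|) + (`|g x| - h x) by ring.
rewrite (le_trans (ler_normD _ _))// [leRHS]splitr lerD ?hh//.
exact: le_trans (ler_dist_dist _ _) (hg _ Kx).
Qed.

Let B_max f g : B f -> B g -> B (fun x => Num.max (f x) (g x)).
Proof.
move=> Bf Bg.
have -> : (fun x => Num.max (f x) (g x)) =
    (fun x => 2^-1 * ((f x + g x) + `|f x + (-1) * g x|)).
  apply/funext => x; rewrite mulN1r; have [h|h] := leP (f x) (g x).
    by rewrite ler0_norm ?subr_le0//; lra.
  by rewrite gtr0_norm ?subr_gt0//; lra.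
by apply: B_scale; apply: B_add; [exact: B_add|apply: B_abs; apply: B_add => //; exact: B_scale].
Qed.

Let B_max_seq (L : seq (T -> R)) f0 : B f0 -> (forall f, f \in L -> B f) ->
  exists g, [/\ B g, forall f z, f \in L -> f z <= g z &
    forall z c, f0 z <= c -> (forall f, f \in L -> f z <= c) -> g z <= c].
Proof.
move=> B0; elim: L => [_|f L ih BL]; first by exists f0; split.
have [|g [Bg hg1 hg2]] := ih; first by move=> h hL; apply: BL; rewrite inE hL orbT.
exists (fun x => Num.max (f x) (g x)); split.
- by apply: B_max => //; apply: BL; rewrite mem_head.
- move=> h z; rewrite inE le_max => /predU1P[->|/hg1 ->]; by rewrite ?lexx ?orbT.
- move=> z c h0 hL; rewrite ge_max hL ?mem_head//= hg2// => h hh.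
  by rewrite hL// inE hh orbT.
Qed.

Let cover_seq (U : T -> set T) : (forall x, K x -> open (U x)) ->
  (forall x, K x -> U x x) ->
  exists2 L : seq T, (forall x, x \in L -> K x) & forall z, K z -> exists2 x, x \in L & U x z.
Proof.
move=> oU hU; have [[x0 Kx0]|noK] := pselect (exists x, K x); last first.
  by exists [::] => // z Kz; case: noK; exists z.
(* compactness only depends on the topology, so that [x0] may serve as a base
   point *)
pose pT : ptopologicalType := HB.pack T (isPointed.Build T x0).
have : @compact pT K by exact: compactK.
rewrite compact_cover => /(_ T K U oU).
case=> [z Kz|D DK KD]; first by exists z => //; exact: hU.
exists (enum_fset D) => [x xD|z /KD[x /= xD Uxz]]; last by exists x.
by have := DK x xD; rewrite inE.
Qed.

Context (F : T -> R) (contF : continuous F).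

Let interpolate x y : K x -> K y -> exists h, [/\ A h, h x = F x & h y = F y].
Proof.
move=> Kx Ky; have [->|xy] := pselect (x = y); first by exists (fun=> F y); split.
have [f Af fxy] := A_separates Kx Ky xy.
pose c := (F y - F x) / (f y - f x).
exists (fun z => (F x - c * f x) + c * f z); split.
- by apply: A_add => //; apply: A_mul.
- by ring.
- rewrite /c; field; by rewrite subr_eq0; apply/eqP => h; apply: fxy.
Qed.

Let continuous_gap (g : T -> R) : continuous g ->
  continuous (fun z => g z + (- 1) * F z).
Proof.
move=> cg z; have cF : {for z, continuous (fun z => (- 1) * F z)}.
  by apply: continuousM; [exact: cst_continuous|exact: contF].
exact: (continuousD (cg z) cF).
Qed.

Let open_above (g : T -> R) c : continuous g -> open [set z | F z + c < g z].
Proof.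
move=> cg; have -> : [set z | F z + c < g z] = (fun z => g z + (- 1) * F z) @^-1` [set x | x > c].
  by apply/seteqP; split => z /=; lra.
apply: open_comp; last exact: open_gt.
by move=> z _; exact: continuous_gap.
Qed.

Let open_below (g : T -> R) c : continuous g -> open [set z | g z < F z + c].
Proof.
move=> cg; have -> : [set z | g z < F z + c] = (fun z => g z + (- 1) * F z) @^-1` [set x | x < c].
  by apply/seteqP; split => z /=; lra.
apply: open_comp; last exact: open_lt.
by move=> z _; exact: continuous_gap.
Qed.

Let above e x : 0 < e -> K x ->
  exists g, [/\ B g, g x <= F x & forall z, K z -> F z - e < g z].
Proof.
move=> e0 Kx.
have /choice[h hP] : forall y, exists h, K y -> [/\ A h, h x = F x & h y = F y].
  move=> y; have [Ky|nKy] := pselect (K y); last by exists (fun=> 0).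
  by have [h hP] := interpolate Kx Ky; exists h.
pose U y := [set z | F z + (- e) < h y z].
have [L LK KL] : exists2 L : seq T, (forall y, y \in L -> K y) &
    forall z, K z -> exists2 y, y \in L & U y z.
  apply: cover_seq => y Ky.
    by apply: open_above; apply: A_continuous; have [] := hP y Ky.
  by rewrite /U /=; have [_ _ ->] := hP y Ky; rewrite gtrDl oppr_lt0.
have [|f fL|g [Bg hg1 hg2]] := @B_max_seq (map h L) (fun=> F x).
- by apply: A_sub; exact: A_cst.
- by move: fL => /mapP[y yL ->]; apply: A_sub; have [] := hP y (LK y yL).
exists g; split => //.
  by apply: hg2 => // f /mapP[y yL ->]; have [_ -> _] := hP y (LK y yL).
move=> z /KL[y yL]; rewrite /U/= => h1; apply: (lt_le_trans h1); apply: hg1.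
by apply/mapP; exists y.
Qed.

(** The uniform closure of [A] on [K] is a lattice, since the absolute value is a
    limit of polynomials.  Functions of [A] interpolate [F] at any two points;
    by compactness, a finite maximum of those that agree with [F] at [x] is above
    [F - e / 3], and a finite minimum of such maxima is also below [F + e / 3]. *)
Theorem stone_weierstrass e : 0 < e ->
  exists2 f, A f & forall x, K x -> `|F x - f x| < e.
Proof.
move=> e0; have [[x0 Kx0]|noK] := pselect (exists x, K x); last first.
  by exists (fun=> 0) => // x Kx; case: noK; exists x.
have e30 : 0 < e / 3 by lra.
have /choice[h hP] : forall x, exists g, K x ->
    [/\ B g, g x <= F x & forall z, K z -> F z - e / 3 < g z].
  move=> x; have [Kx|nKx] := pselect (K x); last by exists (fun=> 0).
  by have [g hg] := above e30 Kx; exists g.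
have [L LK KL] : exists2 L : seq T, (forall x, x \in L -> K x) &
    forall z, K z -> exists2 x, x \in L & h x z < F z + e / 3.
  apply: (@cover_seq (fun x => [set z | h x z < F z + e / 3])) => x Kx.
    by apply: open_below; have [[]] := hP x Kx.
  by have [_ h1 _] := hP x Kx; rewrite /=; lra.
have [|f fL|g [Bg hg1 hg2]] :=
    @B_max_seq [seq (fun z => -1 * h x z) | x <- L] (fun z => -1 * h x0 z).
- by apply: B_scale; have [] := hP x0 Kx0.
- by move: fL => /mapP[x xL ->]; apply: B_scale; have [] := hP x (LK x xL).
have [_ /(_ _ e30)[f Af hf]] := B_scale (-1) Bg.
exists f => // z Kz.
have [x xL hx] := KL z Kz.
have g1 : -1 * h x z <= g z by apply: (hg1 (fun z => -1 * h x z)); apply/mapP; exists x.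
have g2 : g z <= - (F z - e / 3).
  apply: hg2; first by have [_ _ /(_ z Kz)] := hP x0 Kx0; lra.
  by move=> f' /mapP[y yL ->]; have [_ _ /(_ z Kz)] := hP y (LK y yL); lra.
have := hf z Kz; rewrite ler_norml => /andP[f1 f2].
by rewrite ltr_norml; apply/andP; split; lra.
Qed.

End stone_weierstrass.

(** * Functionals as finitely supported tensors *)
Section representation_by_finite_tensors.
Context {R : realType} {m : nat}.

Lemma pairing_of_seq (L : seq (R * seq 'I_m)) :
  exists ell : {fsfun seq 'I_m -> R with 0},
    forall q : tensor R m, pairing ell q = \sum_(p <- L) p.1 * q p.2.
Proof.
pose S : {fset seq 'I_m} := [fset w in map snd L]%fset.
pose c (w : seq 'I_m) : R := \sum_(p <- L | p.2 == w) p.1.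
exists [fsfun w in S => c w | 0] => q.
rewrite /pairing (@big_fset_incl _ _ _ _ _ S).
- rewrite (eq_big_seq (fun w => \sum_(p <- L | p.2 == w) p.1 * q p.2)); last first.
    move=> w wS; rewrite fsfunE wS /c mulr_suml.
    by apply: eq_bigr => p /eqP ->.
  rewrite (exchange_big_dep predT)//=; apply: eq_big_seq => p pL.
  under eq_bigl do rewrite eq_sym.
  rewrite -big_filter (filter_pred1_uniq (fset_uniq S)) ?big_seq1//.
  by rewrite in_fset map_f.
- by apply/fsubsetP => w; rewrite mem_finsupp fsfunE; case: ifP => //; rewrite eqxx.
- by move=> w _; rewrite mem_finsupp negbK => /eqP ->; rewrite mul0r.
Qed.

End representation_by_finite_tensors.

Section efm_signature_coordinates.
Context {R : realType} {d : nat} (T alpha : R) (lam : 'rV[R]_d.+1) (rho : 'rV[R]_d).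
Context (alpha_gt : 1 / 3 < alpha) (alpha_le : alpha <= 1 / 2).
Context (delta : R) (delta_gt0 : 0 < delta).
Hypothesis lam_gt0 : forall k, 0 < lam 0 k.
Hypothesis delta_clock : delta <= lam 0 ord0.
Hypothesis delta_space : forall i : 'I_d, delta <= lam 0 (lift ord0 i) - rho 0 i.

Lemma efm_signatureE (X : geo_rough_path T alpha rho) w :
  efm_signature lam (time_aug X) T w =
  iter_sig (weighted1 lam X) (weighted2 lam X) (rev w) T.
Proof.
have [M M0 XM] := norm_le_exists X.
rewrite /efm_signature (efm_levelE alpha_gt alpha_le M0 XM delta_gt0)//.
by rewrite subrr mulr0 expR0 mul1r.
Qed.

End efm_signature_coordinates.


Theorem theorem4p10 (R : realType) (d : nat) (T alpha : R)
    (alpha_gt : 1 / 3 < alpha) (alpha_le : alpha <= 1 / 2)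
    (lam : 'rV[R]_d.+1) (rho : 'rV[R]_d)
    (lam_gt0 : forall k : 'I_d.+1, 0 < lam 0 k)
    (rho_lam : forall i : 'I_d, 0 < rho 0 i < lam 0 (lift ord0 i))
    (K : set (geo_rough_path T alpha rho)) (compactK : compact K)
    (F : geo_rough_path T alpha rho -> R) (contF : continuous F)
    (eps : R) (eps_gt0 : 0 < eps) :
  exists ell : {fsfun seq 'I_d.+1 -> R with 0},
    forall X : geo_rough_path T alpha rho, K X ->
      `|F X - pairing ell (efm_signature lam (time_aug X) T)| < eps.
Proof.
(* [delta] bounds from below all the margins between decay and growth; time does
   not grow *)
pose gap (k : 'I_d.+1) := lam 0 k - if unlift ord0 k is Some i then rho 0 i else 0.
have [delta delta_gt0 hdelta] : exists2 delta, 0 < delta & forall k, delta <= gap k.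
  apply: exists_pos_lower_bound => k; rewrite /gap.
  case: (unliftP ord0 k) => [i ->|_]; last by rewrite subr0.
  by rewrite subr_gt0; case/andP: (rho_lam i).
have delta_clock : delta <= lam 0 ord0.
  by have := hdelta ord0; rewrite /gap unlift_none subr0.
have delta_space i : delta <= lam 0 (lift ord0 i) - rho 0 i.
  by have := hdelta (lift ord0 i); rewrite /gap liftK.
pose e (X : geo_rough_path T alpha rho) r :=
  iter_sig (weighted1 lam X) (weighted2 lam X) r T.
pose A : set (geo_rough_path T alpha rho -> R) := [set f | exists L, f = fun X => ev (e X) L].
have [|c|f g [L ->] [L' ->]|f g [L ->] [L' ->]|X Y _ _ XY|f [L fL] hf] :=
    @stone_weierstrass _ R K A compactK _ _ _ _ _ F contF _ eps_gt0.
- move=> f [L ->] X; elim: L => [|p L ih].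
    by under eq_fun do rewrite ev_nil; exact: cst_continuous.
  under eq_fun do rewrite ev_cons.
  have c1 : {for X, continuous (fun Y => p.1 * e Y p.2)}.
    apply: continuousM; first exact: cst_continuous.
    exact: (sig_continuous alpha_gt alpha_le delta_gt0).
  exact: (continuousD c1 ih).
- by exists [:: (c, [::])]; apply/funext => X; rewrite ev_cons ev_nil /e/= mulr1 addr0.
- by exists (L ++ L'); apply/funext => X; rewrite ev_cat.
- exists (shuffle_mul L L'); apply/funext => X; rewrite ev_mul// => u v.
  have [M M0 XM] := norm_le_exists X.
  have HA : almost_rough T alpha delta (norm_le M : set (geo_rough_path T alpha rho))
    (weighted1 lam (rho := rho)) (weighted2 lam (rho := rho)) by exact: weighted_almost_rough.
  apply: (sig_shuffle alpha_gt delta_gt0 HA _ u v XM (lexx T)) => i j.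
  exact: weighted_geometric.
- have [r er] : exists r, e X r <> e Y r.
    apply/existsNP => h; apply: XY.
    exact: (sig_injective alpha_gt alpha_le delta_gt0 lam_gt0 delta_clock delta_space).
  exists (fun X => ev (e X) [:: (1, r)]); first by exists [:: (1, r)].
  by rewrite !ev_cons !ev_nil !mul1r !addr0.
have [ell hell] := pairing_of_seq [seq (p.1, rev p.2) | p <- L].
exists ell => X KX.
have -> : pairing ell (efm_signature lam (time_aug X) T) = f X; last exact: hf.
rewrite hell fL /ev big_map; apply: eq_bigr => p _ /=.
by rewrite (efm_signatureE alpha_gt alpha_le delta_gt0)// revK.
Qed.
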